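(* Let $\{X(n) : n\ge 0\}$ be a $\psi$-irreducible and aperiodic discrete-time Markov chain with transition kernel $P$ on a measurable space $(\mathsf{X},\mathcal{B})$ whose $\sigma$-algebra $\mathcal{B}$ is countably generated, with invariant probability measure $\pi$. Suppose that the chain admits a spectral gap in $L_2=L_2(\pi)$. Then, for any $h\in L_2$, there is a $\pi$-integrable function $V_h:\mathsf{X}\to[1,\infty]$ such that the chain is geometrically ergodic with Lyapunov function $V_h$ and $h\in L_\infty^{V_h}$.
   Context: Kernels: $P^n(x,A)=\Pr\{X(n)\in A\mid X(0)=x\}$, $P=P^1$, and $PF(x)=\int_{\mathsf{X}}P(x,dy)F(y)$ whenever the integral exists. $\psi$-irreducible and aperiodic: there is a nonzero $\sigma$-finite measure $\psi$ on $(\mathsf{X},\mathcal{B})$ such that for every $A\in\mathcal{B}$ with $\psi(A)>0$ and every $x\in\mathsf{X}$, $P^n(x,A)>0$ for all $n$ sufficiently large; moreover $\psi$ is maximal, in the sense that any other such $\psi'$ is absolutely continuous with respect to $\psi$. Small set: $C\in\mathcal{B}$ is small if there exist $n\ge1$, $\epsilon>0$ and a probability measure $\nu$ on $(\mathsf{X},\mathcal{B})$ with $P^n(x,A)\ge\epsilon\,\mathbb{I}_C(x)\nu(A)$ for all $x\in\mathsf{X}$, $A\in\mathcal{B}$. Geometrically ergodic with Lyapunov function $V$: $V:\mathsf{X}\to[1,\infty]$ is a measurable function, finite for at least one $x$, for which there exist a small set $C\subset\mathsf{X}$ and constants $\delta>0$, $b<\infty$ such that $PV\le(1-\delta)V+b\,\mathbb{I}_C$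 on $\mathsf{X}$. The space $L_\infty^V$: the space of measurable $F:\mathsf{X}\to\mathbb{C}$ with $\|F\|_V=\sup_{x\in\mathsf{X}}|F(x)|/V(x)<\infty$ (with $|F(x)|/\infty=0$). Spectral gap in $L_2$: $L_2=L_2(\pi)$ is the Hilbert space of measurable $F:\mathsf{X}\to\mathbb{C}$ that are square-integrable under $\pi$, with norm $\|F\|_2=[\int|F|^2d\pi]^{1/2}$, and $P$ is viewed as a linear operator on $L_2$. Its spectrum $\mathcal{S}_2$ is the set of nonzero $\lambda\in\mathbb{C}$ for which the inverse $(I\lambda-P)^{-1}$ does not exist as a bounded linear operator on $L_2$. A pole of finite multiplicity $m$ is an isolated point $\lambda_0$ of the spectrum whose associated spectral projection $\frac{1}{2\pi i}\oint(Iz-P)^{-1}dz$ (over a small circle around $\lambda_0$ enclosing no other point of the spectrum) has finite rank $m$. The chain (equivalently, $P$) admits a spectral gap in $L_2$ if there exists $\varepsilon_0>0$ such that $\mathcal{S}_2\cap\{z:|z|\ge1-\varepsilon_0\}$ is finite and contains only poles of finite multiplicity. *)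

(* Defs.v *)
From HB Require Import structures.
From mathcomp Require Import all_boot all_order all_algebra.
From mathcomp Require Import complex.
From mathcomp Require Import all_classical all_reals all_analysis.
From mathcomp Require Import measurable_realfun.

Set Implicit Arguments.
Unset Strict Implicit.
Unset Printing Implicit Defensive.
Import Order.TTheory GRing.Theory Num.Theory.
Import numFieldNormedType.Exports.
Import Normc.

Local Open Scope classical_set_scope.
Local Open Scope ring_scope.

Section Kernels.
Context (d : measure_display) (T : measurableType d) (R : realType).
Implicit Types (P : R.-pker T ~> T) (mu : probability T R).

Definition countably_generated : Prop :=
  exists G : set (set T), countable G /\ @measurable d T = <<s G >>.

Fixpoint kernel_iter P (n : nat) (x : T) (A : set T) : \bar R :=
  if n is m.+1 then (\int[P x]_y kernel_iter P m y A)%E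
  else (\d_x A)%E.

Definition invariant_probability P mu : Prop :=
  forall A, measurable A -> (\int[mu]_x P x A)%E = mu A.

Definition irreducible_aperiodic_for P
    (psi : {sigma_finite_measure set T -> \bar R}) : Prop :=
  psi setT != 0%E /\
  forall A, measurable A -> (0 < psi A)%E ->
    forall x, \forall n \near \oo, (0 < kernel_iter P n x A)%E.

Definition psi_irreducible_aperiodic P : Prop :=
  exists psi : {sigma_finite_measure set T -> \bar R},
    irreducible_aperiodic_for P psi /\
    forall psi' : {sigma_finite_measure set T -> \bar R},
      irreducible_aperiodic_for P psi' -> psi' `<< psi.

Definition small_set P (C : set T) : Prop :=
  measurable C /\
  exists (n : nat) (eps : R) (nu : probability T R),
    [/\ (1 <= n)%N, 0 < eps &
      forall x A, measurable A ->
        (eps%:E * (\1_C x)%:E * nu A <= kernel_iter P n x A)%E].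

(* At points where V is infinite the right-hand side uses the convention
   0 * +oo = 0, which only matters for delta = 1. *)
Definition geometrically_ergodic P (V : T -> \bar R) : Prop :=
  [/\ measurable_fun setT V,
      forall x, (1 <= V x)%E,
      exists x, (V x < +oo)%E &
      exists (C : set T) (delta b : R),
        [/\ small_set P C, 0 < delta &
          forall x, (\int[P x]_y V y <=
                     (1 - delta)%:E * V x + (b * \1_C x)%:E)%E]].

Definition cmeasurable (F : T -> R[i]) : Prop :=
  measurable_fun setT (fun x => complex.Re (F x)) /\
  measurable_fun setT (fun x => complex.Im (F x)).

(* Division in \bar R satisfies _ / +oo = 0. *)
Definition LVnorm (V : T -> \bar R) (F : T -> R[i]) : \bar R :=
  ereal_sup (range (fun x => ((normc (F x))%:E / V x)%E)).

Definition LVinfty (V : T -> \bar R) (F : T -> R[i]) : Prop :=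
  cmeasurable F /\ (LVnorm V F < +oo)%E.

(* PF; the value is junk where the integral does not exist.  For F in L_2(mu)
   with mu invariant, this happens only on a mu-null set. *)
Definition Kop P (F : T -> R[i]) (x : T) : R[i] :=
  Complex (\int[P x]_y complex.Re (F y)) (\int[P x]_y complex.Im (F y)).

End Kernels.

(* Elements of the Hilbert space L_2 are handled through representatives:
   equality in L_2 is mu-almost everywhere equality, and an operator is a map
   on representatives.  A map satisfying [bounded_op] respects almost
   everywhere equality, since almost everywhere equal functions are at L_2
   distance 0. *)
Section L2.
Context (d : measure_display) (T : measurableType d) (R : realType).
Variable mu : probability T R.
Implicit Types (F G : T -> R[i]) (Q S : (T -> R[i]) -> (T -> R[i])).

Definition L2norm F : \bar R := Lnorm mu 2%:E (fun x => (normc (F x))%:E).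

Definition L2 F : Prop := cmeasurable F /\ (L2norm F < +oo)%E.

Definition bounded_op Q : Prop :=
  [/\ forall F, L2 F -> L2 (Q F),
      forall (a : R[i]) F G, L2 F -> L2 G ->
        Q (fun x => a * F x + G x) = (fun x => a * Q F x + Q G x) %[ae mu] &
      exists M : R, forall F, L2 F -> (L2norm (Q F) <= M%:E * L2norm F)%E].

Definition has_rank Q (m : nat) : Prop :=
  exists e : 'I_m -> T -> R[i],
    [/\ forall i, exists2 F, L2 F & e i = Q F %[ae mu],
        forall c : 'I_m -> R[i],
          (fun x => \sum_(i < m) c i * e i x) = (fun=> 0) %[ae mu] ->
          forall i, c i = 0 &
        forall F, L2 F -> exists c : 'I_m -> R[i],
          Q F = (fun x => \sum_(i < m) c i * e i x) %[ae mu]].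

(* S is the Riemann integral over [a, b] of the operator-valued function Phi:
   tagged Riemann sums converge to S in operator norm as the mesh tends to 0. *)
Definition is_op_Rint (Phi : R -> (T -> R[i]) -> (T -> R[i])) (a b : R) S :
    Prop :=
  bounded_op S /\
  forall eps : R, 0 < eps -> exists2 eta : R, 0 < eta &
    forall (n : nat) (t s : nat -> R),
      t 0%N = a -> t n = b ->
      (forall i, (i < n)%N ->
        [/\ t i <= s i, s i <= t i.+1 & t i.+1 - t i <= eta]) ->
      forall F, L2 F ->
        (L2norm (fun x =>
           ((\sum_(i < n) (t i.+1 - t i)%:C%C * Phi (s i) F x) - S F x)%R)
         <= eps%:E * L2norm F)%E.

Definition cexp (theta : R) : R[i] := Complex (cos theta) (sin theta).

Definition circle_point (z0 : R[i]) (r theta : R) : R[i] :=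
  z0 + r%:C%C * cexp theta.

(* S is the integral of Phi(z) dz over the positively oriented circle of
   centre z0 and radius r, with dz = i r exp(i theta) dtheta. *)
Definition is_circle_int (Phi : R[i] -> (T -> R[i]) -> (T -> R[i]))
    (z0 : R[i]) (r : R) S : Prop :=
  is_op_Rint
    (fun theta F x =>
       Complex 0 1 * r%:C%C * cexp theta * Phi (circle_point z0 r theta) F x)
    0 (2 * pi) S.

Variable P : R.-pker T ~> T.

Definition is_resolvent (z : R[i]) Q : Prop :=
  bounded_op Q /\
  forall F, L2 F ->
    Q (fun x => z * F x - Kop P F x) = F %[ae mu] /\
    (fun x => z * Q F x - Kop P (Q F) x) = F %[ae mu].

Definition resolvent_set : set (R[i]) :=
  [set z | exists Q, is_resolvent z Q].

Definition spectrum2 : set (R[i]) :=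
  [set z | z != 0 /\ ~ resolvent_set z].

(* The punctured disc is required to lie in the resolvent set rather than in
   the complement of [spectrum2]: the latter always contains 0, where the
   resolvent need not exist.  For small r there is no difference, since
   z0 != 0. *)
Definition is_pole (z0 : R[i]) (m : nat) : Prop :=
  spectrum2 z0 /\
  exists2 r : R, 0 < r &
    (forall z, 0 < normc (z - z0) <= r -> resolvent_set z) /\
    exists (Rz : R[i] -> (T -> R[i]) -> (T -> R[i])) S,
      [/\ forall z, normc (z - z0) = r -> is_resolvent z (Rz z),
          is_circle_int Rz z0 r S &
          has_rank (fun F x => (2 * pi%:C%C * Complex 0 1)^-1 * S F x) m].

Definition L2_spectral_gap : Prop :=
  exists2 eps0 : R, 0 < eps0 &
    finite_set (spectrum2 `&` [set z | 1 - eps0 <= normc z]) /\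
    forall z, spectrum2 z -> 1 - eps0 <= normc z -> exists m, is_pole z m.

End L2.

(* Main.v *)
(** Let P_0 be P acting on the mean-zero part of L_2.  At a point z of the
    unit circle the resolvent exists or z is a pole of finite rank; in the
    latter case a nonzero Riesz projection on mean-zero vectors would yield an
    eigenvector.  Equality in Jensen's inequality shows that an eigenfunction f
    for z satisfies f(X(n)) = z^n f(x) almost surely, which together with
    irreducibility and aperiodicity makes f constant.  So z - P_0 is bounded
    below uniformly on the unit circle, and comparing averages of resolvents
    over two circles of radii 1 + eta and 1 - eta gives |P_0^n| <= K rho^n with
    rho < 1.

    Some P^n has a component that is absolutely continuous with respect to the
    product measure mu x mu, with density bounded below on a set H of positive
    measure; chaining P^n, P^k, P^n with k large, where P^k is close to mu in
    L_2, gives P^m >= eps 1_C (x) mu(. & B) everywhere, so C is small.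

    With g = 1 + |h| and Q = P^m - eps 1_C (x) mu(. & B), the spectral gap makes
    the L_2 norms of Q^j g decay geometrically, so that W = sum_j r^j Q^j g is
    integrable for some r > 1 and P^m W <= r^-1 W + b 1_C.  Taking q with
    q^m = r^-1, the function V = sum_(i < m) q^-i P^i W is the required Lyapunov
    function. *)

Require Import Defs.
From HB Require Import structures.
From mathcomp Require Import all_boot all_order all_algebra.
From mathcomp Require Import complex.
From mathcomp Require Import all_classical all_reals all_analysis.
From mathcomp Require Import measurable_realfun.
From mathcomp Require Import zify ring lra.
Set Implicit Arguments.
Unset Strict Implicit.
Unset Printing Implicit Defensive.
Import Order.TTheory GRing.Theory Num.Theory.
Import numFieldNormedType.Exports.
Import Normc.
Local Open Scope classical_set_scope.
Local Open Scope ring_scope.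

(** * Linear operators with poles of finite rank *)

(** The Riesz integral is never deformed. Its Riemann sum at n equidistant nodes of the circle of
    centre z0 and radius r equals exactly (1 - ((P - z0)/r)^n)^-1, so idempotence, commutation with
    P and invariance of the mean-zero part are algebraic identities that pass to the limit. The same
    averages around 0 give the decay of P_0^n without a spectral radius formula. Small sets and
    drift are claims about every point, whereas L_2 sees only almost every point. Two devices bridge
    this. Countable generation turns a minorization that holds almost everywhere for each set into
    one that holds, off a single null set, for all sets at once. And Q acts on [0, +oo]-valued
    functions defined everywhere, so that W may be infinite on a null set while its drift inequality
    holds at each point. The norms of Q^j g decay because the mean of Q f is the integral of f
    against the weight 1 - eps mu(C) 1_B, whose L_2 norm is below 1, while further powers of P^m,
    which dominates Q, damp everything but the mean. *)

Section IterLinear.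
Context (K : fieldType) (V : lmodType K) (D : {linear V -> V}).

Lemma iter_is_linear n : linear (iter n D).
Proof. by elim: n => [|n IH] a u v //=; rewrite IH linearP. Qed.

HB.instance Definition _ n :=
  GRing.isLinear.Build K V V *:%R (iter n D) (iter_is_linear n).

Lemma iterZ n a v : iter n D (a *: v) = a *: iter n D v.
Proof. exact: linearZ. Qed.

Lemma iterB n u v : iter n D (u - v) = iter n D u - iter n D v.
Proof. exact: linearB. Qed.

Lemma iter_sum n (I : Type) (s : seq I) (F : I -> V) :
  iter n D (\sum_(i <- s) F i) = \sum_(i <- s) iter n D (F i).
Proof. exact: linear_sum. Qed.

(** The factorisation of w^n - D^n by w - D, applied to [S u]. The truncation in [n.-1] is harmless,
    the sum being empty for [n = 0]. *)
Lemma resolvent_iter (w : K) (S : V -> V) u n :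
  (forall v, w *: S v - D (S v) = v) ->
  w ^+ n *: S u - iter n D (S u) =
  \sum_(j < n) w ^+ (n.-1 - j) *: iter j D u.
Proof.
move=> HS; elim: n => [|n IH]; first by rewrite big_ord0 /= scale1r subrr.
rewrite big_ord_recr /= subnn expr0 scale1r.
have -> : \sum_(j < n) w ^+ (n - j) *: iter j D u =
          w *: (w ^+ n *: S u - iter n D (S u)).
  rewrite IH scaler_sumr; apply: eq_bigr => j _.
  have -> : (n - j = (n.-1 - j).+1)%N by have := ltn_ord j; lia.
  by rewrite scalerA -exprS.
have -> : iter n D u = w *: iter n D (S u) - iter n.+1 D (S u).
  by rewrite -{1}[u]HS iterB iterZ -iterSr.
by rewrite scalerBr scalerA -exprS addrA subrK.
Qed.

Section Average.
Context (n : nat) (r : K) (w : 'I_n -> K) (S : 'I_n -> {linear V -> V}).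

(* If [w] runs over the n-th roots of [r ^+ n] and [S k] is the resolvent of [D]
   at [w k], this is the inverse of [1 - (D / r)^n], a contour-free approximation
   of the Riesz projection. *)
Definition avg u := n%:R^-1 *: \sum_(k < n) w k *: S k u.

Hypothesis n0 : n%:R != 0 :> K.
Hypothesis w_n : forall k, w k ^+ n = r ^+ n.
Hypothesis w_j : forall j, (0 < j < n)%N -> \sum_(k < n) w k ^+ j = 0.
Hypothesis SR : forall k v, w k *: S k v - D (S k v) = v.
Hypothesis SL : forall k v, S k (w k *: v - D v) = v.

(** By [resolvent_iter] the coefficient of [iter j D u] is a multiple of the sum over k of w_k^(n -
    j), which [w_j] kills for 0 < j < n; only j = 0 survives, with value r^n. *)
Lemma avg_right u : r ^+ n *: avg u - iter n D (avg u) = r ^+ n *: u.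
Proof.
rewrite /avg iterZ iter_sum /= scalerA mulrC -scalerA -scalerBr scaler_sumr -sumrB.
under eq_bigr => k _.
  rewrite iterZ scalerA mulrC -scalerA -scalerBr -(w_n k).
  rewrite (resolvent_iter u n (SR k)) scaler_sumr.
  over.
rewrite exchange_big /=.
have n1 : (0 < n)%N by case: (n) n0; rewrite ?eqxx.
rewrite (bigD1 (Ordinal n1)) //= [X in _ + X]big1 ?addr0; last first.
  move=> j j0; under eq_bigr do rewrite scalerA -exprS.
  rewrite -scaler_suml w_j ?scale0r//.
  have jn := ltn_ord j.
  have j1 : (0 < j)%N by rewrite lt0n; apply: contraNneq j0 => e; apply/eqP/val_inj.
  by move: jn j1; clear; lia.
under eq_bigr do rewrite subn0 scalerA -exprS prednK// w_n.
by rewrite sumr_const cardT size_enum_ord -scaler_nat scalerA mulVf ?scale1r.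
Qed.

(** Both [D (S k u)] and [S k (D u)] equal [w k *: S k u - u]. *)
Lemma avg_comm u : D (avg u) = avg (D u).
Proof.
rewrite /avg linearZ linear_sum /=; congr (_ *: _); apply: eq_bigr => k _.
rewrite linearZ /=; congr (_ *: _).
have := SL k u; rewrite linearB linearZ /= => e.
by rewrite -[LHS](subKr (w k *: S k u)) SR -{2}e subKr.
Qed.

Lemma avg_is_linear : linear avg.
Proof.
move=> a u v; rewrite /avg scalerA mulrC -scalerA -scalerDr; congr (_ *: _).
rewrite scaler_sumr -big_split /=; apply: eq_bigr => k _.
by rewrite linearP scalerDr !scalerA mulrC.
Qed.

Lemma avg_iter_comm m u : iter m D (avg u) = avg (iter m D u).
Proof. by elim: m u => // m IH u; rewrite iterS IH avg_comm -iterS. Qed.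
End Average.
End IterLinear.

Section RootsOfUnity.
Context (R : realType).
Local Notation cexp := (@cexp R).

Lemma cexpD (a b : R) : cexp (a + b) = cexp a * cexp b.
Proof. by rewrite /cexp cosD sinD; congr Complex; rewrite addrC mulrC [X in _ + X]mulrC. Qed.

Lemma cexp0 : cexp 0 = 1.
Proof. by rewrite /cexp cos0 sin0. Qed.

Lemma cexpMn (a : R) m : cexp (a *+ m) = cexp a ^+ m.
Proof.
by elim: m => [|m IH]; rewrite ?mulr0n ?cexp0// mulrS exprS cexpD IH.
Qed.

Lemma cexp2pi : cexp (2 * pi) = 1.
Proof. by rewrite mulr_natl /cexp cos2pi sin2pi. Qed.

Lemma normc_cexp a : normc (cexp a) = 1.
Proof. by rewrite /= cos2Dsin2 sqrtr1. Qed.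

Lemma cexp_neq1 (a : R) : 0 < a < 2 * pi -> cexp a != 1.
Proof.
move=> /andP[a0 a2]; apply/eqP => -[ca _].
(* [cos a = 1] would force [sin (a / 2)] to vanish, but [a / 2] lies strictly between 0 and [pi]. *)
have s0 : 0 < sin (a / 2).
  by apply: sin_gt0_pi; rewrite divr_gt0//= ltr_pdivrMr// mulrC.
have : cos (a / 2 + a / 2) = 1 by rewrite -splitr.
rewrite cosD -!expr2 => e; have := cos2Dsin2 (a / 2); nra.
Qed.

Definition unity_root (n k : nat) : R[i] := cexp (2 * pi / n%:R * k%:R).

Lemma normc_unity_root n k : normc (unity_root n k) = 1.
Proof. exact: normc_cexp. Qed.

Lemma unity_rootE n k : unity_root n k = cexp (2 * pi / n%:R) ^+ k.
Proof. by rewrite -cexpMn /unity_root mulr_natr. Qed.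

Lemma unity_root1 n : (0 < n)%N -> cexp (2 * pi / n%:R) ^+ n = 1.
Proof.
by move=> n0; rewrite -cexpMn -[_ *+ n]mulr_natr divfK ?cexp2pi// pnatr_eq0 -lt0n.
Qed.

Lemma unity_root_expn n k : (0 < n)%N -> unity_root n k ^+ n = 1.
Proof. by move=> n0; rewrite unity_rootE exprAC unity_root1 ?expr1n. Qed.

Lemma sum_unity_root n j : (0 < j < n)%N ->
  \sum_(k < n) unity_root n k ^+ j = 0.
Proof.
move=> /andP[j0 jn]; have n0 := leq_ltn_trans (leq0n j) jn.
set z := cexp (2 * pi / n%:R) ^+ j.
have z1 : z - 1 != 0.
  rewrite subr_eq0 /z -cexpMn -[_ *+ j]mulr_natr cexp_neq1//.
  have n0' : 0 < n%:R :> R by rewrite ltr0n.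
  have j0' : 0 < j%:R :> R by rewrite ltr0n.
  have p0 := pi_gt0 R.
  rewrite mulr_gt0 ?divr_gt0 ?mulr_gt0//= mulrAC ltr_pdivrMr//.
  by rewrite ltr_pM2l ?mulr_gt0// ltr_nat.
under eq_bigr do rewrite unity_rootE exprAC -/z.
apply: (mulfI z1); rewrite mulr0 -subrX1 /z exprAC unity_root1//.
by rewrite expr1n subrr.
Qed.
End RootsOfUnity.

Section Normc.
Context (R : realType).
Implicit Types z w : R[i].

Lemma normc_ge0 z : 0 <= normc z.
Proof. by case: z => a b; exact: sqrtr_ge0. Qed.

Lemma normc_real (a : R) : normc a%:C%C = `|a|.
Proof. by rewrite /= expr0n/= addr0 sqrtr_sqr. Qed.

Lemma normcD z w : normc (z + w) <= normc z + normc w.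
Proof. exact: le_normcD. Qed.

Lemma normcX z n : normc (z ^+ n) = normc z ^+ n.
Proof. by elim: n => [|n IH]; rewrite ?expr0 ?normc1// !exprS normcM IH. Qed.

Lemma normc_gt0 z : (0 < normc z) = (z != 0).
Proof.
rewrite lt_neqAle normc_ge0 andbT eq_sym.
by congr (~~ _); apply/eqP/eqP => [/eq0_normc//|->]; exact: normc0.
Qed.
End Normc.

Section FactoredOperator.
Context (K : fieldType) (V : lmodType K) (P : {linear V -> V}).

(** The value at [v] of the operator p(P). *)
Definition pact (p : {poly K}) (v : V) := \sum_(i < size p) p`_i *: iter i P v.

Lemma pact_widen (p : {poly K}) n v : (size p <= n)%N ->
  pact p v = \sum_(i < n) p`_i *: iter i P v.
Proof.
move=> pn; rewrite /pact (big_ord_widen n (fun i => p`_i *: iter i P v)) // big_mkcond.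
apply: eq_bigr => i _; case: ifPn => //; rewrite -leqNgt => pi.
by rewrite nth_default ?scale0r.
Qed.

Lemma pact_mulXsub (p : {poly K}) z v : pact (('X - z%:P) * p) v = pact p (P v - z *: v).
Proof.
have sz : (size (('X - z%:P) * p)%R <= (size p).+1)%N.
  by apply: leq_trans (size_polyMleq _ _) _; rewrite size_XsubC.
rewrite (pact_widen _ sz) /pact.
under [RHS]eq_bigr do rewrite iterB iterZ -iterSr scalerBr scalerA.
rewrite sumrB; under eq_bigr => i _.
  rewrite mulrBl coefB coefXM coefCM scalerBl; over.
rewrite sumrB; congr (_ - _).
  by rewrite big_ord_recl /= scale0r add0r.
rewrite big_ord_recr /= [X in _ * X]nth_default// mulr0 scale0r addr0.
by apply: eq_bigr => i _; rewrite mulrC.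
Qed.

(** The linear factors are applied one at a time; the last nonzero vector before the product
    vanishes is an eigenvector. [W] tracks a property that every factor preserves. *)
Lemma pact_eigenvector (W : V -> Prop) (s : seq K) (v : V) :
  (forall z u, W u -> W (P u - z *: u)) -> W v -> v != 0 ->
  pact (\prod_(z <- s) ('X - z%:P)) v = 0 ->
  exists z u, [/\ W u, u != 0 & P u = z *: u].
Proof.
move=> WP; elim: s v => [|z s IH] v Wv v0.
  rewrite big_nil /pact size_poly1 big_ord1 /= coefC eqxx scale1r => e.
  by rewrite e eqxx in v0.
rewrite big_cons pact_mulXsub => e.
have [e0|n0] := eqVneq (P v - z *: v) 0.
  by exists z, v; split => //; apply/eqP; rewrite -subr_eq0 e0.
exact: IH (WP _ _ Wv) n0 e.
Qed.

(* A nonzero vector all of whose iterates live in a finite-dimensional space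
   is killed by a nonzero polynomial in [P], whose factors yield an
   eigenvector. *)
Lemma finite_rank_eigenvector (p0 : forall p : {poly K}, exists s : seq K,
    p = lead_coef p *: \prod_(z <- s) ('X - z%:P))
  (W : V -> Prop) (m : nat) (e : 'I_m -> V) (v : V) :
  (forall z u, W u -> W (P u - z *: u)) -> W v -> v != 0 ->
  (forall i, exists c : 'I_m -> K, iter i P v = \sum_(j < m) c j *: e j) ->
  exists z u, [/\ W u, u != 0 & P u = z *: u].
Proof.
move=> WP Wv v0 /choice[c Hc].
pose M := \matrix_(i < m.+1, j < m) c i j.
(* The rows of [M] are m + 1 coefficient vectors of length m, hence dependent; a dependency [x]
   supplies the coefficients of the polynomial that kills [v]. *)
have : kermx M != 0.
  rewrite -mxrank_eq0 mxrank_ker subn_eq0 -ltnNge ltnS.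
  exact: rank_leq_col.
case/rowV0Pn => /= x /sub_kermxP xM x0.
pose p := \poly_(i < m.+1) x 0 (inord i).
have p0' : p != 0.
  apply: contra x0 => /eqP p0'; apply/eqP/rowP => i; rewrite mxE.
  have := congr1 (fun q : {poly K} => q`_i) p0'.
  by rewrite coef_poly ltn_ord coef0 inord_val.
have pv : pact p v = 0.
  rewrite (@pact_widen _ m.+1) ?size_poly//.
  under eq_bigr => i _.
    rewrite coef_poly ltn_ord inord_val Hc scaler_sumr.
    under eq_bigr do rewrite scalerA.
    over.
  rewrite exchange_big /= big1// => j _; rewrite -scaler_suml.
  have := congr1 (fun A : 'rV_m => A 0 j) xM; rewrite !mxE => e0.
  rewrite (_ : \sum_(i < m.+1) _ = 0) ?scale0r// -[RHS]e0.
  by apply: eq_bigr => i _; rewrite mxE.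
have [s ps] := p0 p.
apply: (pact_eigenvector (s := s) WP Wv v0).
have l0 : lead_coef p != 0 by rewrite lead_coef_eq0.
apply: (scalerI l0); rewrite scaler0 -[RHS]pv [in RHS]ps /pact.
rewrite size_scale// scaler_sumr; apply: eq_bigr => i _.
by rewrite coefZ scalerA.
Qed.
End FactoredOperator.

Lemma exprn_small (R : realType) (x e : R) : 0 <= x < 1 -> 0 < e ->
  exists n0, forall n, (n0 <= n)%N -> x ^+ n < e.
Proof.
move=> /andP[x0 x1] e0.
have /cvgr_lt/(_ e e0)[n0 _ H] : (fun n => x ^+ n) @ \oo --> (0 : R).
  by apply: cvg_expr; rewrite ger0_norm.
by exists n0 => n /H.
Qed.

Lemma normc_nat (R : realType) n : normc (n%:R : R[i]) = n%:R.
Proof. by rewrite -(rmorph_nat (real_complex R)) normc_real normr_nat. Qed.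

(** * Riesz projections as limits of averages of resolvents *)

Section Pole.
Context (R : realType) (V : lmodType R[i]) (N : V -> R).
Hypothesis ND : forall u v, N (u + v) <= N u + N v.
Hypothesis NZ : forall a u, N (a *: u) = normc a * N u.
Hypothesis N_eq0 : forall u, N u = 0 -> u = 0.

Lemma nrm0 : N 0 = 0.
Proof. by rewrite -(scale0r 0) NZ (normc0 R) mul0r. Qed.

Lemma nrmN u : N (- u) = N u.
Proof. by rewrite -scaleN1r NZ normcN normc1 mul1r. Qed.

Lemma nrm_ge0 u : 0 <= N u.
Proof. by have := ND u (- u); rewrite subrr nrm0 nrmN; lra. Qed.

Lemma nrmB u v : N (u - v) <= N u + N v.
Proof. by rewrite -(nrmN v); exact: ND. Qed.

Lemma nrm_sum n (F : 'I_n -> V) : N (\sum_(i < n) F i) <= \sum_(i < n) N (F i).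
Proof.
elim/big_ind2: _ => [|x y u v xy uv|//]; first by rewrite nrm0.
by apply: le_trans (ND _ _) _; exact: lerD.
Qed.

(** The restriction [eps <= 1] lets callers bound terms quadratic in [eps] by linear ones. *)
Lemma nrm_small u (c : R) : (forall eps, 0 < eps <= 1 -> N u <= c * eps) -> u = 0.
Proof.
move=> H; apply: N_eq0; apply/eqP; rewrite eq_le nrm_ge0 andbT leNgt.
apply/negP => u0.
have c0 : 0 <= c by have := H 1; rewrite ltr01 lexx mulr1 => /(_ isT); lra.
pose eps := Num.min 1 (N u / (2 * (c + 1))).
have e0 : 0 < N u / (2 * (c + 1)) by rewrite divr_gt0//; lra.
have : N u <= c * eps.
  by apply: H; rewrite /eps lt_min ltr01 e0 ge_min lexx.
have : eps <= N u / (2 * (c + 1)) by rewrite /eps ge_min lexx orbT.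
rewrite ler_pdivlMr; last lra.
have : 0 < eps by rewrite /eps lt_min ltr01 e0.
nra.
Qed.

Definition nbounded (Q : V -> V) := exists M, forall u, N (Q u) <= M * N u.

Lemma nbounded_pos Q : nbounded Q -> exists2 M, 0 < M & forall u, N (Q u) <= M * N u.
Proof.
case=> M HM; exists (`|M| + 1) => [|u]; first by have := normr_ge0 M; lra.
by have := HM u; have := nrm_ge0 u; have := ler_norm M; nra.
Qed.

Lemma nbounded_avg n (w : 'I_n -> R[i]) (S : 'I_n -> {linear V -> V}) :
  (forall k, nbounded (S k)) -> nbounded (avg w S).
Proof.
move=> /choice[M HM]; exists (normc (n%:R^-1 : R[i]) * \sum_k normc (w k) * M k) => u.
rewrite NZ -mulrA ler_wpM2l ?normc_ge0//.
apply: le_trans (nrm_sum _) _; rewrite mulr_suml; apply: ler_sum => k _.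
by rewrite NZ -mulrA ler_wpM2l ?normc_ge0.
Qed.

Lemma nbounded_iter (D : V -> V) L n : 0 <= L -> (forall u, N (D u) <= L * N u) ->
  forall u, N (iter n D u) <= L ^+ n * N u.
Proof.
move=> L0 DL; elim: n => [|n IH] u; first by rewrite expr0 mul1r.
by rewrite iterS exprS -mulrA; apply: le_trans (DL _) _; exact: ler_wpM2l.
Qed.

(** The model is E_n = (1 - q^n)^-1, for which 2 E_n - 1 = (1 + q^n) E_n and hence E_2n (2 E_n - 1)
    = E_n^2. In the limit E (2 E - 1) = E^2, that is, E^2 = E. *)
Lemma limit_idempotent (E_ : nat -> V -> V) (E : {linear V -> V}) :
  nbounded E ->
  (forall eps, 0 < eps -> exists n0, forall n, (n0 <= n)%N ->
     forall u, N (E_ n u - E u) <= eps * N u) ->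
  (forall n u, (0 < n)%N -> E_ (n + n)%N (2 *: E_ n u - u) = E_ n (E_ n u)) ->
  forall u, E (E u) = E u.
Proof.
move=> /nbounded_pos[M M0 HM] lim HE u.
apply/eqP; rewrite -subr_eq0; apply/eqP.
apply: (@nrm_small _ ((4 * M + 4) * N u)) => eps /andP[e0 e1].
have [n0 Hn0] := lim _ e0.
pose n := n0.+1; have nn0 : (n0 <= n)%N by rewrite leqnSn.
have nn0' : (n0 <= n + n)%N by apply: leq_trans nn0 _; rewrite leq_addr.
set v := E_ n u.
have h1 := Hn0 _ nn0 u; rewrite -/v in h1.
have h2 := Hn0 _ nn0' (2 *: v - u).
have h3 := Hn0 _ nn0 v.
have := HE n u isT; rewrite -/v => hE; rewrite hE in h2.
have a0 := nrm_ge0 u.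
have hv : N v <= (M + 1) * N u.
  have := ND (v - E u) (E u); rewrite subrK => h.
  have := HM u; nra.
have h4 : N (2 *: v - u) <= 2 * N v + N u.
  by apply: le_trans (nrmB _ _) _; rewrite NZ normc_nat.
have h5 : N (E (v - E u)) <= M * (eps * N u).
  by apply: le_trans (HM _) _; rewrite ler_pM2l.
have -> : E (E u) - E u = (E_ n v - E v) - (E_ n v - E (2 *: v - u)) - E (v - E u).
  have abel (a x y c : V) : c - y = (a - x) - (a - (2 *: x - y)) - (x - c).
    rewrite scaler_nat mulr2n (opprB a) [a - x + _]addrC subrKA.
    by rewrite [x + x - y]addrAC addrK opprB [RHS]addrC subrKA.
  have -> : E (2 *: v - u) = 2 *: E v - E u by rewrite linearB linearZ.
  by rewrite (linearB E v); exact: abel.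
apply: le_trans (nrmB _ _) _.
apply: le_trans (lerD (nrmB _ _) (lexx _)) _.
nra.
Qed.
Section Operator.
Context (P : {linear V -> V}) (phi : {scalar V}).
Hypothesis PN : forall u, N (P u) <= N u.
Hypothesis phiP : forall u, phi (P u) = phi u.
Hypothesis phiN : forall u, normc (phi u) <= N u.

Definition resolvent_op (z : R[i]) (S : {linear V -> V}) :=
  [/\ forall v, z *: S v - P (S v) = v, forall v, S (z *: v - P v) = v &
      nbounded S].

Definition op_sub (z0 : R[i]) (u : V) := P u - z0 *: u.

Lemma op_sub_is_linear z0 : linear (op_sub z0).
Proof.
move=> a u v; rewrite /op_sub linearP scalerDr opprD addrACA scalerBr.
by rewrite !scalerA mulrC.
Qed.

HB.instance Definition _ z0 :=
  GRing.isLinear.Build R[i] V V *:%R (op_sub z0) (op_sub_is_linear z0).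

Lemma nbounded_op_sub z0 u : N (op_sub z0 u) <= (1 + normc z0) * N u.
Proof.
by apply: le_trans (nrmB _ _) _; rewrite NZ mulrDl mul1r lerD2r.
Qed.

Lemma phi_iter n u : phi (iter n P u) = phi u.
Proof. by elim: n => // n IH; rewrite iterS phiP. Qed.

(** Invariance of [phi] turns the resolvent equation into (z - 1) phi (S u) = phi u. At z = 1 the
    same equation, read at [S u], shows that [phi] vanishes there. *)
Lemma resolvent_phi z S u : resolvent_op z S -> phi u = 0 -> phi (S u) = 0.
Proof.
case=> SR _ _ u0; have [z1|z1] := eqVneq z 1.
  by rewrite -(SR (S u)) linearB phiP linearZ z1 /= mul1r subrr.
have := congr1 phi (SR u); rewrite linearB linearZ phiP /= u0 => /eqP.
by rewrite -{2}(mul1r (phi _)) -mulrBl mulf_eq0 subr_eq0 (negPf z1) => /eqP.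
Qed.

(** Riemann sum of the resolvent against dz / (2 pi i): at node k, dz is i times
    [r%:C%C * unity_root R n k] times 2 pi / n. The node minus [z0] is also the point at which the
    resolvent of P - z0 is taken. *)
Definition circle_avg (z0 : R[i]) (r : R) (Rz : R[i] -> {linear V -> V}) n :
    V -> V :=
  avg (fun k : 'I_n => r%:C%C * unity_root R n k)
      (fun k : 'I_n => Rz (z0 + r%:C%C * unity_root R n k)).

Section CircleAverage.
Context (z0 : R[i]) (r : R) (Rz : R[i] -> {linear V -> V}).
Hypothesis r0 : 0 < r.
Hypothesis HRz : forall z : R[i], normc (z - z0) = r -> resolvent_op z (Rz z).

Let D := op_sub z0.
Let q n u := (r%:C%C ^- n) *: iter n D u.

Lemma normc_circle n k : normc (z0 + r%:C%C * unity_root R n k - z0) = r.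
Proof. by rewrite addrC addKr normcM normc_unity_root mulr1 normc_real gtr0_norm. Qed.

Lemma circle_resolvent n k :
  resolvent_op (z0 + r%:C%C * unity_root R n k)
               (Rz (z0 + r%:C%C * unity_root R n k)).
Proof. exact/HRz/normc_circle. Qed.

Let rC0 : r%:C%C != 0 :> R[i].
Proof. by rewrite -normc_gt0 normc_real normr_gt0 gt_eqF. Qed.

Let w n (k : 'I_n) := r%:C%C * unity_root R n k.
Let S n (k : 'I_n) := Rz (z0 + r%:C%C * unity_root R n k).
Let w_n n k : (0 < n)%N -> @w n k ^+ n = r%:C%C ^+ n.
Proof. by move=> n0; rewrite exprMn unity_root_expn ?mulr1. Qed.
Let w_j n j : (0 < j < n)%N -> \sum_(k < n) w k ^+ j = 0.
Proof.
by move=> jn; under eq_bigr do rewrite exprMn; rewrite -mulr_sumr sum_unity_root ?mulr0.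
Qed.
Let SR n k v : w k *: @S n k v - D (S k v) = v.
Proof.
have [H _ _] := circle_resolvent n k; rewrite -[RHS]H scalerDl /D /op_sub.
by rewrite opprB addrA [z0 *: _ + _]addrC.
Qed.
Let SL n k v : @S n k (w k *: v - D v) = v.
Proof.
have [_ H _] := circle_resolvent n k; rewrite -[RHS]H scalerDl /D /op_sub.
by rewrite opprB addrA [z0 *: _ + _]addrC.
Qed.

Let neq0 n : (0 < n)%N -> n%:R != 0 :> R[i].
Proof. by move=> n0; rewrite pnatr_eq0 -lt0n. Qed.

Lemma circle_avg_is_linear n : linear (circle_avg z0 r Rz n).
Proof. exact: avg_is_linear. Qed.

HB.instance Definition _ n := GRing.isLinear.Build R[i] V V *:%R
  (circle_avg z0 r Rz n) (circle_avg_is_linear n).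

Lemma circle_avgB n u v : circle_avg z0 r Rz n (u - v) =
  circle_avg z0 r Rz n u - circle_avg z0 r Rz n v.
Proof. exact: linearB. Qed.

Lemma circle_avgZ n a u :
  circle_avg z0 r Rz n (a *: u) = a *: circle_avg z0 r Rz n u.
Proof. exact: linearZ. Qed.

Lemma circle_avg_right n u : (0 < n)%N ->
  circle_avg z0 r Rz n u - r%:C%C ^- n *: iter n D (circle_avg z0 r Rz n u) = u.
Proof.
move=> n0; have := avg_right (neq0 n0) (fun k => w_n k n0) (@w_j n) (@SR n) u.
rewrite -[avg _ _ _]/(circle_avg z0 r Rz n u) => e.
have rn : r%:C%C ^+ n != 0 :> R[i] by rewrite expf_neq0.
by apply: (scalerI rn); rewrite -[RHS]e scalerBr (scalerA _ _ (iter _ _ _)) mulfV// scale1r.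
Qed.

Lemma circle_avg_comm n u : circle_avg z0 r Rz n (D u) = D (circle_avg z0 r Rz n u).
Proof. exact/esym/(avg_comm (@SR n) (@SL n)). Qed.

Lemma circle_avg_left n u : (0 < n)%N ->
  circle_avg z0 r Rz n (u - r%:C%C ^- n *: iter n D u) = u.
Proof.
move=> n0; rewrite -[RHS](circle_avg_right u n0).
rewrite [iter n D (circle_avg _ _ _ _ _)](avg_iter_comm (@SR n) (@SL n) n u).
by rewrite circle_avgB circle_avgZ.
Qed.

Lemma circle_avg_phi n u : phi u = 0 -> phi (circle_avg z0 r Rz n u) = 0.
Proof.
move=> u0; rewrite /circle_avg /avg linearZ linear_sum /= big1 ?mulr0// => k _.
by rewrite linearZ /= (resolvent_phi (circle_resolvent n k))// mulr0.
Qed.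

Lemma circle_avg_nbounded n : nbounded (circle_avg z0 r Rz n).
Proof. by apply: nbounded_avg => k; have [] := circle_resolvent n k. Qed.

(** With q the n-th power of (P - z0) / r, both sides are (1 - q)^-2 u: the left one is (1 - q^2)^-1
    (1 + q) (1 - q)^-1 u. *)
Lemma circle_avg_double n u : (0 < n)%N ->
  circle_avg z0 r Rz (n + n) (2 *: circle_avg z0 r Rz n u - u) =
  circle_avg z0 r Rz n (circle_avg z0 r Rz n u).
Proof.
move=> n0; set v := circle_avg z0 r Rz n u; set x := circle_avg z0 r Rz n v.
have n20 : (0 < n + n)%N by rewrite addn_gt0 n0.
rewrite -[RHS](@circle_avg_left (n + n) x n20); congr (circle_avg _ _ _ _ _).
have ev : v - q n v = u := circle_avg_right u n0.
have ex : x - q n x = v := circle_avg_right v n0.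
have qq : q n (q n x) = r%:C%C ^- (n + n) *: iter (n + n) D x.
  by rewrite /q iterZ scalerA -iterD -invfM -exprD.
have qB a b : q n (a - b) = q n a - q n b by rewrite /q iterB scalerBr.
have -> : 2 *: v - u = v + q n v.
  by rewrite -ev scaler_nat mulr2n opprB [q n v - v]addrC -addrA addNKr.
by rewrite -qq -ex qB subrKA.
Qed.
End CircleAverage.

Section FinitePole.
Context (z0 : R[i]) (r : R) (Rz : R[i] -> {linear V -> V}) (E : {linear V -> V}).
Context (m : nat) (e : 'I_m -> V).
Hypothesis r0 : 0 < r.
Hypothesis res : forall z : R[i], 0 < normc (z - z0) <= r ->
  exists S, resolvent_op z S.
Hypothesis HRz : forall z : R[i], normc (z - z0) = r -> resolvent_op z (Rz z).
Hypothesis HE : forall eps, 0 < eps -> exists n0, forall n, (n0 <= n)%N ->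
  forall u, N (circle_avg z0 r Rz n u - E u) <= eps * N u.
Hypothesis EB : nbounded E.
Hypothesis Efin : forall u, exists c : 'I_m -> R[i], E u = \sum_(j < m) c j *: e j.
Hypothesis noev : forall h, phi h = 0 -> P h = z0 *: h -> h = 0.

Let En := circle_avg z0 r Rz.

Lemma pole_idempotent u : E (E u) = E u.
Proof.
apply: (@limit_idempotent En) => // n v n0; exact: circle_avg_double.
Qed.

Lemma pole_comm u : E (P u) = P (E u).
Proof.
have EnP n v : En n (P v) = P (En n v).
  have := circle_avg_comm r0 HRz n v.
  rewrite /op_sub circle_avgB circle_avgZ; exact: addIr.
apply/eqP; rewrite -subr_eq0; apply/eqP.
apply: (@nrm_small _ (2 * N u)) => eps /andP[e0 _].
have [n0 /(_ n0 (leqnn _)) H] := HE e0.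
have h1 := H (P u); have h2 := H u.
have -> : E (P u) - P (E u) = P (En n0 u - E u) - (En n0 (P u) - E (P u)).
  by rewrite linearB EnP opprB [RHS]addrC subrKA.
apply: le_trans (nrmB _ _) _; have := PN (En n0 u - E u); have := PN u.
rewrite -/En in h1 h2; nra.
Qed.

Lemma pole_phi u : phi u = 0 -> phi (E u) = 0.
Proof.
move=> u0; apply: eq0_normc; apply/eqP; rewrite eq_le normc_ge0 andbT.
apply/ler_addgt0Pl => eps e0; rewrite addr0.
have e1 : 0 < eps / (N u + 1) by rewrite divr_gt0//; have := nrm_ge0 u; lra.
have [n0 /(_ n0 (leqnn _)) /(_ u)] := HE e1.
have -> : phi (E u) = - phi (circle_avg z0 r Rz n0 u - E u).
  by rewrite linearB (circle_avg_phi r0 HRz n0 u0) sub0r opprK.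
rewrite normcN; have := phiN (circle_avg z0 r Rz n0 u - E u).
move=> h1 h2; apply: le_trans h1 (le_trans h2 _).
rewrite mulrAC ler_pdivrMr; have := nrm_ge0 u; nra.
Qed.

(** The eigenvalue is not known in advance. At [z0] itself, [noev] applies; within distance [r] of
    it the resolvent makes lam - P injective; beyond, the averages multiply [h] by (1 - mu^n)^-1
    with |mu| > 1, which contradicts their limit [E h = h] unless [h = 0]. *)
Lemma pole_eigenvector lam h :
  phi h = 0 -> E h = h -> P h = lam *: h -> h = 0.
Proof.
move=> ph Eh Ph.
have [l0|l0] := eqVneq lam z0; first by apply: noev; rewrite -?l0.
have [lr|lr] := leP (normc (lam - z0)) r.
  have [|S [_ SL _]] := res (z := lam).
    by rewrite lr andbT normc_gt0 subr_eq0.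
  by rewrite -(SL h) Ph subrr linear0.
have hD n : iter n (op_sub z0) h = (lam - z0) ^+ n *: h.
  elim: n => [|n IH]; first by rewrite scale1r.
  by rewrite iterS IH linearZ /= /op_sub Ph -scalerBl scalerA -exprSr.
pose mu := (lam - z0) / r%:C%C.
have mu1 : r / normc (lam - z0) < 1 by rewrite ltr_pdivrMr ?mul1r ?(lt_trans r0 lr).
have [n1 Hn1] : exists n0, forall n, (n0 <= n)%N -> (r / normc (lam - z0)) ^+ n < 1 / 4.
  apply: exprn_small; last lra.
  by rewrite mu1 divr_ge0 ?normc_ge0 ?ltW.
have [n2 Hn2] := @HE (1 / 2) ltac:(lra).
pose n := (n1 + n2).+1.
have {}Hn1 : (r / normc (lam - z0)) ^+ n < 1 / 4 by apply: Hn1; rewrite /n; lia.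
have {}Hn2 : N (En n h - E h) <= 1 / 2 * N h by apply: Hn2; rewrite /n; lia.
have n0 : (0 < n)%N by [].
have := circle_avg_left r0 HRz h n0.
rewrite hD scalerA -exprVn -exprMn -{1}[h]scale1r -scalerBl circle_avgZ.
rewrite [_^-1 * _]mulrC -/mu => eh.
have nmu : 4 < normc (mu ^+ n).
  rewrite normcX /mu normcM normcV normc_real gtr0_norm//.
  rewrite -[_ / r]invrK invf_div exprVn.
  have p0 : 0 < (r / normc (lam - z0)) ^+ n.
    by rewrite exprn_gt0// divr_gt0// (lt_trans r0).
  by rewrite -[4]invrK ltf_pV2 ?posrE//; lra.
have := congr1 N eh; rewrite NZ -/(En n h).
have : 3 <= normc (1 - mu ^+ n).
  have := normcD (1 - mu ^+ n) (- 1); rewrite addrAC subrr add0r !normcN (normc1 R).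
  lra.
have := ND (E h - En n h) (En n h); rewrite subrK.
have <- : N (En n h - E h) = N (E h - En n h) by rewrite -nrmN opprB.
rewrite Eh in Hn2 *; have := nrm_ge0 h; have := nrm_ge0 (En n h).
move=> a b c d f; apply: N_eq0; nra.
Qed.

Lemma pole_ker u : phi u = 0 -> E u = 0.
Proof.
move=> u0; apply: contrapT => /eqP Eu0.
pose W v := exists2 f, phi f = 0 & v = E f.
have WP z v : W v -> W (P v - z *: v).
  move=> [f f0 ->]; exists (P f - z *: f); last first.
    by rewrite (linearB E) (linearZ_LR E) pole_comm.
  by rewrite linearB linearZ phiP f0 /= mulr0 subr0.
have [z [v [[f f0 ->] v0 Pv]]] : exists z v, [/\ W v, v != 0 & P v = z *: v].
  apply: (@finite_rank_eigenvector _ _ P _ W m e (E u)) => //.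
  - by move=> p; have [s ps] := closed_field_poly_normal p; exists s.
  - by exists u.
  - move=> i; have -> : iter i P (E u) = E (iter i P u); last exact: Efin.
    by elim: i => // i IH; rewrite !iterS IH pole_comm.
move/eqP: v0; apply; apply: pole_eigenvector Pv; last exact: pole_idempotent.
exact: pole_phi.
Qed.

(** As [E] kills [u], the average E_n u at a fixed large n has at most half the norm of [u]. In u =
    E_n u - r^-n E_n (P - z0)^n u this absorbs the first term, and the second is bounded by a
    multiple of the norm of (P - z0) u. *)
Lemma pole_lower_bound : exists2 c, 0 < c &
  forall u, phi u = 0 -> c * N u <= N (z0 *: u - P u).
Proof.
have [n1 Hn1] := @HE (1 / 2) ltac:(lra).
pose n := n1.+1; have {}Hn1 := Hn1 n (leqnSn _).
have [B B0 HB] := nbounded_pos (circle_avg_nbounded r0 HRz n).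
pose L := 1 + normc z0.
have L0 : 0 <= L by rewrite addr_ge0// normc_ge0.
pose K := B * (r ^- n * L ^+ n1) + 1.
have K0 : 0 < K.
  rewrite ltr_wpDl//; apply: mulr_ge0; first exact: ltW.
  by rewrite mulr_ge0 ?exprn_ge0// invr_ge0 exprn_ge0// ltW.
exists (1 / (2 * K)) => [|u u0]; first by rewrite divr_gt0// mulr_gt0.
have := Hn1 u; rewrite (pole_ker u0) subr0 => h1.
have := circle_avg_left r0 HRz u (isT : (0 < n)%N).
rewrite circle_avgB circle_avgZ.
set x := iter n _ _ => h2.
have : N u <= N (circle_avg z0 r Rz n u) + r ^- n * N (circle_avg z0 r Rz n x).
  rewrite -{1}h2; apply: le_trans (nrmB _ _) _; rewrite lerD2l NZ -exprVn normcX.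
  by rewrite normcV normc_real exprVn gtr0_norm.
have := HB x.
have : N x <= L ^+ n1 * N (z0 *: u - P u).
  have -> : N (z0 *: u - P u) = N (op_sub z0 u) by rewrite -nrmN opprB.
  rewrite /x iterSr; apply: nbounded_iter => // v.
  exact: nbounded_op_sub.
move=> h3 h4 h5; rewrite mulrAC ler_pdivrMr ?mulr_gt0//.
have rn : 0 <= r ^- n by rewrite invr_ge0 exprn_ge0// ltW.
have y0 := nrm_ge0 (z0 *: u - P u).
have : r ^- n * N (circle_avg z0 r Rz n x) <= B * (r ^- n * L ^+ n1) * N (z0 *: u - P u).
  have -> : B * (r ^- n * L ^+ n1) * N (z0 *: u - P u) =
     r ^- n * (B * (L ^+ n1 * N (z0 *: u - P u))) by ring.
  by apply: ler_wpM2l => //; apply: le_trans h4 _; rewrite ler_pM2l.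
rewrite /K; nra.
Qed.
End FinitePole.

Definition finite_pole (z0 : R[i]) := exists r Rz (E : {linear V -> V}) m (e : 'I_m -> V),
  [/\ 0 < r,
      forall z : R[i], 0 < normc (z - z0) <= r -> exists S, resolvent_op z S,
      forall z : R[i], normc (z - z0) = r -> resolvent_op z (Rz z),
      forall eps, 0 < eps -> exists n0, forall n, (n0 <= n)%N ->
        forall u, N (circle_avg z0 r Rz n u - E u) <= eps * N u &
      nbounded E /\
      forall u, exists c : 'I_m -> R[i], E u = \sum_(j < m) c j *: e j].
End Operator.
End Pole.

Lemma finite_set_lower_bound (R : realType) (A : set R) : finite_set A ->
  (forall x, A x -> 0 < x) -> exists2 c, 0 < c & forall x, A x -> c <= x.
Proof.
move=> /finite_seqP[s ->].
elim: s => [|x s IH] As; first by exists 1.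
have [y ys|c c0 Hc] := IH; first by apply: As; rewrite /= inE; apply/orP; right.
exists (Num.min c x) => [|y /=]; first by rewrite lt_min c0 As//= mem_head.
rewrite inE => /orP[/eqP ->|ys]; first by rewrite ge_min lexx orbT.
by rewrite ge_min Hc.
Qed.

(** * Uniform bounds near the unit circle and decay of powers *)

Section Gap.
Context (R : realType) (V : lmodType R[i]) (N : V -> R).
Hypothesis ND : forall u v, N (u + v) <= N u + N v.
Hypothesis NZ : forall a u, N (a *: u) = normc a * N u.
Hypothesis N_eq0 : forall u, N u = 0 -> u = 0.
Context (P : {linear V -> V}) (phi : {scalar V}).
Hypothesis PN : forall u, N (P u) <= N u.
Hypothesis phiP : forall u, phi (P u) = phi u.
Hypothesis phiN : forall u, normc (phi u) <= N u.
Hypothesis noev : forall z h, normc z = 1 -> phi h = 0 -> P h = z *: h -> h = 0.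
Local Notation resolvent_op := (resolvent_op N P).
Local Notation nrm_ge0 := (nrm_ge0 ND NZ).
Local Notation nrmB := (nrmB ND NZ).

Let spec : set R[i] := [set z | ~ exists S, resolvent_op z S].
Context (eps0 : R).
Hypothesis eps0_gt0 : 0 < eps0.
Hypothesis spec_fin : finite_set (spec `&` [set z | 1 - eps0 <= normc z]).
Hypothesis spec_pole : forall z, spec z -> 1 - eps0 <= normc z -> finite_pole N P z.

Let lower_bound z c := forall u, phi u = 0 -> c * N u <= N (z *: u - P u).

Lemma unit_lower_bound (z : R[i]) : normc z = 1 -> exists2 c, 0 < c & lower_bound z c.
Proof.
move=> z1; have [[S [SR SL SB]]|nS] := pselect (exists S, resolvent_op z S).
  have [M M0 HM] := nbounded_pos ND NZ SB.
  exists M^-1; first by rewrite invr_gt0.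
  by move=> u _; rewrite mulrC ler_pdivrMr// mulrC -{1}(SL u) HM.
have [|r [Rz [E [m [e [r0 res HRz HE [EB Efin]]]]]]] := spec_pole nS.
  by rewrite z1 lerBlDr lerDl ltW.
have [|c c0 Hc] := pole_lower_bound ND NZ N_eq0 PN phiP phiN r0 res HRz HE EB Efin.
  by move=> h; exact: noev.
by exists c.
Qed.

Lemma lower_bound_lip z w c d : normc (z - w) <= d -> lower_bound z c ->
  lower_bound w (c - d).
Proof.
move=> zw zc u u0; have := zc _ u0.
have -> : z *: u - P u = (w *: u - P u) + (z - w) *: u.
  by rewrite scalerBl [RHS]addrC subrKA.
move=> h; have := le_trans h (ND _ _); rewrite NZ; have := nrm_ge0 u; nra.
Qed.

(** A bound at one point persists nearby with half its constant, by [lower_bound_lip]; compactness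
    of the parameter interval leaves finitely many constants. *)
Lemma circle_lower_bound : exists2 c, 0 < c &
  forall t, t \in `[0, 2 * pi] -> lower_bound (cexp t) c.
Proof.
have /choice[c Hc] : forall t : R, exists c : R, 0 < c /\ lower_bound (cexp t) c.
  by move=> t; have [c c0 ?] := unit_lower_bound (normc_cexp t); exists c.
pose f t : set R := [set s | `|cos s - cos t| + `|sin s - sin t| < c t / 2].
have of_ t : open (f t).
  rewrite /f -[X in open X]/((fun s => `|cos s - cos t| + `|sin s - sin t|) @^-1`
     [set x | x < c t / 2]).
  apply: open_comp; last exact: open_lt.
  move=> s _; apply: cvgD; apply: cvg_norm; apply: cvgB; try exact: cvg_cst.
    exact: continuous_cos.
  exact: continuous_sin.
have := @segment_compact R 0 (2 * pi); rewrite compact_cover.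
move=> /(_ R setT f (fun t _ => of_ t)) cov.
have {cov}[D Dfin cov] : exists2 D : set R, finite_set D & `[0, 2 * pi] `<=` cover D f.
  case: cov => [t _|D _ cov].
    by exists t => //=; rewrite /f /= !subrr normr0 addr0 divr_gt0//; case: (Hc t).
  by eexists; last exact: cov; exact: finite_fset.
have [||c0 c00 Hc0] := @finite_set_lower_bound R [set c t / 2 | t in D].
- exact: finite_image.
- by move=> x [t _ <-]; rewrite divr_gt0//; case: (Hc t).
exists c0 => // s s0.
have [t Dt fts] := cov s s0.
have ct : c0 <= c t / 2 by apply: Hc0; exists t.
have ts : normc (cexp t - cexp s) <= c t / 2.
  rewrite /cexp; set a := cos t; set b := sin t.
  have -> : Complex a b - Complex (cos s) (sin s) =
            (a - cos s)%:C%C + (b - sin s)%:C%C * Complex 0 1.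
    by apply/eqP; rewrite eq_complex /=; apply/andP; split; apply/eqP; ring.
  apply: le_trans (normcD _ _) _; rewrite normcM !normc_real.
  rewrite /= expr0n expr1n add0r sqrtr1 mulr1 distrC [X in _ + X]distrC.
  exact: ltW.
move=> u u0; have := lower_bound_lip ts (Hc t).2 u0; have := nrm_ge0 u; nra.
Qed.

Lemma annulus_lower_bound : exists2 c : R, 0 < c <= 1 &
  forall s t : R, `|s - 1| <= c -> t \in `[0, 2 * pi] -> lower_bound (s%:C%C * cexp t) c.
Proof.
have [c c0 Hc] := circle_lower_bound.
exists (Num.min 1 (c / 2)); first by rewrite lt_min ltr01 divr_gt0//= ge_min lexx.
move=> s t s1 ht.
have sz : normc (cexp t - s%:C%C * cexp t) <= c / 2.
  rewrite -{1}[cexp t]mul1r -mulrBl normcM normc_cexp mulr1.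
  rewrite -(rmorph1 (real_complex R)) -rmorphB normc_real distrC.
  by apply: le_trans s1 _; rewrite ge_min lexx orbT.
move=> u u0; have := lower_bound_lip sz (Hc _ ht) u0; have := nrm_ge0 u.
have : Num.min 1 (c / 2) <= c / 2 by rewrite ge_min lexx orbT.
nra.
Qed.

(** Only finitely many spectral points have modulus at least 1 - eps0, so a small [eta] differs from
    the distance of each such modulus to 1; points on the unit circle, at distance 0, do no harm. *)
Lemma spectrum_free_circles (b : R) : 0 < b -> exists2 eta : R, 0 < eta <= b &
  forall z : R[i], normc z = 1 - eta \/ normc z = 1 + eta ->
    exists S, resolvent_op z S.
Proof.
move=> b0.
pose A := [set `|1 - normc z| | z in spec `&` [set z | 1 - eps0 <= normc z]] `&` [set x | 0 < x].
have [||d d0 Hd] := @finite_set_lower_bound R A.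
- exact/finite_setIl/finite_image.
- by move=> x [].
pose eta := Num.min b (Num.min (d / 2) eps0).
have e0 : 0 < eta by rewrite !lt_min b0 eps0_gt0 divr_gt0.
have ed : eta <= d / 2 by rewrite /eta !ge_min lexx !orbT.
have ee : eta <= eps0 by rewrite /eta !ge_min lexx !orbT.
exists eta; first by rewrite e0 /eta ge_min lexx.
move=> z hz; apply: contrapT => sz.
have zm : `|1 - normc z| = eta.
  case: hz => ->; first by rewrite opprB addrC subrK gtr0_norm.
  by rewrite opprD addrA subrr sub0r normrN gtr0_norm.
suff : A eta by move=> /Hd; lra.
split => //=; exists z => //; split => //=.
by case: hz => ->; lra.
Qed.

(* The averages [(1 - (P / r)^n)^-1] for r = 1 + eta and r = 1 - eta differ by
   O(eta) uniformly in n, because the resolvents near the unit circle are bounded. *)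
Lemma power_decay : exists K rho, [/\ 0 <= rho, rho < 1, 0 < K &
  forall n u, phi u = 0 -> N (iter n P u) <= K * rho ^+ n * N u].
Proof.
have [c /andP[c0 c1] Hc] := annulus_lower_bound.
(* The bound c / 2 keeps both radii positive and inside the annulus where resolvents are controlled;
   the bound c^2 / 8 makes 2 eta / c^2 at most 1/4. *)
have [|eta /andP[e0 eb] He] := @spectrum_free_circles (Num.min (c / 2) (c ^+ 2 / 8)).
  by rewrite lt_min !divr_gt0// exprn_gt0.
have [e1 e2] : eta <= c / 2 /\ eta <= c ^+ 2 / 8.
  by move: eb; rewrite le_min => /andP[].
have /choice[Rz HRz] : forall z, exists S,
    (exists S', resolvent_op z S') -> resolvent_op z S.
  move=> z; have [[S HS]|nS] := pselect (exists S', resolvent_op z S').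
    by exists S.
  by exists P.
pose rp : R := 1 + eta; pose rm : R := 1 - eta.
have rp0 : 0 < rp by rewrite /rp; lra.
have rm0 : 0 < rm by rewrite /rm; lra.
have Rp (z : R[i]) : normc (z - 0) = rp -> resolvent_op z (Rz z).
  by rewrite subr0 => hz; apply/HRz/He; right.
have Rm (z : R[i]) : normc (z - 0) = rm -> resolvent_op z (Rz z).
  by rewrite subr0 => hz; apply/HRz/He; left.
pose Ep := circle_avg 0 rp Rz; pose Em := circle_avg 0 rm Rz.
have s0 n (v : V) : iter n (op_sub P 0) v = iter n P v.
  by apply: eq_iter => x; rewrite /op_sub scale0r subr0.
have iterN n (v : V) : N (iter n P v) <= N v.
  by rewrite -[leRHS]mul1r -(expr1n _ n); apply: nbounded_iter => // x; rewrite mul1r.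
have rC (a : R) n : normc (a%:C%C ^- n) = `|a| ^- n.
  by rewrite normcV normcX normc_real.
have ang n (k : 'I_n) : 2 * pi / n%:R * k%:R \in `[(0 : R), 2 * pi].
  have p0 : 0 < 2 * pi :> R by rewrite mulr_gt0// pi_gt0.
  have n0 : (0 : R) < n%:R by rewrite ltr0n (leq_ltn_trans _ (ltn_ord k)).
  rewrite in_itv /=; apply/andP; split.
    by rewrite mulr_ge0 ?divr_ge0 ?(ltW p0).
  by rewrite mulrAC ler_pdivrMr// ler_wpM2l ?(ltW p0)// ler_nat ltnW.
(* At each node w S u = u + P (S u), so the two summands differ by P y with
   [y := Rz wp u - Rz wm u]. The resolvent identity (wm - P) y = (wm - wp) Rz wp u and two uses of
   the lower bound give N y <= (2 eta / c^2) N u. *)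
have diff n u : (0 < n)%N -> phi u = 0 -> N (Ep n u - Em n u) <= 1 / 4 * N u.
  move=> n0 u0; rewrite /Ep /Em /circle_avg /avg -scalerBr -sumrB NZ.
  rewrite normcV normc_nat mulrC ler_pdivrMr ?ltr0n//.
  apply: le_trans (nrm_sum ND NZ _) _.
  apply: (@le_trans _ _ (\sum_(k < n) 1 / 4 * N u)); last first.
    by rewrite sumr_const cardT size_enum_ord mulr_natr.
  apply: ler_sum => k _.
  set wp := rp%:C%C * _; set wm := rm%:C%C * _.
  have rwp : resolvent_op (0 + wp) (Rz (0 + wp)).
    exact: (circle_resolvent rp0 Rp n k).
  have rwm : resolvent_op (0 + wm) (Rz (0 + wm)).
    exact: (circle_resolvent rm0 Rm n k).
  rewrite !add0r in rwp rwm *.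
  have [SRp _ _] := rwp; have [SRm _ _] := rwm.
  have up := resolvent_phi phiP rwp u0; have um := resolvent_phi phiP rwm u0.
  set y := Rz wp u - Rz wm u.
  have -> : wp *: Rz wp u - wm *: Rz wm u = P y.
    have e (w : R[i]) S : (forall v, w *: S v - P (S v) = v) ->
        w *: S u = u + P (S u) by move=> eS; rewrite -{2}(eS u) subrK.
    rewrite /y (e wp (Rz wp))// (e wm (Rz wm))// linearB.
    by rewrite opprD addrACA subrr add0r.
  have h1 : c * N (Rz wp u) <= N u.
    rewrite -{2}(SRp u); apply: Hc => //.
    by rewrite /rp addrAC subrr add0r gtr0_norm//; lra.
  have h2 : c * N y <= 2 * eta * N (Rz wp u).
    have -> : 2 * eta * N (Rz wp u) = N ((wm - wp) *: Rz wp u).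
      rewrite NZ /wm /wp -mulrBl normcM normc_unity_root mulr1 -rmorphB normc_real.
      congr (_ * _); rewrite /rm /rp.
      by rewrite (_ : _ - _ = - (2 * eta)) ?normrN ?gtr0_norm ?mulr_gt0//; ring.
    have -> : (wm - wp) *: Rz wp u = wm *: y - P y.
      have e (w : R[i]) S : (forall v, w *: S v - P (S v) = v) ->
          P (S u) = w *: S u - u by move=> eS; rewrite -{3}(eS u) subKr.
      rewrite /y (linearB P) (e wp (Rz wp))// (e wm (Rz wm))// scalerBr scalerBl.
      by rewrite (opprB (wm *: _)) subrKA opprB subrKA.
    apply: Hc; last 2 first.
    - exact: ang.
    - by rewrite /y linearB up um subrr.
    by rewrite /rm addrAC subrr add0r normrN gtr0_norm//; lra.
  apply: le_trans (PN _) _; have := nrm_ge0 u; have := nrm_ge0 y.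
  have v0 := nrm_ge0 (Rz wp u); move=> y0 u0'.
  have h3 : c ^+ 2 * N y <= 2 * eta * N u.
    rewrite expr2 -mulrA; apply: (@le_trans _ _ (c * (2 * eta * N (Rz wp u)))).
      by rewrite ler_pM2l.
    by rewrite mulrCA ler_pM2l ?mulr_gt0.
  have c2 : 0 < c ^+ 2 by rewrite exprn_gt0.
  have h4 : 2 * eta * N u <= c ^+ 2 / 4 * N u by rewrite ler_wpM2r//; lra.
  by rewrite -(ler_pM2l c2); apply: le_trans h3 (le_trans h4 _); rewrite !mulrA mulr1.
have [n1 Hn1] : exists n0, forall n, (n0 <= n)%N -> rp^-1 ^+ n < 1 / 8.
  apply: exprn_small; last lra.
  by rewrite invr_ge0 ltW//= invf_lt1// /rp; lra.
(* On the outer circle the average is close to the identity, because (P / rp)^n has norm at most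
   rp^-n. *)
have Ep1 n u : (0 < n)%N -> (n1 <= n)%N -> N (Ep n u - u) <= 1 / 4 * N u.
  move=> n0 nn; have := circle_avg_right rp0 Rp u n0.
  rewrite -/(Ep n) s0 => e.
  have := Hn1 _ nn; rewrite exprVn => h.
  have r0 : 0 < rp ^- n by rewrite invr_gt0 exprn_gt0.
  have h1 : N (Ep n u - u) <= rp ^- n * N (Ep n u).
    by rewrite -{2}e subKr NZ rC gtr0_norm// ler_wpM2l ?iterN// ltW.
  have := ND (Ep n u - u) u; rewrite subrK => h2.
  have h3 : rp ^- n * N (Ep n u) <= 1 / 8 * N (Ep n u).
    by rewrite ler_wpM2r ?nrm_ge0 ?ltW.
  have := le_trans h1 h3; have := nrm_ge0 u; lra.
(* The summand [rm ^- n1.+1] covers the times n <= n1, where only contractivity is used. *)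
exists (3 + rm ^- n1.+1), rm; split.
- exact: ltW.
- by rewrite /rm; lra.
- by rewrite ltr_wpDr// invr_ge0 exprn_ge0 ?ltW.
move=> n u u0; have rn0 : 0 < rm ^+ n by rewrite exprn_gt0.
have [nn|nn] := leqP n1.+1 n; last first.
  apply: le_trans (iterN _ _) _; rewrite -[leLHS]mul1r ler_wpM2r ?nrm_ge0//.
  have : 1 <= rm ^- n1.+1 * rm ^+ n.
    rewrite mulrC ler_pdivlMr ?exprn_gt0// mul1r; apply: ler_wiXn2l (ltnW nn).
    - exact: ltW.
    - by rewrite /rm; lra.
  by move=> h; rewrite mulrDl; apply: (le_trans h); rewrite lerDr mulr_ge0// ltW.
have n0 : (0 < n)%N by apply: leq_trans nn.
(* [g] is chosen so that the inner average returns [u]. The outer average of [g] is within N g / 4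
   of both [g] and [u]; hence N g <= 2 N u, and (P / rm)^n u = u - g has norm at most 3 N u. *)
pose g := u - rm%:C%C ^- n *: iter n P u.
have g0 : phi g = 0.
  by rewrite /g linearB linearZ /= (phi_iter phiP) u0 mulr0 subr0.
have Emg : Em n g = u.
  by have := circle_avg_left rm0 Rm u n0; rewrite s0.
have h1 := diff n g n0 g0; have h2 := Ep1 n g n0 (ltnW nn).
rewrite Emg in h1.
have h3 : N g <= 2 * N u.
  have := ND (g - Ep n g) (Ep n g); have := ND (Ep n g - u) u.
  rewrite !subrK; have : N (g - Ep n g) = N (Ep n g - g) by rewrite -nrmN // opprB.
  move=> ->; lra.
have : N (rm%:C%C ^- n *: iter n P u) <= 3 * N u.
  have := nrmB u g; rewrite {1}/g opprB addrC subrK; lra.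
rewrite NZ rC gtr0_norm// mulrC ler_pdivrMr// => h.
apply: le_trans h _; rewrite mulrAC; apply: ler_wpM2r; first exact: nrm_ge0.
apply: ler_wpM2r; first exact: ltW.
by rewrite lerDl invr_ge0 exprn_ge0// ltW.
Qed.
End Gap.

(** * Kernels and square integrable functions *)

Local Open Scope ereal_scope.

Section Mixture.
Context d (T : measurableType d) (R : realType).

(** A probability seen as a kernel that ignores its starting point, so that results on compositions
    and products of kernels apply to a fixed initial law. *)
Definition cst_kernel (m : probability T R) :=
  kprobability (@measurable_cst _ _ T (pprobability T R) setT (m : pprobability T R)).

Lemma integral_mixture (m : probability T R) (m' : {measure set T -> \bar R})
    (k : R.-pker T ~> T) (f : T -> \bar R) :
  (forall A, measurable A -> \int[m]_x k x A = m' A) ->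
  (forall x, 0 <= f x) -> measurable_fun setT f ->
  \int[m']_x f x = \int[m]_x \int[k x]_y f y.
Proof.
move=> mk f0 mf.
have := @integral_kcomp _ _ _ T T T R (cst_kernel m) (@kernel.kernel_snd _ _ _ T T T R k) point f f0 mf.
move=> <-; apply: eq_measure_integral => A mA _.
by rewrite -mk.
Qed.
 
(** A copy of [P x] that carries the probability structure, so that statements about a [probability]
    apply to it. *)
Definition kernel_prob (P : R.-pker T ~> T) (x : T) : set T -> \bar R := P x.
HB.instance Definition _ P x := Measure.on (kernel_prob P x).
HB.instance Definition _ P x := Measure_isProbability.Build _ _ _ (kernel_prob P x) (prob_kernel x).

Lemma measurable_int_kernel (k : R.-pker T ~> T) (f : T -> \bar R) :
  (forall x, 0 <= f x) -> measurable_fun setT f ->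
  measurable_fun setT (fun x => \int[k x]_y f y).
Proof.
by move=> f0 mf; apply: measurable_fun_integral_kernel => // U; exact: measurable_kernel.
Qed.

Lemma kernel_comp_exists (k l : R.-pker T ~> T) : exists m : R.-pker T ~> T,
  forall x A, m x A = \int[k x]_y l y A.
Proof.
pose m := mkcomp_noparam k l.
have m1 x : m x setT = 1.
  rewrite /m /mkcomp_noparam /= /kcomp_noparam.
  under eq_integral do rewrite prob_kernel.
  by rewrite integral_cst// mul1e prob_kernel.
pose M : R.-pker T ~> T := HB.pack m (Kernel_isProbability.Build _ _ T T R m m1).
by exists M.
Qed.

Lemma kernel_iter_exists (P : R.-pker T ~> T) n : exists k : R.-pker T ~> T,
  forall x A, k x A = kernel_iter P n x A.
Proof.
elim: n => [|n [k Hk]].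
  by exists (kdirac (@measurable_id _ T setT)).
have [m Hm] := kernel_comp_exists P k; exists m => x A; rewrite Hm /=.
by under eq_integral do rewrite Hk.
Qed.

(** The iterates as genuine kernels: [kernel_iter] is a bare set function, without the measure
    structure that the integration lemmas require. *)
Definition kiter P n : R.-pker T ~> T := projT1 (cid (kernel_iter_exists P n)).

Lemma kiterE P n x A : kiter P n x A = kernel_iter P n x A.
Proof. by rewrite /kiter; case: cid. Qed.

Lemma integral_kiter0 P x f : (forall x, 0 <= f x) -> measurable_fun setT f ->
  \int[kiter P 0 x]_y f y = f x.
Proof.
move=> f0 mf; rewrite (eq_measure_integral (\d_x)).
  by rewrite integral_dirac// diracT mul1e.
by move=> A mA _; rewrite kiterE.
Qed.

Lemma integral_kiterS P n x f : (forall x, 0 <= f x) -> measurable_fun setT f ->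
  \int[kiter P n.+1 x]_y f y = \int[P x]_y \int[kiter P n y]_z f z.
Proof.
move=> f0 mf; apply: (@integral_mixture (kernel_prob P x)) => // A mA.
by rewrite kiterE /=; apply: eq_integral => y _; rewrite kiterE.
Qed.

Lemma integral_kiterD P m n x f : (forall x, 0 <= f x) -> measurable_fun setT f ->
  \int[kiter P (m + n) x]_y f y = \int[kiter P m x]_y \int[kiter P n y]_z f z.
Proof.
move=> f0 mf; elim: m x => [|m IH] x.
  rewrite add0n integral_kiter0//; last exact: measurable_int_kernel.
  by move=> y; exact: integral_ge0.
rewrite addSn integral_kiterS//.
rewrite [RHS]integral_kiterS; last 2 first.
  by move=> y; exact: integral_ge0.
  exact: measurable_int_kernel.
by apply: eq_integral => y _; rewrite IH.
Qed.

Lemma kiter_invariant P (mu : probability T R) n : invariant_probability P mu ->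
  invariant_probability (kiter P n) mu.
Proof.
move=> inv; elim: n => [|n IH] A mA.
  under eq_integral do rewrite kiterE /= diracE.
  rewrite (_ : mu A = \int[mu]_x (\1_A x)%:E); last by rewrite integral_indic// setIT.
  by apply: eq_integral => x _; rewrite indicE.
under eq_integral do rewrite kiterE /=.
under eq_integral do under eq_integral do rewrite -kiterE.
rewrite -(integral_mixture inv)//; last exact: measurable_kernel.
exact: IH.
Qed.

Lemma integral_invariant P (mu : probability T R) f : invariant_probability P mu ->
  (forall x, 0 <= f x) -> measurable_fun setT f ->
  \int[mu]_x \int[P x]_y f y = \int[mu]_x f x.
Proof. by move=> inv f0 mf; rewrite -(integral_mixture inv). Qed.
End Mixture.

Section SquareIntegrable.
Context d (T : measurableType d) (R : realType) (m : probability T R).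
Implicit Types f g : T -> R.

Definition sqint f : \bar R := \int[m]_x ((f x ^+ 2)%R)%:E.

Lemma integral_prob_cst (c : \bar R) : \int[m]_x c = c.
Proof. rewrite integral_cst// -[RHS]mule1; congr (_ * _); exact: probability_setT. Qed.

Lemma Rintegral_prob_cst (c : R) : (\int[m]_x c)%R = c.
Proof. by rewrite /Rintegral integral_prob_cst. Qed.

Lemma measurable_sq f : measurable_fun setT f ->
  measurable_fun setT (fun x => ((f x ^+ 2)%R)%:E).
Proof. by move=> mf; apply/measurable_EFinP/measurable_funX. Qed.

Lemma sqint_ge0 f : 0 <= sqint f.
Proof. by apply: integral_ge0 => x _; rewrite lee_fin sqr_ge0. Qed.

Lemma sq_integrable f : measurable_fun setT f -> sqint f < +oo ->
  m.-integrable setT (EFin \o f).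
Proof.
move=> mf fi; apply: (@le_integrable _ _ _ m setT measurableT _
  (fun x => (1 + f x ^+ 2)%:E)).
- exact/measurable_EFinP.
- move=> x _ /=; rewrite lee_fin [leRHS]ger0_norm ?addr_ge0 ?sqr_ge0// ler_norml.
  have := sqr_ge0 (f x - 1)%R; have := sqr_ge0 (f x + 1)%R.
  by rewrite !expr2 => ? ?; apply/andP; split; nra.
- apply/integrableP; split.
    by apply/measurable_EFinP/measurable_funD => //; exact: measurable_funX.
  rewrite (eq_integral (fun x => 1 + ((f x ^+ 2)%R)%:E)); last first.
    by move=> x _; rewrite gee0_abs ?lee_fin ?addr_ge0 ?sqr_ge0// EFinD.
  rewrite ge0_integralD//; last 2 first.
  + by move=> x _; rewrite lee_fin sqr_ge0.
  + exact: measurable_sq.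
  by rewrite integral_prob_cst lte_add_pinfty// ltry.
Qed.

Lemma sq_mul_integrable f g : measurable_fun setT f -> measurable_fun setT g ->
  sqint f < +oo -> sqint g < +oo -> m.-integrable setT (fun x => ((f x * g x)%R)%:E).
Proof.
move=> mf mg fi gi; apply: (@le_integrable _ _ _ m setT measurableT _
  (fun x => (f x ^+ 2 + g x ^+ 2)%:E)).
- by apply/measurable_EFinP/measurable_funM.
- move=> x _ /=; rewrite lee_fin [leRHS]ger0_norm ?addr_ge0 ?sqr_ge0// ler_norml.
  have := sqr_ge0 (f x - g x)%R; have := sqr_ge0 (f x + g x)%R.
  have := sqr_ge0 (f x); have := sqr_ge0 (g x).
  by rewrite !expr2 => ? ? ? ?; apply/andP; split; nra.
- apply/integrableP; split.
    by apply/measurable_EFinP/measurable_funD; exact: measurable_funX.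
  rewrite (eq_integral (fun x => ((f x ^+ 2)%R)%:E + ((g x ^+ 2)%R)%:E)); last first.
    by move=> x _; rewrite gee0_abs ?lee_fin ?addr_ge0 ?sqr_ge0// EFinD.
  rewrite ge0_integralD//; last 4 first.
  + by move=> x _; rewrite lee_fin sqr_ge0.
  + exact: measurable_sq.
  + by move=> x _; rewrite lee_fin sqr_ge0.
  + exact: measurable_sq.
  by rewrite lte_add_pinfty.
Qed.

Lemma sqintB_cst f c : measurable_fun setT f -> sqint f < +oo ->
  sqint (fun x => f x - c)%R = sqint f - (2 * c * \int[m]_x f x - c ^+ 2)%:E.
Proof.
move=> mf fi; have If := sq_integrable mf fi.
have If2 : m.-integrable setT (fun x => ((f x ^+ 2)%R)%:E).
  apply/integrableP; split; first exact: measurable_sq.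
  by rewrite (eq_integral (fun x => ((f x ^+ 2)%R)%:E))// => x _; rewrite gee0_abs// lee_fin sqr_ge0.
have Ic : m.-integrable setT (fun x => (2 * c * f x - c ^+ 2)%:E).
  apply: (@integrableB _ _ _ m setT measurableT
    (fun x => (2 * c)%:E * (f x)%:E) (fun=> (c ^+ 2)%:E)).
    exact: integrableZl.
  exact: finite_measure_integrable_cst.
rewrite /sqint (eq_integral (fun x => ((f x ^+ 2)%R)%:E - (2 * c * f x - c ^+ 2)%:E)); last first.
  by move=> x _; rewrite -EFinB; congr EFin; ring.
rewrite integralB//; congr (_ - _).
rewrite -[LHS]fineK; last exact: integrable_fin_num.
congr EFin; rewrite -/(Rintegral _ _ _) RintegralB//; last 2 first.
- exact: (@integrableZl _ _ _ m setT measurableT (2 * c)%R (fun x => (f x)%:E)).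
- exact: finite_measure_integrable_cst.
by rewrite RintegralZl// Rintegral_prob_cst.
Qed.

(** Jensen's inequality for the square: the second moment about the mean, computed by [sqintB_cst],
    is nonnegative. *)
Lemma sq_Rintegral_le f : measurable_fun setT f ->
  ((\int[m]_x f x) ^+ 2)%R%:E <= sqint f.
Proof.
move=> mf; have [->|fi] := eqVneq (sqint f) +oo; first by rewrite leey.
have {}fi : sqint f < +oo by rewrite ltey.
have := sqint_ge0 (fun x => f x - \int[m]_x f x)%R; rewrite sqintB_cst//.
have : sqint f \is a fin_num by rewrite ge0_fin_numE// sqint_ge0.
case: (sqint f) => // a _; rewrite -EFinB !lee_fin; set c := (\int[m]_x f x)%R.
rewrite !expr2; lra.
Qed.
End SquareIntegrable.

Section ComplexL2.
Context d (T : measurableType d) (R : realType) (mu : probability T R).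
Implicit Types F G : T -> R[i].

Lemma normc_sqr (z : R[i]) : (normc z ^+ 2 = complex.Re z ^+ 2 + complex.Im z ^+ 2)%R.
Proof. by case: z => a b; rewrite /= sqr_sqrtr// addr_ge0 ?sqr_ge0. Qed.

Lemma measurable_normc F : cmeasurable F -> measurable_fun setT (fun x => normc (F x)).
Proof.
move=> [mR mI].
rewrite (_ : (fun x => _) = Num.sqrt \o
   (fun x => complex.Re (F x) ^+ 2 + complex.Im (F x) ^+ 2)%R).
  apply: measurableT_comp; last by apply: measurable_funD; exact: measurable_funX.
  apply: continuous_measurable_fun; exact: sqrt_continuous.
by apply/funext => x /=; case: (F x).
Qed.

Lemma measurable_normc_sq F : cmeasurable F ->
  measurable_fun setT (fun x => ((normc (F x) ^+ 2)%R)%:E).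
Proof. by move=> mF; apply/measurable_EFinP/measurable_funX/measurable_normc. Qed.

Definition csq F : \bar R := \int[mu]_x ((normc (F x) ^+ 2)%R)%:E.

Lemma csqE F : cmeasurable F ->
  csq F = sqint mu (fun x => complex.Re (F x)) + sqint mu (fun x => complex.Im (F x)).
Proof.
move=> [mR mI]; rewrite /csq /sqint -ge0_integralD//; last 4 first.
- by move=> x _; rewrite lee_fin sqr_ge0.
- exact: measurable_sq.
- by move=> x _; rewrite lee_fin sqr_ge0.
- exact: measurable_sq.
by apply: eq_integral => x _; rewrite normc_sqr EFinD.
Qed.

Lemma L2norm_sqr F : L2norm mu F `^ 2 = csq F.
Proof.
rewrite /L2norm poweR_Lnorm//; apply: eq_integral => x _.
by rewrite /= ger0_norm ?normc_ge0// powR_mulrn// normc_ge0.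
Qed.

Lemma L2_csq F : L2 mu F <-> cmeasurable F /\ csq F < +oo.
Proof.
rewrite /L2 -L2norm_sqr; split => -[mF h]; split => //; first exact: poweR_lty.
exact: lty_poweRy h.
Qed.

Lemma L2P F : L2 mu F <-> [/\ cmeasurable F,
  sqint mu (fun x => complex.Re (F x)) < +oo & sqint mu (fun x => complex.Im (F x)) < +oo].
Proof.
split=> [/L2_csq[mF]|[mF h1 h2]]; last first.
  by apply/L2_csq; split => //; rewrite csqE// lte_add_pinfty.
rewrite csqE// => h; split => //; apply: le_lt_trans h.
  by rewrite leeDl// sqint_ge0.
by rewrite leeDr// sqint_ge0.
Qed.

Lemma cmeasurable_lin (a : R[i]) F G : cmeasurable F -> cmeasurable G ->
  cmeasurable (fun x => a * F x + G x)%R.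
Proof.
move=> [FR FI] [GR GI]; split.
- rewrite (_ : (fun x => _) = (fun x => complex.Re a * complex.Re (F x) -
    complex.Im a * complex.Im (F x) + complex.Re (G x))%R).
    by apply: measurable_funD => //; apply: measurable_funB; exact: measurable_funM.
  by apply/funext => x; case: a (F x) (G x) => [? ?] [? ?] [? ?].
- rewrite (_ : (fun x => _) = (fun x => complex.Re a * complex.Im (F x) +
    complex.Im a * complex.Re (F x) + complex.Im (G x))%R).
    by apply: measurable_funD => //; apply: measurable_funD; exact: measurable_funM.
  by apply/funext => x; case: a (F x) (G x) => [? ?] [? ?] [? ?].
Qed.

Lemma L2_lin (a : R[i]) F G : L2 mu F -> L2 mu G -> L2 mu (fun x => a * F x + G x)%R.
Proof.
move=> /L2_csq[mF hF] /L2_csq[mG hG]; apply/L2_csq.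
have maFG := cmeasurable_lin a mF mG; split => //.
have mn := measurable_normc_sq.
have n0 H x : 0 <= ((normc (H x : R[i]) ^+ 2)%R)%:E by rewrite lee_fin sqr_ge0.
apply: (@le_lt_trans _ _ (\int[mu]_x ((2 * normc a ^+ 2)%:E * ((normc (F x) ^+ 2)%R)%:E +
   2%:E * ((normc (G x) ^+ 2)%R)%:E))).
  apply: ge0_le_integral => //.
  - exact: mn.
  - apply: emeasurable_funD; apply: measurable_funeM; exact: mn.
  - move=> x _; rewrite -!EFinM -EFinD lee_fin.
    have := normcD (a * F x)%R (G x); rewrite normcM.
    have := normc_ge0 (a * F x + G x)%R; have := normc_ge0 (G x).
    have := normc_ge0 (F x); have := normc_ge0 a.
    set p := normc a; set q := normc (F x); set r := normc (G x); set s := normc _.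
    move=> p0 q0 r0 s0 h; have pq : (0 <= p * q)%R by rewrite mulr_ge0.
    apply: (@le_trans _ _ ((p * q + r) ^+ 2)%R).
      by rewrite ler_sqr ?nnegrE ?addr_ge0.
    have := sqr_ge0 (p * q - r)%R; rewrite !expr2; nra.
rewrite ge0_integralD//; last 4 first.
- by move=> x _; rewrite mule_ge0// lee_fin mulr_ge0// sqr_ge0.
- by apply: measurable_funeM; exact: mn.
- by move=> x _; rewrite mule_ge0// lee_fin.
- by apply: measurable_funeM; exact: mn.
rewrite ge0_integralZl_EFin//; [|exact: mn|by rewrite mulr_ge0// sqr_ge0].
rewrite ge0_integralZl_EFin//; [|exact: mn].
by rewrite lte_add_pinfty// lte_mul_pinfty// lee_fin mulr_ge0// sqr_ge0//.
Qed.

Lemma L2norm_triangle F G : L2 mu F -> L2 mu G ->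
  L2norm mu (fun x => F x + G x)%R <= L2norm mu F + L2norm mu G.
Proof.
move=> [mF _] [mG _]; rewrite /L2norm.
apply: le_trans (minkowski_EFin mu (measurable_normc mF) (measurable_normc mG) _); last first.
  by rewrite ler1n.
have le_half (x y : \bar R) : 0 <= x -> x <= y -> x `^ 2^-1 <= y `^ 2^-1.
  move=> x0 xy; rewrite gt0_ler_poweR//.
  - by rewrite in_itv /= x0 leey.
  - by rewrite in_itv /= (le_trans x0 xy) leey.
rewrite unlock; apply: le_half.
  by apply: integral_ge0 => x _; exact: poweR_ge0.
apply: ge0_le_integral => //.
- move=> x _; exact: poweR_ge0.
- apply: (measurableT_comp (measurable_poweR _)); apply: measurableT_comp => //.
  apply/measurable_EFinP/(@measurable_normc (fun x => F x + G x)%R).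
  rewrite (_ : (fun x => _) = (fun x => 1 * F x + G x)%R).
    exact: cmeasurable_lin.
  by apply/funext => x; rewrite mul1r.
- apply: (measurableT_comp (measurable_poweR _)); apply: measurableT_comp => //.
  exact/measurable_EFinP/(measurable_funD (measurable_normc mF) (measurable_normc mG)).
- move=> x _; rewrite gt0_ler_poweR//.
  + by rewrite in_itv -[_ && _]/((0 <= `|_|%E) && (_ <= +oo)) abse_ge0 leey.
  + by rewrite in_itv -[_ && _]/((0 <= `|_|%E) && (_ <= +oo)) abse_ge0 leey.
  rewrite /= lee_fin !ger0_norm ?addr_ge0 ?normc_ge0//; exact: normcD.
Qed.

Lemma L2normZ (a : R[i]) F : cmeasurable F ->
  L2norm mu (fun x => a * F x)%R = (normc a)%:E * L2norm mu F.
Proof.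
move=> mF; rewrite /L2norm unlock.
under eq_integral => x _ do rewrite normcM EFinM abseM poweRM ?abse_ge0//.
rewrite (gee0_abs (_ : 0 <= (normc a)%:E)) ?lee_fin ?normc_ge0//.
rewrite poweR_EFin ge0_integralZl_EFin//; last 3 first.
- move=> x _; exact: poweR_ge0.
- apply: (measurableT_comp (measurable_poweR _)); apply: measurableT_comp => //.
  by apply/measurable_EFinP/(measurable_normc mF).
- by rewrite powR_ge0.
rewrite poweRM ?lee_fin ?powR_ge0//; last first.
  by apply: integral_ge0 => x _; exact: poweR_ge0.
by rewrite poweR_EFin -powRrM divff// powRr1// normc_ge0.
Qed.

Lemma L2norm_eq0 F : L2 mu F -> L2norm mu F = 0 -> F = (fun=> 0%R) %[ae mu].
Proof.
move=> [mF _] /Lnorm_eq0_eq0 h.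
have {h} : (fun x => (normc (F x))%:E) = \0 %[ae mu].
  by apply: h => //; apply/measurable_EFinP/measurable_normc.
apply: filterS => x /= + _ => /(_ Logic.I)[]; exact: eq0_normc.
Qed.

Lemma L2norm_ae F G : cmeasurable F -> cmeasurable G -> F = G %[ae mu] ->
  L2norm mu F = L2norm mu G.
Proof.
move=> mF mG FG; rewrite /L2norm unlock.
have mH (H : T -> R[i]) : cmeasurable H ->
    measurable_fun setT (fun x => `|(normc (H x))%:E| `^ 2).
  move=> mH; apply: (measurableT_comp (measurable_poweR _)); apply: measurableT_comp => //.
  by apply/measurable_EFinP/measurable_normc.
rewrite (ae_eq_integral _ _ measurableT (mH _ mF) (mH _ mG))//.
by apply: filterS FG => x /= + _ => /(_ Logic.I) ->.
Qed.
End ComplexL2.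

(** * Geometric decay on mean-zero functions *)

Local Close Scope ereal_scope.

Section L2Quotient.
Context d (T : measurableType d) (R : realType) (mu : probability T R).
Implicit Types F G : T -> R[i].

(* A chosen representative of the almost everywhere class of [F]: the vectors
   of [L2q] are these representatives, so that equality of vectors is almost
   everywhere equality. *)
Definition canon F : T -> R[i] := xget (fun=> 0) [set G | L2 mu G /\ G = F %[ae mu]].

Lemma canonP F : L2 mu F -> L2 mu (canon F) /\ canon F = F %[ae mu].
Proof.
move=> LF; apply: (@xgetPex _ (fun=> 0) [set G | L2 mu G /\ G = F %[ae mu]]).
by exists F; split => //; exact: ae_eq_refl.
Qed.

Lemma canon_ae F G : F = G %[ae mu] -> canon F = canon G.
Proof.
move=> FG; rewrite /canon; congr (xget _ _); apply/seteqP; split => H [LH HF]; split => //.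
  exact: ae_eq_trans FG.
by apply: ae_eq_trans HF _; exact: ae_eq_sym.
Qed.

Record L2q : Type := L2Class {
  rep : T -> R[i];
  rep_L2 : L2 mu rep;
  rep_canon : canon rep = rep }.

Lemma rep_inj u v : rep u = rep v -> u = v.
Proof.
case: u v => [f Lf cf] [g Lg cg] /= fg; case: _ / fg Lg cg => Lg cg.
by congr L2Class; exact: Prop_irrelevance.
Qed.

Lemma rep_ae u v : rep u = rep v %[ae mu] -> u = v.
Proof. by move/canon_ae; rewrite !rep_canon; exact: rep_inj. Qed.

HB.instance Definition _ := gen_eqMixin L2q.
HB.instance Definition _ := gen_choiceMixin L2q.

Lemma canonK F : L2 mu F -> canon (canon F) = canon F.
Proof. by move=> LF; apply/canon_ae; case: (canonP LF). Qed.

Definition cls F (LF : L2 mu F) : L2q := L2Class (canonP LF).1 (canonK LF).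

Lemma rep_cls F (LF : L2 mu F) : rep (cls LF) = F %[ae mu].
Proof. exact: (canonP LF).2. Qed.

Lemma L2_0 : L2 mu (fun=> 0).
Proof.
have c0 : cmeasurable (fun _ : T => 0 : R[i]) by split; exact: measurable_cst.
apply/L2_csq; split => //.
by rewrite /csq; under eq_integral do rewrite (normc0 R) expr0n; rewrite integral0.
Qed.

Lemma L2_scale a F : L2 mu F -> L2 mu (fun x => a * F x).
Proof.
move=> LF; rewrite (_ : (fun x => _) = (fun x => a * F x + 0)).
  exact: L2_lin LF L2_0.
by apply/funext => x; rewrite addr0.
Qed.

Lemma L2_add F G : L2 mu F -> L2 mu G -> L2 mu (fun x => F x + G x).
Proof.
move=> LF LG; rewrite (_ : (fun x => _) = (fun x => 1 * F x + G x)).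
  exact: L2_lin.
by apply/funext => x; rewrite mul1r.
Qed.

Definition zeroq := cls L2_0.
Definition addq u v := cls (L2_add (rep_L2 u) (rep_L2 v)).
Definition scaleq a u := cls (L2_scale a (rep_L2 u)).
Definition oppq u := scaleq (-1) u.

Let repD u v : rep (addq u v) = (fun x => rep u x + rep v x) %[ae mu].
Proof. exact: rep_cls. Qed.
Let repZ a u : rep (scaleq a u) = (fun x => a * rep u x) %[ae mu].
Proof. exact: rep_cls. Qed.
Let rep0 : rep zeroq = (fun=> 0) %[ae mu].
Proof. exact: rep_cls. Qed.

Lemma addqA : associative addq.
Proof.
move=> u v w; apply: rep_ae; have h1 := repD u (addq v w); have h2 := repD v w.
have h3 := repD (addq u v) w; have h4 := repD u v.
near=> x => _; rewrite (near h1 x)// (near h2 x)// (near h3 x)// (near h4 x)//.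
by rewrite addrA.
Unshelve. all: by end_near. Qed.

Lemma addqC : commutative addq.
Proof.
move=> u v; apply: rep_ae; have h1 := repD u v; have h2 := repD v u.
near=> x => _; rewrite (near h1 x)// (near h2 x)//.
by rewrite addrC.
Unshelve. all: by end_near. Qed.

Lemma add0q : left_id zeroq addq.
Proof.
move=> u; apply: rep_ae; have h1 := repD zeroq u; have h2 := rep0.
near=> x => _; rewrite (near h1 x)// (near h2 x)//.
by rewrite add0r.
Unshelve. all: by end_near. Qed.

Lemma addNq : left_inverse zeroq oppq addq.
Proof.
move=> u; apply: rep_ae; have h1 := repD (oppq u) u; have h2 := rep0.
have h3 := repZ (-1) u.
near=> x => _; rewrite (near h1 x)// (near h2 x)// (near h3 x)//.
by rewrite mulN1r addNr.
Unshelve. all: by end_near. Qed.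

HB.instance Definition _ := GRing.isZmodule.Build L2q addqA addqC add0q addNq.

Lemma scaleqA a b u : scaleq a (scaleq b u) = scaleq (a * b) u.
Proof.
apply: rep_ae; have h1 := repZ a (scaleq b u); have h2 := repZ b u.
have h3 := repZ (a * b) u.
near=> x => _; rewrite (near h1 x)// (near h2 x)// (near h3 x)//.
by rewrite mulrA.
Unshelve. all: by end_near. Qed.

Lemma scale1q : left_id 1 scaleq.
Proof.
move=> u; apply: rep_ae; have h1 := repZ 1 u.
by near=> x => _; rewrite (near h1 x)// mul1r.
Unshelve. all: by end_near. Qed.

Lemma scaleqDr : right_distributive scaleq +%R.
Proof.
move=> a u v; apply: rep_ae; have h1 := repD u v; have h2 := repZ a (addq u v).
have h3 := repZ a u; have h4 := repZ a v; have h5 := repD (scaleq a u) (scaleq a v).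
near=> x => _; rewrite (near h2 x)// (near h1 x)// (near h5 x)// (near h3 x)//.
by rewrite (near h4 x)// mulrDr.
Unshelve. all: by end_near. Qed.

Lemma scaleqDl u : {morph scaleq^~ u : a b / a + b}.
Proof.
move=> a b; apply: rep_ae; have h1 := repZ (a + b) u.
have h3 := repZ a u; have h4 := repZ b u; have h5 := repD (scaleq a u) (scaleq b u).
near=> x => _; rewrite (near h1 x)// (near h5 x)// (near h3 x)//.
by rewrite (near h4 x)// mulrDl.
Unshelve. all: by end_near. Qed.

HB.instance Definition _ := GRing.Zmodule_isLmodule.Build R[i] L2q
  scaleqA scale1q scaleqDr scaleqDl.

Lemma repDE u v : rep (u + v) = (fun x => rep u x + rep v x) %[ae mu].
Proof. exact: repD. Qed.
Lemma repZE a u : rep (a *: u) = (fun x => a * rep u x) %[ae mu].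
Proof. exact: repZ. Qed.
Lemma rep0E : rep 0 = (fun=> 0) %[ae mu].
Proof. exact: rep0. Qed.

Lemma rep_lin a u v : rep (a *: u + v) = (fun x => a * rep u x + rep v x) %[ae mu].
Proof.
have h1 := repDE (a *: u) v; have h2 := repZE a u.
by near=> x => _; rewrite (near h1 x)// (near h2 x).
Unshelve. all: by end_near. Qed.

Lemma repBE u v : rep (u - v) = (fun x => rep u x - rep v x) %[ae mu].
Proof.
have h1 := rep_lin (-1) v u; rewrite scaleN1r addrC in h1.
by near=> x => _; rewrite (near h1 x)// mulN1r addrC.
Unshelve. all: by end_near. Qed.

Lemma rep_sum n (c : 'I_n -> R[i]) (e : 'I_n -> L2q) :
  rep (\sum_(i < n) c i *: e i) = (fun x => \sum_(i < n) c i * rep (e i) x) %[ae mu].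
Proof.
elim: n c e => [|n IH] c e.
  rewrite big_ord0; have h := rep0E.
  by near=> x => _; rewrite (near h x)// big_ord0.
rewrite big_ord_recl; have h1 := rep_lin (c ord0) (e ord0) (\sum_(i < n) c (lift ord0 i) *: e (lift ord0 i)).
have h2 := IH (fun i => c (lift ord0 i)) (fun i => e (lift ord0 i)).
by near=> x => _; rewrite (near h1 x)// (near h2 x)// big_ord_recl.
Unshelve. all: by end_near. Qed.

Definition nrmq (u : L2q) : R := fine (L2norm mu (rep u)).

Lemma L2norm_ge0 F : (0 <= L2norm mu F)%E.
Proof. exact: Lnorm_ge0. Qed.

Lemma nrmqE u : (nrmq u)%:E = L2norm mu (rep u).
Proof.
by rewrite fineK// ge0_fin_numE ?L2norm_ge0//; case: (rep_L2 u).
Qed.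

Lemma nrmq_of u F : L2 mu F -> rep u = F %[ae mu] -> (nrmq u)%:E = L2norm mu F.
Proof.
move=> [mF _] h; rewrite nrmqE; apply: L2norm_ae => //.
by case: (rep_L2 u).
Qed.

Lemma nrmqD u v : nrmq (u + v) <= nrmq u + nrmq v.
Proof.
have LD := L2_add (rep_L2 u) (rep_L2 v).
rewrite -lee_fin (nrmq_of LD (repDE u v)) EFinD !nrmqE.
exact: (L2norm_triangle (rep_L2 u) (rep_L2 v)).
Qed.

Lemma nrmqZ a u : nrmq (a *: u) = normc a * nrmq u.
Proof.
apply: EFin_inj; rewrite (nrmq_of (L2_scale a (rep_L2 u)) (repZE a u)) EFinM nrmqE.
by apply: L2normZ; case: (rep_L2 u).
Qed.

Lemma nrmq_eq0 u : nrmq u = 0 -> u = 0.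
Proof.
move=> u0; apply: rep_ae; apply: ae_eq_trans (ae_eq_sym rep0E).
by apply: L2norm_eq0; [exact: rep_L2|rewrite -nrmqE u0].
Qed.

Section Lift.
Context (Q : (T -> R[i]) -> (T -> R[i])) (HQ : bounded_op mu Q).

Lemma bounded_op_ae F G : L2 mu F -> L2 mu G -> F = G %[ae mu] -> Q F = Q G %[ae mu].
Proof.
have [QL Qlin [M QM]] := HQ => LF LG FG.
have LD := L2_lin (-1) LF LG.
have e0 : L2norm mu (fun x => -1 * F x + G x) = 0%E.
  rewrite (@L2norm_ae _ _ _ _ _ (fun=> 0)).
  - by rewrite -(nrmq_of L2_0 rep0E) (nrm0 nrmqZ).
  - by case: LD.
  - by case: L2_0.
  - by near=> x => _; rewrite (near FG x)// mulN1r addNr.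
have := QM _ LD; rewrite e0 mule0 => h.
have {}h : L2norm mu (Q (fun x => -1 * F x + G x)) = 0%E.
  by apply/eqP; rewrite eq_le h L2norm_ge0.
have h1 := L2norm_eq0 (QL _ LD) h; have h2 := Qlin (-1) _ _ LF LG.
near=> x => _; apply/eqP; rewrite eq_sym -subr_eq0; apply/eqP.
have <- := near h1 x; rewrite // (near h2 x)// mulN1r addrC //.
Unshelve. all: by end_near. Qed.

Definition liftq (u : L2q) : L2q :=
  let: And3 QL _ _ := HQ in cls (QL _ (rep_L2 u)).

Lemma rep_liftq u : rep (liftq u) = Q (rep u) %[ae mu].
Proof. by rewrite /liftq; case: HQ => QL _ _; exact: rep_cls. Qed.

Lemma rep_liftq_of u F : L2 mu F -> rep u = F %[ae mu] ->
  rep (liftq u) = Q F %[ae mu].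
Proof.
move=> LF uF; apply: ae_eq_trans (rep_liftq u) _.
by apply: bounded_op_ae => //; exact: rep_L2.
Qed.

Lemma liftq_is_linear : linear liftq.
Proof.
move=> a u v; apply: rep_ae.
have [QL Qlin _] := HQ.
have h1 := rep_liftq_of (L2_lin a (rep_L2 u) (rep_L2 v)) (rep_lin a u v).
have h2 := Qlin a _ _ (rep_L2 u) (rep_L2 v).
have h3 := rep_lin a (liftq u) (liftq v).
have h4 := rep_liftq u; have h5 := rep_liftq v.
near=> x => _; rewrite (near h1 x)// (near h2 x)// (near h3 x)//.
by rewrite (near h4 x)// (near h5 x).
Unshelve. all: by end_near. Qed.

HB.instance Definition _ := GRing.isLinear.Build R[i] L2q L2q *:%R liftq
  liftq_is_linear.

Lemma liftq_le M : (forall F, L2 mu F -> (L2norm mu (Q F) <= M%:E * L2norm mu F)%E) ->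
  forall u, nrmq (liftq u) <= M * nrmq u.
Proof.
have [QL _ _] := HQ => QM u.
rewrite -lee_fin (nrmq_of (QL _ (rep_L2 u)) (rep_liftq u)) EFinM nrmqE.
exact: QM (rep_L2 u).
Qed.

Lemma liftq_bounded : nbounded nrmq liftq.
Proof. by have [_ _ [M HM]] := HQ; exists M; exact: liftq_le. Qed.
End Lift.
End L2Quotient.

Lemma Rintegral_lin3 d (T : measurableType d) (R : realType)
    (m : {measure set T -> \bar R}) (f g h : T -> R) (a b : R) :
  m.-integrable setT (EFin \o f) -> m.-integrable setT (EFin \o g) ->
  m.-integrable setT (EFin \o h) ->
  \int[m]_x (a * f x + b * g x + h x) =
  a * (\int[m]_x f x) + b * (\int[m]_x g x) + \int[m]_x h x.
Proof.
move=> If Ig Ih.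
have Z c k : m.-integrable setT (EFin \o k) -> m.-integrable setT (EFin \o (fun x => c * k x)).
  by move=> Ik; exact: (integrableZl measurableT c Ik).
rewrite RintegralD//; last first.
  exact: (integrableD measurableT (Z a f If) (Z b g Ig)).
by rewrite RintegralD// ?RintegralZl//; exact: Z.
Qed.

Section KernelOperator.
Context d (T : measurableType d) (R : realType) (mu : probability T R).
Context (P : R.-pker T ~> T).
Hypothesis inv : invariant_probability P mu.
Implicit Types (f g : T -> R) (F G : T -> R[i]).

Definition kint f (x : T) : R := \int[P x]_y f y.

Lemma measurable_kint f : measurable_fun setT f -> measurable_fun setT (kint f).
Proof.
move=> mf; rewrite /kint /Rintegral.
apply: (@measurableT_comp _ _ _ _ _ _ (@fine R)) => //=.
rewrite (_ : (fun x => _) = (fun x => \int[P x]_y ((EFin \o f)^\+ y) -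
   \int[P x]_y ((EFin \o f)^\- y))%E).
  apply: emeasurable_funB; apply: measurable_int_kernel => //.
    by apply: measurable_funepos; exact/measurable_EFinP.
  by apply: measurable_funeneg; exact/measurable_EFinP.
by apply/funext => x; rewrite integralE.
Qed.

Lemma integral_sqint f : measurable_fun setT f ->
  (\int[mu]_x sqint (kernel_prob P x) f)%E = sqint mu f.
Proof.
move=> mf; apply: (integral_invariant inv); last exact: measurable_sq.
by move=> x; rewrite lee_fin sqr_ge0.
Qed.

Lemma measurable_sqint f : measurable_fun setT f ->
  measurable_fun setT (fun x => sqint (kernel_prob P x) f).
Proof.
move=> mf; apply: measurable_int_kernel; last exact: measurable_sq.
by move=> x; rewrite lee_fin sqr_ge0.
Qed.

(** By invariance the second moments under [P x] average to the one under [mu], so they are finite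
    almost everywhere; at such points the integrals in [Kop] exist. *)
Lemma ae_sqint f : measurable_fun setT f -> (sqint mu f < +oo)%E ->
  {ae mu, forall x, (sqint (kernel_prob P x) f < +oo)%E}.
Proof.
move=> mf fi.
have : mu.-integrable setT (fun x => sqint (kernel_prob P x) f).
  apply/integrableP; split; first exact: measurable_sqint.
  rewrite (eq_integral (fun x => sqint (kernel_prob P x) f)).
    by rewrite integral_sqint.
  by move=> x _; rewrite gee0_abs// sqint_ge0.
move=> /(integrable_ae measurableT).
by apply: filterS => x /(_ Logic.I); rewrite ge0_fin_numE// sqint_ge0.
Qed.

Lemma sqint_kint f : measurable_fun setT f -> (sqint mu (kint f) <= sqint mu f)%E.
Proof.
move=> mf; rewrite -(integral_sqint mf); apply: ge0_le_integral => //.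
- by move=> x _; rewrite lee_fin sqr_ge0.
- by apply: measurable_sq; exact: measurable_kint.
- exact: measurable_sqint.
- by move=> x _; exact: (sq_Rintegral_le (kernel_prob P x) mf).
Qed.

Lemma Kop_L2 F : L2 mu F -> L2 mu (Kop P F).
Proof.
move=> /L2P[[mR mI] hR hI]; apply/L2P; split.
- by split; exact: measurable_kint.
- exact: le_lt_trans (sqint_kint mR) hR.
- exact: le_lt_trans (sqint_kint mI) hI.
Qed.

Lemma Kop_norm F : L2 mu F -> (L2norm mu (Kop P F) <= L2norm mu F)%E.
Proof.
move=> LF; have [[mR mI] hR hI] := (L2P mu F).1 LF.
have LK := Kop_L2 LF; have [mK _] := LK.
have h : (L2norm mu (Kop P F) `^ 2 <= L2norm mu F `^ 2)%E.
  rewrite !L2norm_sqr !csqE//; apply: leeD; exact: sqint_kint.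
have := L2norm_ge0 mu F; have := L2norm_ge0 mu (Kop P F); move: h.
case: LF => _; case: LK => _; case: L2norm => // a; case: L2norm => // b _ _.
rewrite !poweR_EFin !lee_fin => h a0 b0.
by move: h; rewrite !powR_mulrn// ler_sqr.
Qed.

Lemma Kop_lin (a : R[i]) F G : L2 mu F -> L2 mu G ->
  Kop P (fun x => a * F x + G x) = (fun x => a * Kop P F x + Kop P G x) %[ae mu].
Proof.
move=> /L2P[[mR mI] hR hI] /L2P[[mR' mI'] hR' hI'].
have h1 := ae_sqint mR hR; have h2 := ae_sqint mI hI.
have h3 := ae_sqint mR' hR'; have h4 := ae_sqint mI' hI'.
near=> x => _.
have i1 : (P x).-integrable setT (EFin \o (fun y => complex.Re (F y))).
  by apply: (@sq_integrable _ _ _ (kernel_prob P x)) => //; near: x.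
have i2 : (P x).-integrable setT (EFin \o (fun y => complex.Im (F y))).
  by apply: (@sq_integrable _ _ _ (kernel_prob P x)) => //; near: x.
have i3 : (P x).-integrable setT (EFin \o (fun y => complex.Re (G y))).
  by apply: (@sq_integrable _ _ _ (kernel_prob P x)) => //; near: x.
have i4 : (P x).-integrable setT (EFin \o (fun y => complex.Im (G y))).
  by apply: (@sq_integrable _ _ _ (kernel_prob P x)) => //; near: x.
case: a => a b; rewrite /Kop; apply/eqP; rewrite eq_complex; apply/andP; split; apply/eqP.
- rewrite [RHS]/= -mulNr -(Rintegral_lin3 _ _ i1 i2 i3); apply: eq_Rintegral => y _.
  by case: (F y) (G y) => [? ?] [? ?] /=; rewrite mulNr.
- rewrite [RHS]/= -(Rintegral_lin3 _ _ i2 i1 i4); apply: eq_Rintegral => y _.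
  by case: (F y) (G y) => [? ?] [? ?] /=.
Unshelve. all: by end_near. Qed.

Lemma Kop_bounded : bounded_op mu (Kop P).
Proof.
split; [exact: Kop_L2|exact: Kop_lin|exists 1 => F LF].
by rewrite mul1e Kop_norm.
Qed.
End KernelOperator.

Lemma ae_eq_of_le d (T : measurableType d) (R : realType)
    (mu : {measure set T -> \bar R}) (f g : T -> \bar R) :
  measurable_fun setT f -> measurable_fun setT g ->
  (forall x, 0 <= f x)%E -> {ae mu, forall x, f x <= g x}%E ->
  (\int[mu]_x g x < +oo)%E -> (forall x, 0 <= g x)%E ->
  (\int[mu]_x g x <= \int[mu]_x f x)%E -> {ae mu, forall x, f x = g x}.
Proof.
move=> mf mg f0 fg gi g0 gf.
have Ig : mu.-integrable setT g.
  apply/integrableP; split => //.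
  by under eq_integral do rewrite gee0_abs//.
have fi : (\int[mu]_x f x < +oo)%E.
  apply: le_lt_trans gi; apply: ae_ge0_le_integral => //.
  by apply: filterS fg.
have If : mu.-integrable setT f.
  apply/integrableP; split => //.
  by under eq_integral do rewrite gee0_abs//.
have h : (\int[mu]_x `|g x - f x| = 0)%E.
  rewrite (ae_eq_integral (fun x => g x - f x)%E) //.
  - rewrite integralB//; apply/eqP; rewrite sube_eq ?add0e.
    + rewrite eq_le gf/=; apply: ae_ge0_le_integral => //.
      by apply: filterS fg.
    + by rewrite ge0_fin_numE// integral_ge0.
    + by rewrite fin_num_adde_defl// ge0_fin_numE// integral_ge0.
  - by apply: measurableT_comp => //; exact: emeasurable_funB.
  - exact: emeasurable_funB.
  - have af := integrable_ae measurableT If.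
    near=> x => _; rewrite gee0_abs// sube_ge0; first by near: x.
    by apply/orP; left; apply: (near af x).
have := (ae_eq_integral_abs mu measurableT (emeasurable_funB mg mf)).1 h.
move=> e; have af := integrable_ae measurableT If.
have ag := integrable_ae measurableT Ig.
apply: filterS3 e af ag => x /(_ Logic.I) h1 /(_ Logic.I) ffin /(_ Logic.I) gfin.
by move: h1 ffin gfin; case: (f x) (g x) => [a||] [b||] //= [] /eqP; rewrite subr_eq0 => /eqP ->.
Unshelve. all: by end_near. Qed.

(** * Eigenfunctions with eigenvalue of modulus one *)

Section Eigenfunction.
Context d (T : measurableType d) (R : realType) (mu : probability T R).
Context (P : R.-pker T ~> T).
Hypothesis inv : invariant_probability P mu.
Context (F : T -> R[i]) (z : R[i]).
Hypothesis LF : L2 mu F.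
Hypothesis z1 : normc z = 1.
Hypothesis eF : Kop P F = (fun x => z * F x) %[ae mu].

Lemma measurable_rneq (f : T -> R) c : measurable_fun setT f ->
  measurable [set y | f y != c].
Proof.
move=> mf; rewrite (_ : [set y | f y != c] = f @^-1` (~` [set c])).
  by rewrite -[X in measurable X]setTI; apply: mf => //; exact: measurableC.
by apply/seteqP; split => y /= /eqP.
Qed.

Lemma measurable_cneq (G : T -> R[i]) c : cmeasurable G -> measurable [set y | G y != c].
Proof.
move=> [mR mI].
have -> : [set y | G y != c] = [set y | complex.Re (G y) != complex.Re c] `|`
    [set y | complex.Im (G y) != complex.Im c].
  by apply/seteqP; split => y /=; rewrite eq_complex negb_and => /orP.
by apply: measurableU; exact: measurable_rneq.
Qed.

Lemma sqint_eq0 (m : probability T R) (f : T -> R) : measurable_fun setT f ->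
  sqint m f = 0%E -> m [set y | f y != 0] = 0%E.
Proof.
move=> mf f0.
have := (ae_eq_integral_abs m measurableT (measurable_sq mf)).1.
rewrite (eq_integral (fun x => ((f x ^+ 2)%R)%:E)); last first.
  by move=> x _; rewrite gee0_abs// lee_fin sqr_ge0.
move=> /(_ f0) h.
apply: (measure_negligible (measurable_rneq 0 mf)).
apply: negligibleS h => y /= fy /(_ Logic.I) [] /eqP.
by rewrite sqrf_eq0 (negPf fy).
Qed.

(** The second moment [A] of [F] under [P x] is the variance [D] plus |z F(x)|^2 = |F(x)|^2, and by
    invariance [A] has the same integral as |F|^2. Hence the variance vanishes almost everywhere. *)
Lemma eigen_step : {ae mu, forall x, P x [set y | F y != z * F x] = 0%E}.
Proof.
have [[mR mI] hR hI] := (L2P mu F).1 LF; have [mF _] := LF.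
pose f y := complex.Re (F y); pose g y := complex.Im (F y).
pose c x := complex.Re (z * F x); pose e x := complex.Im (z * F x).
have pR := ae_sqint inv mR hR; have pI := ae_sqint inv mI hI.
pose A x := (sqint (kernel_prob P x) f + sqint (kernel_prob P x) g)%E.
pose D x := (sqint (kernel_prob P x) (fun y => (f y - c x)%R) +
             sqint (kernel_prob P x) (fun y => (g y - e x)%R))%E.
have DA : {ae mu, forall x, A x = D x + ((normc (F x) ^+ 2)%R)%:E}%E.
  apply: filterS3 pR pI eF => x hf hg /(_ Logic.I) ex.
  have -> : (normc (F x) ^+ 2 = c x ^+ 2 + e x ^+ 2)%R.
    by rewrite -normc_sqr normcM z1 mul1r.
  rewrite /A /D (sqintB_cst _ mR hf) (sqintB_cst _ mI hg).
  have -> : \int[kernel_prob P x]_y complex.Re (F y) = c x.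
    by rewrite /c -ex.
  have -> : \int[kernel_prob P x]_y complex.Im (F y) = e x.
    by rewrite /e -ex.
  have := sqint_ge0 (kernel_prob P x) f; have := sqint_ge0 (kernel_prob P x) g.
  move: hf hg; rewrite -/f -/g; case: sqint => // r; case: sqint => // s _ _ _ _.
  by rewrite -!EFinD; congr EFin; ring.
have FA : {ae mu, forall x, ((normc (F x) ^+ 2)%R)%:E = A x}.
  apply: ae_eq_of_le.
  - exact: measurable_normc_sq.
  - by apply: emeasurable_funD; exact: measurable_sqint.
  - by move=> x; rewrite lee_fin sqr_ge0.
  - by apply: filterS DA => x ->; rewrite leeDr// adde_ge0// sqint_ge0.
  - rewrite ge0_integralD//; try by move=> x _; exact: sqint_ge0.
    + by rewrite !integral_sqint// lte_add_pinfty.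
    + exact: measurable_sqint.
    + exact: measurable_sqint.
  - by move=> x; rewrite adde_ge0// sqint_ge0.
  - rewrite ge0_integralD//; try by move=> x _; exact: sqint_ge0.
    + by rewrite !integral_sqint// -csqE.
    + exact: measurable_sqint.
    + exact: measurable_sqint.
near=> x.
have D0 : D x = 0%E.
  have h1 : A x = (D x + ((normc (F x) ^+ 2)%R)%:E)%E by near: x.
  have h2 : ((normc (F x) ^+ 2)%R)%:E = A x by near: x.
  move: h1; rewrite -h2; have : (0 <= D x)%E by rewrite adde_ge0// sqint_ge0.
  case: (D x) => // r _ [] /eqP; rewrite -subr_eq subrr => /eqP <- //.
have /andP[/eqP s1 /eqP s2] : (sqint (kernel_prob P x) (fun y => (f y - c x)%R) == 0%E) &&
    (sqint (kernel_prob P x) (fun y => (g y - e x)%R) == 0%E).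
  by rewrite -padde_eq0 ?sqint_ge0//; apply/eqP.
have e1 := sqint_eq0 (measurable_funB mR (measurable_cst _)) s1.
have e2 := sqint_eq0 (measurable_funB mI (measurable_cst _)) s2.
apply: (measure_negligible (measurable_cneq _ mF)).
have n1 := (negligibleP _ (measurable_rneq 0 (measurable_funB mR (measurable_cst (c x))))).2 e1.
have n2 := (negligibleP _ (measurable_rneq 0 (measurable_funB mI (measurable_cst (e x))))).2 e2.
apply: negligibleS (negligibleU n1 n2) => y /=.
by rewrite eq_complex negb_and !subr_eq0 => /orP.
Unshelve. all: by end_near. Qed.

Let E n x := [set y | F y != z ^+ n * F x].

Lemma eigen_iter : {ae mu, forall x, forall n, kiter P n x (E n x) = 0%E}.
Proof.
have [mF _] := LF.
have mE n x : measurable (E n x) by exact: measurable_cneq.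
apply: ae_foralln => n; elim: n => [|n IH].
  apply: filterE => x; rewrite kiterE /= diracE.
  by rewrite (_ : (x \in E 0 x) = false)//; apply/negbTE; rewrite notin_setE /E /= expr0 mul1r eqxx.
have [N [mN N0 HN]] := IH.
(* By invariance the probabilities [P x N] integrate to [mu N], so the exceptional null set of the
   previous step is missed from almost every start. *)
have PN : {ae mu, forall x, P x N = 0%E}.
  have := (ae_eq_integral_abs mu measurableT (measurable_kernel P N mN)).1.
  rewrite (eq_integral (fun x => P x N)); last by move=> x _; rewrite gee0_abs.
  rewrite (inv mN) => /(_ N0); apply: filterS => x; exact.
apply: filterS2 PN eigen_step => x PxN Px1.
rewrite kiterE /= (eq_integral (fun y => kiter P n y (E n.+1 x))); last first.
  by move=> y _; rewrite kiterE.
rewrite (ae_eq_integral (cst 0%E))//; first by rewrite integral0.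
  exact: measurable_kernel.
have n1 := (negligibleP _ mN).2 PxN.
have n2 := (negligibleP _ (measurable_cneq _ mF)).2 Px1.
apply: negligibleS (negligibleU n1 n2) => y /= h.
have [Fy|Fy] := eqVneq (F y) (z * F x); last by right.
left; apply: HN => /= h1; apply: h => _.
by rewrite (_ : E n.+1 x = E n y)// /E Fy mulrA -exprSr.
Qed.
End Eigenfunction.

Lemma normc_le_ReIm (R : realType) (z : R[i]) :
  normc z <= `|complex.Re z| + `|complex.Im z|.
Proof.
case: z => a b /=; rewrite -[leRHS]ger0_norm ?addr_ge0// -[leRHS]sqrtr_sqr.
rewrite ler_sqrt ?sqr_ge0// sqrrD !real_normK ?num_real//.
have := mulr_ge0 (normr_ge0 a) (normr_ge0 b); rewrite -mulr_natr; lra.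
Qed.

Section SmallCell.
Context d (T : measurableType d) (R : realType).

(** A grid of squares of side eps / 2 covers the plane with countably many cells; were all their
    preimages [psi]-null, the whole space would be too. *)
Lemma small_cell (psi : {measure set T -> \bar R}) (F : T -> R[i]) (eps : R) :
  cmeasurable F -> psi setT != 0%E -> 0 < eps ->
  exists B, [/\ measurable B, (0 < psi B)%E &
    forall y y', B y -> B y' -> normc (F y - F y') <= eps].
Proof.
move=> [mR mI] psi0 e0.
pose del := eps / 2; have del0 : 0 < del by rewrite divr_gt0.
pose I (a : int) := `[(a%:~R * del), ((a + 1)%:~R * del)[.
pose C (p : int * int) := [set y | complex.Re (F y) \in I p.1] `&`
  [set y | complex.Im (F y) \in I p.2].
have mC p : measurable (C p).
  apply: measurableI.
    by have := mR measurableT _ (measurable_itv (I p.1)); rewrite setTI.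
  by have := mI measurableT _ (measurable_itv (I p.2)); rewrite setTI.
apply: contrapT => nB.
have C0 p : psi (C p) = 0%E.
  apply/eqP; rewrite eq_le measure_ge0 andbT leNgt; apply/negP => Cp; apply: nB.
  exists (C p); split => // y y' [h1 h2] [h3 h4].
  move: h1 h2 h3 h4; rewrite /I /= !in_itv /=.
  move=> /andP[h1 h2] /andP[h3 h4] /andP[h5 h6] /andP[h7 h8].
  apply: le_trans (normc_le_ReIm _) _.
  have -> : complex.Re (F y - F y') = complex.Re (F y) - complex.Re (F y').
    by case: (F y) (F y') => [? ?] [? ?].
  have -> : complex.Im (F y - F y') = complex.Im (F y) - complex.Im (F y').
    by case: (F y) (F y') => [? ?] [? ?].
  rewrite [leRHS]splitr; apply: lerD; rewrite ler_norml -/del;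
    rewrite !rmorphD /= !mulrDl !mul1r in h2 h4 h6 h8; apply/andP; split; lra.
move/eqP: psi0; apply.
pose D n := if @choice.unpickle (int * int)%type n is Some p then C p else set0.
have : psi.-negligible (\bigcup_n D n).
  apply: negligible_bigcup => n; rewrite /D; case: choice.unpickle => [p|].
    exact: (negligibleP _ (mC p)).2 (C0 p).
  exact: negligible_set0.
have -> : \bigcup_n D n = setT.
  apply/seteqP; split => // y _.
  have fl (r : R) : r \in I (Num.floor (r / del)).
    rewrite in_itv /= -ler_pdivlMr// -ltr_pdivrMr//.
    by rewrite ge_floor //= floorD1_gt.
  pose p := (Num.floor (complex.Re (F y) / del), Num.floor (complex.Im (F y) / del)).
  have Cy : C p y by split => /=; exact: fl.
  exists (choice.pickle p); first exact: Logic.I.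
  by rewrite /D choice.pickleK.
by move/(measure_negligible measurableT).
Qed.
End SmallCell.

Section NoEigenvalue.
Context d (T : measurableType d) (R : realType) (mu : probability T R).
Context (P : R.-pker T ~> T).
Hypothesis inv : invariant_probability P mu.
Hypothesis irr : psi_irreducible_aperiodic P.

(** From almost every x and for all large n the chain can reach a set [B k] on which F varies by at
    most 1/(k+1), at a point where F equals z^n F(x). For z = 1 this brings F(x) and F(x0)
    arbitrarily close. Otherwise the consecutive times n and n + 1, both available by aperiodicity,
    give |z - 1| |F(x)| <= 1/(k+1), so F vanishes. *)
Lemma eigen_constant (F : T -> R[i]) (z : R[i]) : L2 mu F -> normc z = 1 ->
  Kop P F = (fun x => z * F x) %[ae mu] ->
  exists2 c, F = (fun=> c) %[ae mu] & z = 1 \/ c = 0.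
Proof.
move=> LF z1 eF; have [mF _] := LF.
have [psi [[psi0 Hpsi] _]] := irr.
have /choice[B HB] : forall k : nat, exists B : set T, [/\ measurable B, (0 < psi B)%E &
    forall y y', B y -> B y' -> normc (F y - F y') <= k.+1%:R^-1].
  by move=> k; apply: small_cell; rewrite ?invr_gt0.
have good : {ae mu, forall x, forall k, exists n0, forall n, (n0 <= n)%N ->
    exists2 y, B k y & F y = z ^+ n * F x}.
  apply: filterS (eigen_iter inv LF z1 eF) => x Hx k.
  have [mB B0 _] := HB k; have [n0 _ Hn0] := Hpsi _ mB B0 x.
  exists n0 => n nn; apply: contrapT => nex.
  have := Hn0 n nn; rewrite /= -kiterE ltNge => /negP; apply.
  rewrite -(Hx n); apply: le_measure; [exact/mem_set|exact/mem_set/measurable_cneq|].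
  by move=> y By /=; apply/eqP => Fy; apply: nex; exists y.
have [x0 Hx0] : exists x0, forall k, exists n0, forall n, (n0 <= n)%N ->
    exists2 y, B k y & F y = z ^+ n * F x0.
  apply: contrapT => nex; have [N [mN N0 HN]] := good.
  have : mu setT = 0%E.
    apply/eqP; rewrite -measure_le0 -N0 le_measure ?inE// => x _.
    by apply: HN => hx; apply: nex; exists x.
  by rewrite (_ : mu setT = 1%E) => [/eqP|]; rewrite ?onee_eq0//; exact: probability_setT.
have small (r : R) : (forall k : nat, r <= k.+1%:R^-1) -> r <= 0.
  move=> h; rewrite leNgt; apply/negP => r0.
  have := h (Num.truncn r^-1); rewrite -[leLHS]invrK lef_pV2 ?posrE ?invr_gt0//.
  by move=> h1; have := truncnS_gt r^-1; rewrite ltNge h1.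
have zn n : normc (z ^+ n) = 1 by rewrite normcX z1 expr1n.
have [ez|nz] := eqVneq z 1.
  exists (F x0); last by left.
  apply: filterS good => x Hx _ /=.
  apply/eqP; rewrite -subr_eq0; apply/eqP/eq0_normc/eqP.
  rewrite eq_le normc_ge0 andbT; apply: small => k.
  have [n1 /(_ n1 (leqnn _))[y By Fy]] := Hx k.
  have [n2 /(_ n2 (leqnn _))[y' By' Fy']] := Hx0 k.
  have [_ _ /(_ _ _ By By')] := HB k.
  by rewrite Fy Fy' ez !expr1n !mul1r.
exists 0; last by right.
apply: filterS good => x Hx _ /=.
apply: eq0_normc; apply/eqP; rewrite eq_le normc_ge0 andbT.
rewrite -(pmulr_rle0 (x := normc (z - 1))) ?normc_gt0 ?subr_eq0//.
apply: small => k.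
have [n1 Hn1] := Hx k; have [y By Fy] := Hn1 _ (leqnn _).
have [y' By' Fy'] := Hn1 _ (leqnSn _).
have [_ _ /(_ _ _ By' By)] := HB k.
by rewrite Fy Fy' exprS -mulrBl normcM -{2}[z ^+ n1]mul1r -mulrBl normcM zn mulr1.
Qed.
End NoEigenvalue.

(** * The mean functional and the transfer of the spectral hypotheses to classes *)

Section Mean.
Context d (T : measurableType d) (R : realType) (mu : probability T R).
Implicit Types (f : T -> R) (F : T -> R[i]) (u v : L2q mu).

Definition cmean F : R[i] :=
  Complex (\int[mu]_x complex.Re (F x)) (\int[mu]_x complex.Im (F x)).

Lemma Rintegral_ae (f g : T -> R) : measurable_fun setT f -> measurable_fun setT g ->
  f = g %[ae mu] -> \int[mu]_x f x = \int[mu]_x g x.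
Proof.
move=> mf mg fg; congr fine; apply: ae_eq_integral => //.
- exact/measurable_EFinP.
- exact/measurable_EFinP.
- by apply: filterS fg => x + _ => /(_ Logic.I) ->.
Qed.

Lemma cmean_ae F G : cmeasurable F -> cmeasurable G -> F = G %[ae mu] ->
  cmean F = cmean G.
Proof.
move=> [FR FI] [GR GI] FG; rewrite /cmean; congr Complex; apply: Rintegral_ae => //;
  by apply: filterS FG => x + _ => /(_ Logic.I) ->.
Qed.

Lemma cmean_lin (a : R[i]) F G : L2 mu F -> L2 mu G ->
  cmean (fun x => a * F x + G x) = a * cmean F + cmean G.
Proof.
move=> /L2P[[mR mI] hR hI] /L2P[[mR' mI'] hR' hI'].
have i1 := sq_integrable mR hR; have i2 := sq_integrable mI hI.
have i3 := sq_integrable mR' hR'; have i4 := sq_integrable mI' hI'.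
case: a => a b; rewrite /cmean; apply/eqP; rewrite eq_complex; apply/andP; split; apply/eqP.
- rewrite [RHS]/= -mulNr -(Rintegral_lin3 _ _ i1 i2 i3); apply: eq_Rintegral => y _.
  by case: (F y) (G y) => [? ?] [? ?] /=; rewrite mulNr.
- rewrite [RHS]/= -(Rintegral_lin3 _ _ i2 i1 i4); apply: eq_Rintegral => y _.
  by case: (F y) (G y) => [? ?] [? ?] /=.
Qed.

Definition meanq u : R[i] := cmean (rep u).

Lemma meanq_of u F : L2 mu F -> rep u = F %[ae mu] -> meanq u = cmean F.
Proof. by move=> [mF _] uF; apply: cmean_ae => //; case: (rep_L2 u). Qed.

Lemma meanq_is_scalar : scalar meanq.
Proof.
move=> a u v; rewrite (meanq_of (L2_lin a (rep_L2 u) (rep_L2 v)) (rep_lin a u v)).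
by rewrite cmean_lin//; exact: rep_L2.
Qed.

HB.instance Definition _ := GRing.isLinear.Build R[i] (L2q mu) R[i] *%R meanq
  meanq_is_scalar.

Lemma L2norm_csq F : L2 mu F -> exists2 r : R, 0 <= r & L2norm mu F = r%:E /\ csq mu F = (r ^+ 2)%:E.
Proof.
move=> [mF hF]; have h := L2norm_sqr mu F; move: hF h (L2norm_ge0 mu F).
case: L2norm => // r _ <- r0; exists r => //; split => //.
by rewrite poweR_EFin powR_mulrn.
Qed.

Lemma cmean_le F : L2 mu F -> ((normc (cmean F))%:E <= L2norm mu F)%E.
Proof.
move=> LF; have [r r0 [-> h]] := L2norm_csq LF; have [mF _] := LF.
rewrite lee_fin -ler_sqr ?nnegrE ?normc_ge0// -lee_fin -h csqE// normc_sqr EFinD.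
by case: mF => mR mI; apply: leeD; exact: sq_Rintegral_le.
Qed.

Lemma meanq_le u : normc (meanq u) <= nrmq u.
Proof. by rewrite -lee_fin nrmqE cmean_le//; exact: rep_L2. Qed.
End Mean.

Section KernelMean.
Context d (T : measurableType d) (R : realType) (mu : probability T R).
Context (P : R.-pker T ~> T).
Hypothesis inv : invariant_probability P mu.

Lemma Rintegral_kint (f : T -> R) : measurable_fun setT f -> (sqint mu f < +oo)%E ->
  \int[mu]_x kint P f x = \int[mu]_x f x.
Proof.
move=> mf hf; congr fine.
have If := sq_integrable mf hf.
have mE : measurable_fun setT (EFin \o f) by exact/measurable_EFinP.
pose A x := (\int[P x]_y ((EFin \o f)^\+ y))%E.
pose B x := (\int[P x]_y ((EFin \o f)^\- y))%E.
have mA : measurable_fun setT A.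
  by apply: measurable_int_kernel => //; exact: measurable_funepos.
have mB : measurable_fun setT B.
  by apply: measurable_int_kernel => //; exact: measurable_funeneg.
have A0 x : (0 <= A x)%E by exact: integral_ge0.
have B0 x : (0 <= B x)%E by exact: integral_ge0.
have iA : (\int[mu]_x A x = \int[mu]_x (EFin \o f)^\+ x)%E.
  by apply: (integral_invariant inv) => //; exact: measurable_funepos.
have iB : (\int[mu]_x B x = \int[mu]_x (EFin \o f)^\- x)%E.
  by apply: (integral_invariant inv) => //; exact: measurable_funeneg.
rewrite [RHS]integralE -iA -iB -integralB//; last 2 first.
- apply/integrableP; split => //; under eq_integral do rewrite gee0_abs//.
  rewrite iA; have /integrableP[_] := integrable_funepos measurableT If.
  by under eq_integral do rewrite gee0_abs//.
- apply/integrableP; split => //; under eq_integral do rewrite gee0_abs//.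
  rewrite iB; have /integrableP[_] := integrable_funeneg measurableT If.
  by under eq_integral do rewrite gee0_abs//.
apply: ae_eq_integral => //.
- by apply/measurable_EFinP; exact: measurable_kint.
- exact: emeasurable_funB.
apply: filterS (ae_sqint inv mf hf) => x hx _.
rewrite -integralE /kint fineK//.
exact: (integrable_fin_num measurableT (sq_integrable mf hx)).
Qed.

Lemma cmean_Kop F : L2 mu F -> cmean mu (Kop P F) = cmean mu F.
Proof.
by move=> /L2P[[mR mI] hR hI]; rewrite /cmean; congr Complex; exact: Rintegral_kint.
Qed.

Definition Pq : L2q mu -> L2q mu := liftq (Kop_bounded inv).
HB.instance Definition _ := GRing.Linear.on Pq.

Lemma rep_Pq u : rep (Pq u) = Kop P (rep u) %[ae mu].
Proof. exact: rep_liftq. Qed.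

Lemma meanq_Pq u : meanq (Pq u) = meanq u.
Proof.
rewrite (meanq_of (Kop_L2 inv (rep_L2 u)) (rep_Pq u)) cmean_Kop//; exact: rep_L2.
Qed.

Lemma nrmq_Pq u : nrmq (Pq u) <= nrmq u.
Proof.
rewrite -[leRHS]mul1r; apply: liftq_le => F LF.
by rewrite mul1e Kop_norm.
Qed.

Lemma L2_cst (c : R[i]) : L2 mu (fun=> c).
Proof.
apply/L2_csq; split; first by split; exact: measurable_cst.
by rewrite /csq integral_prob_cst ltry.
Qed.

Lemma L2_sum n (c : 'I_n -> R[i]) (F : 'I_n -> T -> R[i]) : (forall i, L2 mu (F i)) ->
  L2 mu (fun x => \sum_(i < n) c i * F i x).
Proof.
elim: n c F => [|n IH] c F LF.
  by rewrite (_ : (fun x => _) = (fun=> 0)); [exact: L2_cst|apply/funext => x; rewrite big_ord0].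
rewrite (_ : (fun x => _) = (fun x => c ord0 * F ord0 x +
    \sum_(i < n) c (lift ord0 i) * F (lift ord0 i) x)).
  by apply: L2_lin => //; apply: (IH (fun i => c (lift ord0 i)) (fun i => F (lift ord0 i))).
by apply/funext => x; rewrite big_ord_recl.
Qed.

Lemma Pq_eigen (irr : psi_irreducible_aperiodic P) z u : normc z = 1 ->
  meanq u = 0 -> Pq u = z *: u -> u = 0.
Proof.
move=> z1 u0 Pu.
have [|c uc [ez|c0]] := eigen_constant inv irr (rep_L2 u) z1.
- apply: ae_eq_trans (ae_eq_sym (rep_Pq u)) _; rewrite Pu; exact: repZE.
- have c0 : c = 0.
    rewrite -u0 (meanq_of (L2_cst c) uc) /cmean !Rintegral_prob_cst.
    by case: (c).
  by apply: rep_ae; apply: ae_eq_trans uc _; rewrite c0; apply: ae_eq_sym; exact: rep0E.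
- by apply: rep_ae; apply: ae_eq_trans uc _; rewrite c0; apply: ae_eq_sym; exact: rep0E.
Qed.

Local Notation resolvent_op := (resolvent_op (@nrmq _ _ _ mu) Pq).

Lemma rep_res (z : R[i]) (v : L2q mu) F : L2 mu F -> rep v = F %[ae mu] ->
  rep (z *: v - Pq v) = (fun x => z * F x - Kop P F x) %[ae mu].
Proof.
move=> LF vF; have h1 := repBE (z *: v) (Pq v); have h2 := repZE z v.
have h3 := rep_liftq_of (Kop_bounded inv) LF vF.
by near=> x => _; rewrite (near h1 x)// (near h2 x)// (near h3 x)// (near vF x).
Unshelve. all: by end_near. Qed.

Lemma resolvent_lift z Q : is_resolvent mu P z Q ->
  exists S : {linear L2q mu -> L2q mu}, resolvent_op z S /\
    forall v, rep (S v) = Q (rep v) %[ae mu].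
Proof.
case=> BQ HQ; exists (liftq BQ); split; last by move=> v; exact: rep_liftq.
have [QL _ _] := BQ.
split; last exact: liftq_bounded.
- move=> v; apply: rep_ae; have [_ h] := HQ _ (rep_L2 v).
  by apply: ae_eq_trans h; apply: rep_res; [exact/QL/rep_L2|exact: rep_liftq].
- move=> v; apply: rep_ae; have [h _] := HQ _ (rep_L2 v).
  apply: ae_eq_trans h; apply: rep_liftq_of.
    rewrite (_ : (fun x => _) = (fun x => (-1) * Kop P (rep v) x + z * rep v x)).
      by apply: L2_lin; [exact/(Kop_L2 inv)/rep_L2|exact/L2_scale/rep_L2].
    by apply/funext => x; rewrite mulN1r addrC.
  by apply: rep_res; [exact: rep_L2|exact: ae_eq_refl].
Qed.

Lemma ae_ord n (A : 'I_n -> T -> Prop) : (forall i, {ae mu, forall x, A i x}) ->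
  {ae mu, forall x, forall i, A i x}.
Proof.
move=> H; have : {ae mu, forall x, forall k : nat, forall i : 'I_n, val i = k -> A i x}.
  apply: ae_foralln => k; have [kn|nk] := ltnP k n.
    apply: filterS (H (Ordinal kn)) => x Ax i ik.
    by rewrite (_ : i = Ordinal kn)//; exact: val_inj.
  by apply: filterE => x i ik; have := ltn_ord i; rewrite ik ltnNge nk.
by apply: filterS => x h i; exact: h.
Qed.

Lemma twopii_neq0 : (2 * pi%:C%C * Complex 0 1 : R[i]) != 0.
Proof.
rewrite -normc_gt0 !normcM normc_nat normc_real /= expr0n expr1n add0r sqrtr1 mulr1.
by rewrite mulr_gt0// gtr0_norm ?pi_gt0.
Qed.

Lemma rep_circle_avg (z0 : R[i]) r (Rz : R[i] -> (T -> R[i]) -> (T -> R[i]))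
    (S : R[i] -> {linear L2q mu -> L2q mu}) n (u : L2q mu) : 0 < r ->
  (forall z v, normc (z - z0) = r -> rep (S z v) = Rz z (rep v) %[ae mu]) ->
  rep (circle_avg z0 r S n u) = (fun x => n%:R^-1 * \sum_(k < n)
    (r%:C%C * unity_root R n k) * Rz (z0 + r%:C%C * unity_root R n k) (rep u) x) %[ae mu].
Proof.
move=> r0 HS.
have h1 := repZE n%:R^-1 (\sum_(k < n) (r%:C%C * unity_root R n k) *: S (z0 + r%:C%C * unity_root R n k) u).
have h2 := rep_sum (fun k : 'I_n => r%:C%C * unity_root R n k) (fun k => S (z0 + r%:C%C * unity_root R n k) u).
have h3 := @ae_ord n _ (fun k => HS _ u (normc_circle z0 r0 n k)).
near=> x => _; rewrite (near h1 x)// (near h2 x)//; congr (_ * _); apply: eq_bigr => k _.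
by congr (_ * _); apply: (near h3 x).
Unshelve. all: by end_near. Qed.

(** The contour integral is known only through Riemann sums; for the equidistant partition tagged at
    left end points these are, up to the factor 1 / (2 pi i), the averages [circle_avg]. *)
Lemma pole_lift z0 m : is_pole mu P z0 m -> finite_pole (@nrmq _ _ _ mu) Pq z0.
Proof.
case=> _ [r r0 [Hres [Rz [S [HRz [BS HS] [e [He _ Hfin]]]]]]].
pose c : R[i] := (2 * pi%:C%C * Complex 0 1)^-1.
pose Sc F x := c * S F x.
have BSc : bounded_op mu Sc.
  have [SL Slin [M SM]] := BS; split.
  - by move=> F LF; exact/L2_scale/SL.
  - move=> a F G LF LG; apply: filterS (Slin a F G LF LG) => x /(_ Logic.I) h _.
    by rewrite /Sc h mulrDr mulrCA.
  - exists (normc c * M) => F LF.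
    rewrite L2normZ; last by case: (SL _ LF).
    rewrite EFinM -muleA; apply: lee_pmul => //.
    + by rewrite lee_fin normc_ge0.
    + exact: L2norm_ge0.
    + exact: SM.
have /choice[Rq HRq] : forall z, exists S : {linear L2q mu -> L2q mu},
    normc (z - z0) = r -> resolvent_op z S /\ forall v, rep (S v) = Rz z (rep v) %[ae mu].
  move=> z; have [zr|zr] := pselect (normc (z - z0) = r); last by exists Pq.
  by have [S' HS'] := resolvent_lift (HRz z zr); exists S'.
have /choice[Fe HFe] : forall i, exists F, L2 mu F /\ e i = Sc F %[ae mu].
  by move=> i; have [F LF hF] := He i; exists F.
have [ScL _ _] := BSc.
exists r, Rq, (liftq BSc), m, (fun i => cls (ScL _ (HFe i).1)); split => //.
- move=> z hz; have [Q HQ] := Hres z hz.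
  by have [S' [HS' _]] := resolvent_lift HQ; exists S'.
- by move=> z hz; case: (HRq z hz).
- move=> eps eps0; have [eta eta0 Heta] := HS eps eps0.
  (* From this n on, the mesh 2 pi / n is at most [eta]. *)
  exists (Num.truncn (2 * pi / eta)).+1 => n nn u.
  have pi0 : 0 < pi :> R := pi_gt0 R.
  have n0 : (0 < n)%N by apply: leq_trans nn.
  have n0' : 0 < n%:R :> R by rewrite ltr0n.
  pose t (i : nat) : R := 2 * pi / n%:R * i%:R.
  have tS i : t i.+1 - t i = 2 * pi / n%:R.
    by rewrite /t -mulrBr -natrB// subSnn mulr1.
  have t0 : t 0%N = 0 by rewrite /t mulr0.
  have tn : t n = 2 * pi by rewrite /t divfK ?gt_eqF.
  have ht i : (i < n)%N -> [/\ t i <= t i, t i <= t i.+1 & t i.+1 - t i <= eta].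
    move=> _; split; [exact: lexx| |rewrite tS].
      by rewrite -subr_ge0 tS divr_ge0 ?mulr_ge0 ?ltW.
    rewrite ler_pdivrMr// -ler_pdivrMl// mulrC.
    by apply: ltW; apply: lt_le_trans (truncnS_gt _) _; rewrite ler_nat.
  have := Heta n t t t0 tn ht (rep u) (rep_L2 u).
  set G := (fun x : T => _) => hG.
  pose Rk (k : 'I_n) := Rz (circle_point z0 r (t k)) (rep u).
  have LRk k : L2 mu (Rk k).
    have [|[RL _ _] _] := HRz (circle_point z0 r (t k)); first exact: normc_circle.
    exact/RL/rep_L2.
  have [SL _ _] := BS.
  have LG : L2 mu G.
    rewrite (_ : G = (fun x => (-1) * S (rep u) x + \sum_(k < n)
      ((2 * pi / n%:R)%:C%C * (Complex 0 1 * r%:C%C * cexp (t k))) * Rk k x)).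
      by apply: L2_lin; [exact/SL/rep_L2|exact: L2_sum].
    apply/funext => x; rewrite /G mulN1r addrC; congr (_ + _).
    by apply: eq_bigr => k _; rewrite tS -!mulrA.
  (* The mesh 2 pi / n and the i of dz cancel against 2 pi i, which leaves the weight 1/n of
     [circle_avg]. *)
  have key : c * ((2 * pi / n%:R)%:C%C * Complex 0 1) = n%:R^-1.
    rewrite !rmorphM /= fmorphV !rmorph_nat /c.
    rewrite (_ : 2 * pi%:C%C / n%:R * Complex 0 1 = (2 * pi%:C%C * Complex 0 1) / n%:R).
      by rewrite mulrA mulVf ?mul1r// twopii_neq0.
    by rewrite mulrAC.
  have hrep : rep (circle_avg z0 r Rq n u - liftq BSc u) = (fun x => c * G x) %[ae mu].
    have h1 := repBE (circle_avg z0 r Rq n u) (liftq BSc u).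
    have h2 := rep_circle_avg n u r0 (fun z v hz => (HRq z hz).2 v).
    have h3 := rep_liftq BSc u.
    apply: filterS3 h1 h2 h3 => x /(_ Logic.I) -> /(_ Logic.I) -> /(_ Logic.I) -> _.
    rewrite /G /Sc mulrBr; congr (_ - _); rewrite !mulr_sumr; apply: eq_bigr => k _.
    rewrite tS -[Rz _ (rep u) x]/(Rk k x).
    by rewrite -[unity_root R n k]/(cexp (t k)) -key -!mulrA.
  rewrite -lee_fin (nrmq_of (L2_scale c LG) hrep) L2normZ; last by case: LG.
  rewrite EFinM nrmqE; apply: le_trans hG; rewrite -[leRHS]mul1e.
  apply: lee_pmul => //.
  + by rewrite lee_fin normc_ge0.
  + exact: L2norm_ge0.
  rewrite lee_fin /c normcV invf_le1; last by rewrite normc_gt0 twopii_neq0.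
  rewrite !normcM normc_nat normc_real /= expr0n expr1n add0r sqrtr1 mulr1.
  by rewrite gtr0_norm//; have := pi_ge2 R; lra.
- split; first exact: liftq_bounded.
  move=> u; have [cc Hcc] := Hfin _ (rep_L2 u); exists cc; apply: rep_ae.
  apply: ae_eq_trans (rep_liftq BSc u) _; apply: ae_eq_trans Hcc _.
  have h1 := rep_sum cc (fun i => cls (ScL _ (HFe i).1)).
  have h2 := @ae_ord m _ (fun i => (HFe i).2).
  have h3 := @ae_ord m _ (fun i => rep_cls (ScL _ (HFe i).1)).
  near=> x => _; rewrite (near h1 x)//; apply: eq_bigr => i _; congr (_ * _).
  by rewrite (near h2 x)// (near h3 x).
Unshelve. all: by end_near. Qed.
End KernelMean.

Section RealGap.
Context d (T : measurableType d) (R : realType) (mu : probability T R).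
Context (P : R.-pker T ~> T).
Hypothesis inv : invariant_probability P mu.
Hypothesis irr : psi_irreducible_aperiodic P.
Hypothesis gap : L2_spectral_gap mu P.

Lemma L2q_decay : exists K rho : R, [/\ 0 <= rho, rho < 1, 0 < K &
  forall n (u : L2q mu), meanq u = 0 -> nrmq (iter n (Pq inv) u) <= K * rho ^+ n * nrmq u].
Proof.
have [eps0 eps00 [fin pole]] := gap.
(* The cap 1/2 keeps the annulus away from 0, which [spectrum2] excludes by definition. *)
have e0 : 0 < Num.min eps0 (1 / 2) :> R by rewrite lt_min eps00 divr_gt0.
have spec2 (z : R[i]) : ~ (exists S, resolvent_op (@nrmq _ _ _ mu) (Pq inv) z S) ->
    1 - Num.min eps0 (1 / 2) <= normc z -> spectrum2 mu P z /\ 1 - eps0 <= normc z.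
  move=> nS zl.
  have e1 : Num.min eps0 (1 / 2) <= eps0 by rewrite ge_min lexx.
  have e2 : Num.min eps0 (1 / 2) <= 1 / 2 by rewrite ge_min lexx orbT.
  split; last lra.
  split; first by rewrite -normc_gt0; lra.
  by case=> Q /(resolvent_lift inv)[S [HS _]]; apply: nS; exists S.
apply: (power_decay (@nrmqD _ _ _ mu) (@nrmqZ _ _ _ mu) (@nrmq_eq0 _ _ _ mu)
   (@nrmq_Pq _ _ _ mu P inv) (@meanq_Pq _ _ _ mu P inv) (@meanq_le _ _ _ mu) _ e0).
- by move=> z h; exact: Pq_eigen.
- by apply: sub_finite_set fin => z [/= nS zl]; exact: spec2.
- by move=> z nS zl; have [h1 h2] := spec2 z nS zl; have [m /(pole_lift inv)] := pole z h1 h2.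
Qed.

Definition rc (f : T -> R) : T -> R[i] := fun x => (f x)%:C%C.

Lemma csq_rc f : measurable_fun setT f -> csq mu (rc f) = sqint mu f.
Proof.
by move=> mf; apply: eq_integral => x _; rewrite normc_sqr /= expr0n addr0.
Qed.

Lemma L2_rc f : measurable_fun setT f -> (sqint mu f < +oo)%E -> L2 mu (rc f).
Proof.
move=> mf hf; apply/L2_csq; rewrite csq_rc//; split => //; split => //.
Qed.

Lemma Kop_rc f : Kop P (rc f) = rc (kint P f).
Proof.
by apply/funext => x; rewrite /Kop /rc /kint /=; congr Complex; rewrite Rintegral_cst// mul0r.
Qed.

Lemma nrmq_rc (u : L2q mu) f : measurable_fun setT f -> (sqint mu f < +oo)%E ->
  rep u = rc f %[ae mu] -> (nrmq u ^+ 2)%:E = sqint mu f.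
Proof.
move=> mf hf uf; have Lf := L2_rc mf hf; have [r r0 [h1 h2]] := L2norm_csq Lf.
have := nrmq_of Lf uf; rewrite h1 => -[->].
by rewrite -h2 csq_rc.
Qed.

(** The equality is only almost sure: [fine] sends an infinite inner integral to 0, which can break
    it on a null set. *)
Lemma kint_kiterS n (f : T -> R) : measurable_fun setT f -> (forall x, 0 <= f x) ->
  (sqint mu f < +oo)%E ->
  kint (kiter P n.+1) f = kint P (kint (kiter P n) f) %[ae mu].
Proof.
move=> mf f0 hf.
have mE : measurable_fun setT (EFin \o f) by exact/measurable_EFinP.
have f0E x : (0 <= (f x)%:E)%E by rewrite lee_fin.
pose A x := (\int[kiter P n x]_y (f y)%:E)%E.
have mA : measurable_fun setT A by exact: measurable_int_kernel.
have A0 x : (0 <= A x)%E by exact: integral_ge0.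
have Af : (\int[mu]_x \int[P x]_y A y < +oo)%E.
  rewrite (integral_invariant inv)// (integral_invariant (kiter_invariant n inv))//.
  have /integrableP[_] := sq_integrable mf hf.
  by rewrite (eq_integral (fun x => (f x)%:E))// => x _; rewrite gee0_abs ?f0E.
have : mu.-integrable setT (fun x => \int[P x]_y A y)%E.
  apply/integrableP; split; first exact: measurable_int_kernel.
  rewrite (eq_integral (fun x => \int[P x]_y A y)%E)// => x _.
  by rewrite gee0_abs ?integral_ge0.
move=> /(integrable_ae measurableT); apply: filterS => x /(_ Logic.I) hx _.
rewrite /kint /Rintegral integral_kiterS//; congr fine.
have : (P x).-integrable setT A.
  apply/integrableP; split => //.
  rewrite (eq_integral A)//; first by rewrite -ge0_fin_numE// integral_ge0.
  by move=> y _; rewrite gee0_abs.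
move=> /(integrable_ae measurableT) hA.
apply: ae_eq_integral => //.
  by apply/measurable_EFinP; exact: (measurable_kint (kiter P n) mf).
by apply: filterS hA => y /(_ Logic.I) hy _; rewrite fineK.
Qed.

(** [L2q_decay] is applied to the class of f - m, with m the mean of f; its iterates under [Pq] are
    represented by the actual functions P^n f - m, and centring does not increase the second
    moment. *)
Lemma kint_gap : exists K rho : R, [/\ 0 <= rho, rho < 1, 0 < K &
  forall n (f : T -> R), measurable_fun setT f -> (forall x, 0 <= f x) -> (sqint mu f < +oo)%E ->
   (sqint mu (fun x => kint (kiter P n) f x - \int[mu]_y f y)%R <=
    ((K * rho ^+ n) ^+ 2)%:E * sqint mu f)%E].
Proof.
have [K [rho [rho0 rho1 K0 HK]]] := L2q_decay.
exists K, rho; split => // n f mf f0 hf.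
set m := \int[mu]_y f y.
have mk k : measurable_fun setT (kint (kiter P k) f) by exact: measurable_kint.
have hk k : (sqint mu (kint (kiter P k) f) < +oo)%E.
  by apply: le_lt_trans hf; apply: sqint_kint => //; exact: kiter_invariant.
have mkm k : measurable_fun setT (fun x => kint (kiter P k) f x - m).
  exact: measurable_funB.
have sqB g : measurable_fun setT g -> (sqint mu g < +oo)%E -> \int[mu]_x g x = m ->
    (sqint mu (fun x => (g x - m)%R) <= sqint mu g)%E.
  move=> mg hg eg; rewrite sqintB_cst// eg.
  have : (2 * m * m - m ^+ 2 = m ^+ 2)%R by ring.
  move=> ->; have := sqint_ge0 mu g; move: hg; case: sqint => // a _ _.
  by rewrite -EFinB lee_fin gerBl sqr_ge0.
have ek k : \int[mu]_x kint (kiter P k) f x = m.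
  by apply: Rintegral_kint => //; exact: kiter_invariant.
have hkm k : (sqint mu (fun x => (kint (kiter P k) f x - m)%R) < +oo)%E.
  by apply: le_lt_trans (hk k); exact: sqB.
pose u := cls (L2_rc (mkm 0%N) (hkm 0%N)).
have ru k : rep (iter k (Pq inv) u) = rc (fun x => kint (kiter P k) f x - m) %[ae mu].
  elim: k => [|k IH]; first exact: rep_cls.
  apply: ae_eq_trans (rep_liftq_of (Kop_bounded inv) (L2_rc (mkm k) (hkm k)) IH) _.
  rewrite Kop_rc.
  apply: filterS2 (kint_kiterS k mf f0 hf) (ae_sqint inv (mk k) (hk k)) => x /(_ Logic.I) h hx _.
  rewrite /rc h; congr (_%:C)%C; rewrite /kint.
  have := sq_integrable (mk k) hx => hI.
  rewrite RintegralB//; last exact: (finite_measure_integrable_cst (kernel_prob P x)).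
  by congr (_ - _); exact: (Rintegral_prob_cst (kernel_prob P x)).
have u0 : meanq u = 0.
  rewrite (meanq_of (L2_rc (mkm 0%N) (hkm 0%N)) (ru 0%N)) /cmean /rc /=.
  rewrite (Rintegral_prob_cst mu) RintegralB//; last 2 first.
  - exact: (sq_integrable (mk 0%N) (hk 0%N)).
  - exact: finite_measure_integrable_cst.
  by rewrite ek Rintegral_prob_cst subrr.
rewrite -(nrmq_rc (mkm n) (hkm n) (ru n)).
apply: (@le_trans _ _ (((K * rho ^+ n) ^+ 2)%:E * (nrmq u ^+ 2)%:E)%E).
  rewrite -EFinM lee_fin -exprMn ler_sqr ?nnegrE ?(nrm_ge0 (@nrmqD _ _ _ mu) (@nrmqZ _ _ _ mu))//.
    exact: HK.
  by rewrite !mulr_ge0 ?exprn_ge0 ?(nrm_ge0 (@nrmqD _ _ _ mu) (@nrmqZ _ _ _ mu))// ltW.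
rewrite (nrmq_rc (mkm 0%N) (hkm 0%N) (ru 0%N)) lee_wpmul2l// ?lee_fin ?sqr_ge0//.
have e0 : kint (kiter P 0) f = f.
  by apply/funext => x; rewrite /kint /Rintegral integral_kiter0//; exact/measurable_EFinP.
by rewrite e0; apply: sqB.
Qed.
End RealGap.

(** * Small sets *)

Section CountableAlgebra.
Context d (T : measurableType d) (R : realType) (g : nat -> set T).

(* [GenTree.tree nat] serves as a countable type of codes for the algebra of sets
   generated by [g]. *)
Fixpoint alg_eval (t : GenTree.tree nat) : set T :=
  match t with
  | GenTree.Leaf n => g n
  | GenTree.Node _ l => ~` ((fix aux l := if l is t :: l' then alg_eval t `|` aux l' else set0) l)
  end.

Definition alg_compl (t : GenTree.tree nat) := GenTree.Node 0 [:: t].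
Definition alg_union (t s : GenTree.tree nat) := alg_compl (GenTree.Node 0 [:: t; s]).

Lemma alg_complE t : alg_eval (alg_compl t) = ~` alg_eval t.
Proof. by rewrite /= setU0. Qed.

Lemma alg_unionE t s : alg_eval (alg_union t s) = alg_eval t `|` alg_eval s.
Proof. by rewrite /= !setU0 setCK. Qed.

Hypothesis mg : forall n, measurable (g n).

Lemma measurable_alg t : measurable (alg_eval t).
Proof.
elim: t => [n|k l] //= H; apply: measurableC.
by elim: l H => [|t l IH] //= [H1 H2]; apply: measurableU => //; exact: IH.
Qed.

Context (m : {measure set T -> \bar R}).
Hypothesis mfin : (m setT < +oo)%E.

(** Bounding the two one-sided differences separately makes the notion stable under complement,
    which exchanges them. *)
Definition approximable (B : set T) := measurable B /\ forall eps : R, 0 < eps ->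
  exists t, (m (B `\` alg_eval t) <= eps%:E)%E /\ (m (alg_eval t `\` B) <= eps%:E)%E.

Lemma approximable_alg t : approximable (alg_eval t).
Proof.
split; first exact: measurable_alg.
by move=> eps e0; exists t; rewrite setDv measure0 lee_fin ltW.
Qed.

Lemma approximableC B : approximable B -> approximable (~` B).
Proof.
move=> [mB HB]; split; first exact: measurableC.
move=> eps e0; have [t [h1 h2]] := HB eps e0; exists (alg_compl t).
rewrite alg_complE; split; first by rewrite setDE setCK setIC -setDE.
by rewrite setDE setCK setIC -setDE.
Qed.

Lemma approximableU A B : approximable A -> approximable B -> approximable (A `|` B).
Proof.
move=> [mA HA] [mB HB]; split; first exact: measurableU.
move=> eps e0; have e2 : 0 < eps / 2 by rewrite divr_gt0.
have [t [h1 h2]] := HA _ e2; have [s [h3 h4]] := HB _ e2; exists (alg_union t s).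
have mt := measurable_alg t; have ms := measurable_alg s.
rewrite alg_unionE (splitr eps) EFinD; split.
- apply: le_trans (leeD h1 h3); apply: le_trans (measureU2 _ _ _); last 2 first.
    exact: measurableD.
    exact: measurableD.
  apply: le_measure; rewrite ?inE.
  + by apply: measurableD; exact: measurableU.
  + by apply: measurableU; exact: measurableD.
  + by move=> x [[Ax|Bx] /not_orP[nt ns]]; [left|right].
- apply: le_trans (leeD h2 h4); apply: le_trans (measureU2 _ _ _); last 2 first.
    exact: measurableD.
    exact: measurableD.
  apply: le_measure; rewrite ?inE.
  + by apply: measurableD; exact: measurableU.
  + by apply: measurableU; exact: measurableD.
  + by move=> x [[Ax|Bx] /not_orP[nt ns]]; [left|right].
Qed.

Lemma approximable0 : approximable set0.
Proof.
split => // eps e0; exists (alg_compl (GenTree.Node 0 [::])).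
by rewrite /= setU0 setC0 setCT setDv measure0 lee_fin ltW.
Qed.

(** Continuity from above, available for a finite measure, replaces the union by a finite one at the
    cost of half of [eps]. *)
Lemma approximable_bigcup (A : nat -> set T) : (forall n, approximable (A n)) ->
  approximable (\bigcup_n A n).
Proof.
move=> HA; have mA n : measurable (A n) by case: (HA n).
have mU : measurable (\bigcup_n A n) by exact: bigcup_measurable.
split => // eps e0; have e2 : 0 < eps / 2 by rewrite divr_gt0.
pose U n := \big[setU/set0]_(i < n) A i.
have HU n : approximable (U n).
  rewrite /U; elim: n => [|n IH]; first by rewrite big_ord0; exact: approximable0.
  by rewrite big_ord_recr; exact: approximableU.
have mUn n : measurable (U n) by case: (HU n).
have : m ((\bigcup_n A n) `\` U n) @[n --> \oo] --> m (\bigcap_n ((\bigcup_n A n) `\` U n)).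
  apply: nonincreasing_cvg_mu => //.
  - by apply: le_lt_trans mfin; apply: le_measure; rewrite ?inE//; exact: measurableD.
  - by move=> n; exact: measurableD.
  - by apply: bigcapT_measurable => n; exact: measurableD.
  - move=> i j ij; apply/subsetPset; apply: setDS.
    by apply: subset_bigsetU.
rewrite (_ : \bigcap_n _ = set0) ?measure0; last first.
  apply/seteqP; split => // x Hx; have [[k _ Akx] _] := Hx 0%N I.
  by have [_ []] := Hx k.+1 I; rewrite /U big_ord_recr; right.
have le_eps n : (m ((\bigcup_n A n) `\` U n) < +oo)%E.
  by apply: le_lt_trans mfin; apply: le_measure; rewrite ?inE//; exact: measurableD.
move=> /fine_cvgP[_ /cvgrPdist_le /(_ _ e2)] [N _ /(_ N (leqnn _))] /=.
rewrite sub0r normrN ger0_norm ?fine_ge0// => hN.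
have {}hN : (m ((\bigcup_n A n) `\` U N) <= (eps / 2)%:E)%E.
  by rewrite -lee_fin fineK ?ge0_fin_numE// in hN.
have [t [h1 h2]] := (HU N).2 _ e2; exists t; have mt := measurable_alg t.
have UA : U N `<=` \bigcup_n A n.
  by move=> x; rewrite /U -bigcup_mkord => -[i _ Aix]; exists i.
split.
- rewrite (splitr eps) EFinD; apply: le_trans (leeD hN h1).
  apply: le_trans (measureU2 _ _ _); last 2 first.
    exact: measurableD.
    exact: measurableD.
  apply: le_measure; rewrite ?inE; [exact: measurableD|apply: measurableU; exact: measurableD|].
  by move=> x [Ax nt]; have [Ux|nU] := pselect (U N x); [right|left].
- apply: le_trans (le_trans h2 _); last by rewrite lee_fin; lra.
  apply: le_measure; rewrite ?inE; [exact: measurableD|exact: measurableD|].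
  by move=> x [tx nA]; split => // /UA.
Qed.

Lemma sigma_approximable : <<s range g >> `<=` approximable.
Proof.
apply: smallest_sub; last first.
  by move=> _ [n _ <-]; exact: (approximable_alg (GenTree.Leaf n)).
split; first exact: approximable0.
  by move=> A HA; rewrite setTD; exact: approximableC.
by move=> A HA; exact: approximable_bigcup.
Qed.
End CountableAlgebra.

Lemma countably_generated_seq d (T : measurableType d) : countably_generated T ->
  exists g : nat -> set T, (forall n, measurable (g n)) /\
    (forall B, measurable B -> (<<s range g >>) B).
Proof.
move=> [G [/countable_injP[f finj] GE]].
have mG A : G A -> measurable A by move=> GA; rewrite GE; exact: sub_sigma_algebra.
pose g n := xget set0 [set A | G A /\ f A = n].
have gG n : g n = set0 \/ G (g n).
  rewrite /g; case: xgetP => [A _ [GA _]|_]; [by right|by left].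
exists g; split.
  by move=> n; case: (gG n) => [->//|/mG].
move=> B; rewrite GE; apply: smallest_sub; first exact: smallest_sigma_algebra.
move=> A GA.
apply: sub_sigma_algebra; exists (f A) => //.
have [GA' fA] : [set A' | G A' /\ f A' = f A] (g (f A)).
  by apply: (@xgetPex _ set0 [set A' | G A' /\ f A' = f A]); exists A.
by apply: finj => //; rewrite inE.
Qed.

(** Approximating a set in the sum of the two measures makes one element of the countable algebra
    serve for both. *)
Lemma le_measure_countable d (T : measurableType d) (R : realType) (g : nat -> set T)
  (m1 m2 : {measure set T -> \bar R}) :
  (forall n, measurable (g n)) -> (forall B, measurable B -> (<<s range g >>) B) ->
  (m1 setT < +oo)%E -> (m2 setT < +oo)%E ->
  (forall t, m1 (alg_eval g t) <= m2 (alg_eval g t))%E ->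
  forall B, measurable B -> (m1 B <= m2 B)%E.
Proof.
move=> mg gB f1 f2 H B mB.
pose m := measure_add m1 m2.
have mE A : m A = (m1 A + m2 A)%E by rewrite /m measure_addE.
have mf : (m setT < +oo)%E by rewrite mE lte_add_pinfty.
have [_ HB] := @sigma_approximable _ _ _ _ mg m mf _ (gB B mB).
apply/lee_addgt0Pr => eps e0; have e2 : 0 < eps / 2 by rewrite divr_gt0.
have [t [h1 h2]] := HB _ e2; have mt := measurable_alg mg t.
have {}h1 : (m1 (B `\` alg_eval g t) + m2 (B `\` alg_eval g t) <= (eps / 2)%:E)%E.
  by rewrite -mE.
have {}h2 : (m1 (alg_eval g t `\` B) + m2 (alg_eval g t `\` B) <= (eps / 2)%:E)%E.
  by rewrite -mE.
have a1 : (m1 B <= m1 (alg_eval g t) + (eps / 2)%:E)%E.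
  apply: (@le_trans _ _ (m1 (alg_eval g t) + m1 (B `\` alg_eval g t))%E).
    apply: le_trans (measureU2 _ _ _) => //; last exact: measurableD.
    apply: le_measure; rewrite ?inE//; first by apply: measurableU => //; exact: measurableD.
    by move=> x Bx; have [?|?] := pselect (alg_eval g t x); [left|right].
  by apply: leeD => //; apply: le_trans h1; rewrite leeDl.
have a2 : (m2 (alg_eval g t) <= m2 B + (eps / 2)%:E)%E.
  apply: (@le_trans _ _ (m2 B + m2 (alg_eval g t `\` B))%E).
    apply: le_trans (measureU2 _ _ _) => //; last exact: measurableD.
    apply: le_measure; rewrite ?inE//; first by apply: measurableU => //; exact: measurableD.
    by move=> x Bx; have [?|?] := pselect (B x); [left|right].
  by apply: leeD => //; apply: le_trans h2; rewrite leeDr.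
apply: (le_trans a1); rewrite [in leRHS](splitr eps) EFinD addeA leeD2r//.
exact: le_trans (H t) a2.
Qed.

Local Open Scope ereal_scope.

Section FiniteMeasureOf.
Context d (S : measurableType d) (R : realType) (m : {measure set S -> \bar R}).

Definition finite_measure_of of fin_num_fun m : set S -> \bar R := m.

HB.instance Definition _ mf := Measure.on (@finite_measure_of mf).
HB.instance Definition _ mf :=
  Measure_isFinite.Build _ _ _ (@finite_measure_of mf) mf.
End FiniteMeasureOf.

(** [H] is the positive set of a Hahn decomposition of the charge m1 - t m2. *)
Lemma hahn_threshold d (S : measurableType d) (R : realType)
    (m1 m2 : {measure set S -> \bar R}) (t : R) :
  m1 setT < +oo -> m2 setT < +oo ->
  exists H, [/\ measurable H,
    forall G, measurable G -> t%:E * m2 (G `&` H) <= m1 G &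
    forall G, measurable G -> G `&` H = set0 -> m1 G <= t%:E * m2 G].
Proof.
move=> f1 f2.
have fin (m : {measure set S -> \bar R}) : m setT < +oo -> fin_num_fun m.
  by move=> mf A mA; rewrite ge0_fin_numE//; apply: le_lt_trans mf; apply: le_measure; rewrite ?inE.
pose nu := cadd (charge_of_finite_measure (finite_measure_of (fin m1 f1)))
  (cscale (- t) (charge_of_finite_measure (finite_measure_of (fin m2 f2)))).
have nuE A : nu A = m1 A - t%:E * m2 A.
  by rewrite -mulNe -EFinN.
have [Q [N [[mQ HQ] [mN HN] QN _]]] := Hahn_decomposition nu.
exists Q; split => //.
- move=> G mG; have mGQ : measurable (G `&` Q) by exact: measurableI.
  have : 0 <= nu (G `&` Q) := HQ _ mGQ (@subIsetr _ _ _).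
  rewrite nuE sube_ge0; last by rewrite (fin m1 f1)// orbT.
  move=> h; apply: le_trans h _; apply: le_measure; rewrite ?inE//; exact: subIsetl.
- move=> G mG GQ; have GN : G `<=` N.
    move=> x Gx; have : (Q `|` N) x by rewrite QN.
    by case=> // Qx; have : (G `&` Q) x by []; rewrite GQ.
  have : nu G <= 0 := HN _ mG GN.
  by rewrite nuE sube_le0.
Qed.

Lemma prob_mass d (T : measurableType d) (R : realType) (m : probability T R) :
  m setT = 1.
Proof. exact: probability_setT. Qed.

Lemma ae_exists d (T : measurableType d) (R : realType) (mu : probability T R)
  (A : T -> Prop) : {ae mu, forall x, A x} -> exists x, A x.
Proof.
move=> [N [mN N0 HN]]; apply: contrapT => nex.
have : mu setT = 0.
  apply/eqP; rewrite -measure_le0 -N0 le_measure ?inE// => x _.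
  by apply: HN => hx; apply: nex; exists x.
by rewrite prob_mass => /eqP; rewrite onee_eq0.
Qed.

Lemma ae_eq0_integral d (T : measurableType d) (R : realType)
    (mu : {measure set T -> \bar R}) (f : T -> \bar R) :
  measurable_fun setT f -> (forall x, 0 <= f x) -> \int[mu]_x f x = 0 ->
  {ae mu, forall x, f x = 0}.
Proof.
move=> mf f0 i0; have := (ae_eq_integral_abs mu measurableT mf).1.
rewrite (eq_integral f); last by move=> x _; rewrite gee0_abs.
by move=> /(_ i0); apply: filterS => x /(_ Logic.I).
Qed.

(** Tested on the set where g < f, the hypothesis forces f = g almost everywhere there, so that set
    is null. *)
Lemma ae_le_of_integral d (T : measurableType d) (R : realType)
    (mu : probability T R) (f g : T -> \bar R) :
  measurable_fun setT f -> measurable_fun setT g ->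
  (forall x, 0 <= f x) -> (forall x, 0 <= g x) -> \int[mu]_x g x < +oo ->
  (forall D, measurable D -> \int[mu]_(x in D) f x <= \int[mu]_(x in D) g x) ->
  {ae mu, forall x, f x <= g x}.
Proof.
move=> mf mg f0 g0 gi H.
pose D := [set x | g x < f x].
have mD : measurable D.
  rewrite (_ : D = setT `&` D); last by rewrite setTI.
  exact: measurable_lte.
have r0 (h : T -> \bar R) : (forall x, 0 <= h x) -> forall x, 0 <= (h \_ D) x.
  by move=> h0 x; rewrite patchE; case: ifP.
have mr (h : T -> \bar R) : measurable_fun setT h -> measurable_fun setT (h \_ D).
  by move=> mh; exact: (measurable_restrictT h mD).1 (measurable_funTS mh).
have fge : {ae mu, forall x, (g \_ D) x = (f \_ D) x}.
  apply: ae_eq_of_le; [exact: mr|exact: mr|exact: r0| | |exact: r0|].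
  - apply: filterE => x; rewrite !patchE; case: ifP => //.
    by rewrite inE => /ltW.
  - rewrite -integral_mkcond; apply: le_lt_trans (H D mD) _.
    apply: le_lt_trans gi; apply: ge0_subset_integral => //.
  - by rewrite -!integral_mkcond; exact: H.
apply: filterS fge => x; rewrite !patchE leNgt; case: ifPn.
  by move=> _ ->; rewrite ltxx.
by move=> /negP xD _; apply/negP => h; apply: xD; rewrite inE.
Qed.

Section Joint.
Context d (T : measurableType d) (R : realType) (mu : probability T R).

(** The law of (X(0), X(n)) with X(0) distributed as [mu], when [k] is the n-step kernel; for
    [cst_kernel mu] it is the product measure. *)
Definition joint (k : R.-pker T ~> T) : {measure set (T * T) -> \bar R} :=
  mkproduct (cst_kernel mu) (@kernel.kernel_snd _ _ _ T T T R k) point.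

Lemma jointE k A : measurable A -> joint k A = \int[mu]_x k x (xsection A x).
Proof.
by move=> mA; apply: eq_integral => x _; rewrite kernel.intker_indicE.
Qed.

Lemma joint_setT k : joint k setT = 1.
Proof.
rewrite jointE// (eq_integral (cst 1)); first exact: integral_prob_cst.
move=> x _; rewrite (_ : xsection _ x = setT) ?prob_kernel//.
by apply/seteqP; split => y //= _; rewrite /xsection /= inE.
Qed.

Lemma joint_cstE A : measurable A ->
  joint (cst_kernel mu) A = \int[mu]_x mu (xsection A x).
Proof. exact: jointE. Qed.

Context (P : R.-pker T ~> T).
Hypothesis inv : invariant_probability P mu.
Hypothesis irr : psi_irreducible_aperiodic P.

Let mu2 := joint (cst_kernel mu).

Lemma measurable_xsection_kernel (k : R.-pker T ~> T) (A : set (T * T)) :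
  measurable A -> measurable_fun setT (fun x => k x (xsection A x)).
Proof. by move=> mA; apply: measurable_fun_xsection_finite_kernel; exact: mem_set. Qed.

(* Otherwise, by the Hahn decomposition, each P^n(x, .) is singular to mu for
   almost every x, and the union of the supports is a mu-null set whose
   complement is never visited. *)
Lemma iter_ac_component : exists n (t : R) H, [/\ (0 < t)%R, measurable H, 0 < mu2 H &
  forall G, measurable G -> t%:E * mu2 (G `&` H) <= joint (kiter P n) G].
Proof.
have j_lty k : joint k setT < +oo by rewrite joint_setT ltry.
(* The index [p] is a pair of a time n and a number j that stands for the threshold 1/(j+1). *)
have /choice[H0 HH0] : forall p : nat * nat, exists H, [/\ measurable H,
    forall G, measurable G -> (p.2.+1%:R^-1)%:E * mu2 (G `&` H) <= joint (kiter P p.1) G &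
    forall G, measurable G -> G `&` H = set0 ->
      joint (kiter P p.1) G <= (p.2.+1%:R^-1)%:E * mu2 G].
  by move=> p; apply: hahn_threshold; exact: j_lty.
have [[p Hp]|/forallNP nH] := pselect (exists p, 0 < mu2 (H0 p)).
  by exists p.1, (p.2.+1%:R^-1)%R, (H0 p); have [h1 h2 _] := HH0 p; rewrite invr_gt0.
have H00 p : mu2 (H0 p) = 0.
  by apply/eqP; rewrite eq_le measure_ge0 andbT leNgt; apply/negP/nH.
have mH0 p : measurable (H0 p) by case: (HH0 p).
pose Z := \bigcup_n \bigcup_j H0 (n, j).
have mZ : measurable Z by apply: bigcupT_measurable => n; exact: bigcupT_measurable.
have Z0 : mu2 Z = 0.
  apply: (measure_negligible mZ); apply: negligible_bigcup => n.
  by apply: negligible_bigcup => j; apply/(negligibleP _ (mH0 _)); exact: H00.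
(* Off [Z] the joint law is bounded by 1/(j+1) for every j. *)
have nZ n : joint (kiter P n) (~` Z) = 0.
  apply/eqP; rewrite eq_le measure_ge0 andbT.
  apply/lee_addgt0Pr => eps e0; rewrite add0e.
  pose j := Num.truncn eps^-1.
  have [_ _ /(_ (~` Z) (measurableC mZ))] := HH0 (n, j).
  have -> : ~` Z `&` H0 (n, j) = set0.
    by apply/seteqP; split => // x [nz h]; apply: nz; exists n => //; exists j.
  move=> /(_ erefl) h; apply: le_trans h _.
  apply: (@le_trans _ _ ((j.+1%:R^-1)%:E * 1)).
    rewrite lee_wpmul2l ?lee_fin ?invr_ge0//= -(joint_setT (cst_kernel mu)).
    by apply: le_measure; rewrite ?inE//; exact: measurableC.
  rewrite mule1 lee_fin -[leRHS]invrK lef_pV2 ?posrE ?invr_gt0//.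
  exact: ltW (truncnS_gt _).
have s1 : {ae mu, forall x, mu (xsection Z x) = 0}.
  apply: ae_eq0_integral => //; first exact: (measurable_xsection_kernel (cst_kernel mu)).
  by rewrite -joint_cstE.
have s2 : {ae mu, forall x, forall n, kiter P n x (xsection (~` Z) x) = 0}.
  apply: ae_foralln => n; apply: ae_eq0_integral => //.
    by apply: measurable_xsection_kernel; exact: measurableC.
  by rewrite -jointE//; exact: measurableC.
have [x [x1 x2]] := ae_exists (filterI s1 s2).
have [psi [[psi0 Hpsi] _]] := irr.
have mZx : measurable (xsection Z x) by exact: measurable_xsection.
have mnZx : measurable (xsection (~` Z) x) by apply: measurable_xsection; exact: measurableC.
(* [psi] is dominated by [mu]: a [mu]-null set is, by invariance, missed at all times from almost
   every start, which irreducibility forbids for a set of positive [psi]-measure. *)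
have psi_pos A : measurable A -> 0 < psi A -> 0 < mu A.
  move=> mA pA; rewrite lt_neqAle measure_ge0 andbT eq_sym; apply/negP => /eqP A0.
  have : {ae mu, forall y, forall n, kiter P n y A = 0}.
    apply: ae_foralln => n; apply: ae_eq0_integral => //; first exact: measurable_kernel.
    by rewrite (kiter_invariant n inv).
  move=> /ae_exists[y hy]; have [n0 _ /(_ n0 (leqnn _))] := Hpsi A mA pA y.
  by rewrite /= -kiterE hy ltxx.
have psiZ : psi (xsection Z x) = 0.
  apply/eqP; rewrite eq_le measure_ge0 andbT leNgt; apply/negP => /(psi_pos _ mZx).
  by rewrite x1 ltxx.
have psinZ : 0 < psi (xsection (~` Z) x).
  rewrite lt_neqAle measure_ge0 andbT eq_sym; apply/negP => /eqP h.
  move/eqP: psi0; apply.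
  have := negligibleU ((negligibleP psi mZx).2 psiZ) ((negligibleP psi mnZx).2 h).
  rewrite (_ : _ `|` _ = setT); first exact: measure_negligible.
  apply/seteqP; split => // y _; rewrite /xsection /=.
  by have [zy|nzy] := pselect (Z (x, y)); [left|right]; rewrite inE.
have [n0 _ /(_ n0 (leqnn _))] := Hpsi _ mnZx psinZ x.
by rewrite /= -kiterE x2 ltxx.
Qed.
End Joint.

Section LeIntegralMeasure.
Import HBNNSimple.

Lemma le_integral_measure d (T : measurableType d) (R : realType)
    (m1 m2 : {measure set T -> \bar R}) (f : T -> \bar R) :
  (forall A, measurable A -> m1 A <= m2 A) -> (forall x, 0 <= f x) ->
  \int[m1]_x f x <= \int[m2]_x f x.
Proof.
move=> m12 f0; rewrite !ge0_integralTE//; apply: ge_ereal_sup => _ [h hf <-].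
apply: (@le_trans _ _ (sintegral m2 h)); last by apply: ereal_sup_ubound; exists h.
rewrite !sintegralE; apply: lee_fsum => [|r [x _ <-]]; first exact: fimfunP.
by rewrite lee_wpmul2l// ?lee_fin// m12.
Qed.
End LeIntegralMeasure.

(** * Minorization for all sets at once *)

Section MinorizationAllSets.
Context d (T : measurableType d) (R : realType) (mu : probability T R).
Hypothesis hcg : countably_generated T.
Local Notation joint := (joint mu).
Local Notation mu2 := (joint (cst_kernel mu)).

Lemma joint_setX (k : R.-pker T ~> T) (D E : set T) (H : set (T * T)) :
  measurable D -> measurable E -> measurable H ->
  joint k ((D `*` E) `&` H) = \int[mu]_(x in D) k x (E `&` xsection H x).
Proof.
move=> mD mE mH; rewrite jointE; last by apply: measurableI => //; exact: measurableX.
rewrite [RHS]integral_mkcond; apply: eq_integral => x _; rewrite patchE xsectionI.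
case: ifPn => xD; first by rewrite in_xsectionX.
by rewrite notin_xsectionX// set0I measure0.
Qed.

(** Tested on rectangles D x A, the inequality of joint laws gives an almost sure inequality for
    each A. The countably many A of the generated algebra need one common null set, and
    [le_measure_countable] extends the result to all sets. *)
Lemma ae_minorization (k : R.-pker T ~> T) (t : R) (H : set (T * T)) : (0 < t)%R ->
  measurable H ->
  (forall G, measurable G -> t%:E * mu2 (G `&` H) <= joint k G) ->
  {ae mu, forall x, forall B, measurable B -> t%:E * mu (B `&` xsection H x) <= k x B}.
Proof.
move=> t0 mH HG.
have [g [mg gB]] := countably_generated_seq hcg.
have mt := measurable_alg mg.
have key c : {ae mu, forall x,
    t%:E * mu (alg_eval g c `&` xsection H x) <= k x (alg_eval g c)}.
  have mf : measurable_fun setT (fun x => mu (alg_eval g c `&` xsection H x)).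
    rewrite (_ : (fun x => _) = (fun x => cst_kernel mu x
        (xsection ((setT `*` alg_eval g c) `&` H) x))).
      by apply: measurable_xsection_kernel; apply: measurableI => //; exact: measurableX.
    by apply/funext => x; rewrite xsectionI in_xsectionX// inE.
  apply: ae_le_of_integral => //.
  - exact: measurable_funeM.
  - exact: measurable_kernel.
  - by move=> x; rewrite mule_ge0// lee_fin ltW.
  - apply: (@le_lt_trans _ _ (\int[mu]_x cst 1 x)); last by rewrite integral_prob_cst ltry.
    apply: ge0_le_integral => //; first exact: measurable_kernel.
    move=> x _; rewrite (_ : cst 1 x = k x setT); last by rewrite prob_kernel.
    by apply: le_measure; rewrite ?inE.
  - move=> D mD.
    have := HG (D `*` alg_eval g c) (measurableX mD (mt c)).
    rewrite joint_setX// -[X in joint k X]setIT joint_setX//.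
    rewrite ge0_integralZl//; last 2 first.
    + exact: measurable_funTS.
    + by rewrite lee_fin ltW.
    congr (_ <= _); apply: eq_integral => x _; congr (k x _).
    by rewrite (_ : xsection setT x = setT) ?setIT//; apply/seteqP; split => y //= _; rewrite /xsection /= inE.
have : {ae mu, forall x, forall n, forall c, choice.unpickle n = Some c ->
    t%:E * mu (alg_eval g c `&` xsection H x) <= k x (alg_eval g c)}.
  apply: ae_foralln => n; case: choice.unpickle => [c|]; last exact: filterE.
  by apply: filterS (key c) => x h _ [<-].
apply: filterS => x hx.
have mHx : measurable (xsection H x) by exact: measurable_xsection.
pose m1 := mscale (NngNum (ltW t0)) (mrestr mu mHx).
apply: (@le_measure_countable _ _ _ g m1 (k x) mg gB).
- have : t%:E * mu (setT `&` xsection H x) < +oo; last by [].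
  rewrite lte_mul_pinfty// ?lee_fin ?ltW// setTI.
  by apply: le_lt_trans (ltry 1); rewrite -(prob_mass mu); apply: le_measure; rewrite ?inE.
- by rewrite prob_kernel ltry.
- by move=> c; apply: (hx (choice.pickle c)); exact: choice.pickleK.
Qed.
End MinorizationAllSets.

Lemma minorized_integral d (T : measurableType d) (R : realType)
    (m1 m2 : {measure set T -> \bar R}) (t : R) (D : set T) (f : T -> \bar R) :
  (0 <= t)%R -> measurable D ->
  (forall B, measurable B -> t%:E * m1 (B `&` D) <= m2 B) ->
  (forall x, 0 <= f x) -> measurable_fun setT f ->
  t%:E * \int[m1]_(x in D) f x <= \int[m2]_x f x.
Proof.
move=> t0 mD HB f0 mf.
apply: (@le_trans _ _ (\int[mscale (NngNum t0) (mrestr m1 mD)]_x f x)); last first.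
  by apply: le_integral_measure => // A mA; exact: HB.
rewrite ge0_integral_mscale//= lee_wpmul2l ?lee_fin//.
apply: (@le_trans _ _ (\int[mrestr m1 mD]_(x in D) f x)); last first.
  by apply: ge0_subset_integral => //; exact: measurable_funTS.
rewrite le_eqVlt; apply/orP; left; apply/eqP; apply: eq_measure_integral => A mA AD.
by rewrite -[in LHS](setIidl AD).
Qed.

Lemma integrable_bounded_prob d (T : measurableType d) (R : realType)
    (m : probability T R) (f : T -> R) (c : R) :
  measurable_fun setT f -> (forall x, 0 <= f x <= c)%R -> m.-integrable setT (EFin \o f).
Proof.
move=> mf fc; apply: measurable_bounded_integrable => //; first by apply: (@le_lt_trans _ _ 1); [rewrite -(prob_mass m) lexx|exact: ltry].
exists c; split; first by rewrite num_real.
move=> M cM x _ /=; have /andP[f0 fle] := fc x.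
by rewrite ger0_norm// (le_trans fle)// ltW.
Qed.

(** Otherwise the level sets at heights 1/(n+1) are all null and f vanishes almost everywhere. *)
Lemma positive_level d (T : measurableType d) (R : realType) (mu : probability T R)
    (f : T -> \bar R) : measurable_fun setT f -> (forall x, 0 <= f x) ->
  0 < \int[mu]_x f x -> exists del : R, (0 < del)%R /\ 0 < mu [set x | del%:E <= f x].
Proof.
move=> mf f0 fpos; apply: contrapT => nex.
have mL (r : R) : measurable [set x | r%:E <= f x].
  rewrite (_ : [set _ | _] = setT `&` [set x | r%:E <= f x]); last by rewrite setTI.
  by apply: measurable_lee.
have L0 n : mu [set x | (n.+1%:R^-1)%:E <= f x] = 0.
  apply/eqP; rewrite eq_le measure_ge0 andbT leNgt; apply/negP => h.
  by apply: nex; exists (n.+1%:R^-1)%R; rewrite invr_gt0.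
have : mu.-negligible (\bigcup_n [set x | (n.+1%:R^-1)%:E <= f x]).
  by apply: negligible_bigcup => n; apply/(negligibleP _ (mL _)); exact: L0.
move=> ng; move: fpos; rewrite (@ae_eq_integral _ _ _ mu _ (cst 0))//; first by rewrite integral0 ltxx.
apply: negligibleS ng => x /= h; apply: contrapT => nx; apply: h => _.
apply/eqP; rewrite eq_le f0 andbT leNgt; apply/negP => fx; apply: nx.
have [r [r0 hr]] : exists r : R, (0 < r)%R /\ r%:E <= f x.
  move: fx; case: (f x) => [r||]//; first by rewrite lte_fin => r0; exists r.
  by move=> _; exists 1%R; rewrite leey.
exists (Num.truncn r^-1) => //=; apply: le_trans hr; rewrite lee_fin.
by rewrite -[leRHS]invrK lef_pV2 ?posrE ?invr_gt0//; exact: ltW (truncnS_gt _).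
Qed.

Section SmallSet.
Context d (T : measurableType d) (R : realType) (mu : probability T R).
Context (P : R.-pker T ~> T).
Hypothesis inv : invariant_probability P mu.
Hypothesis irr : psi_irreducible_aperiodic P.
Hypothesis hcg : countably_generated T.
Hypothesis gap : L2_spectral_gap mu P.

Lemma kiterD m n x A : measurable A ->
  kiter P (m + n) x A = \int[kiter P m x]_y kiter P n y A.
Proof.
move=> mA.
have e (k : R.-pker T ~> T) y : k y A = \int[k y]_z (\1_A z)%:E.
  by rewrite integral_indic// setIT.
rewrite e integral_kiterD//.
  by apply: eq_integral => y _; rewrite -e.
by apply/measurable_EFinP; exact: measurable_indic.
Qed.

Lemma le1_prob (A : set T) : measurable A -> mu A <= 1.
Proof. by move=> mA; rewrite -(prob_mass mu); apply: le_measure; rewrite ?inE. Qed.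

Lemma fin_prob (A : set T) : measurable A -> mu A \is a fin_num.
Proof.
by move=> mA; rewrite ge0_fin_numE//; apply: le_lt_trans (le1_prob mA) (ltry _).
Qed.

Section Core.
Context (n : nat) (t : R) (H : set (T * T)).
Hypothesis t0 : (0 < t)%R.
Hypothesis mH : measurable H.
Context (G : set T).
Hypothesis mG : measurable G.
Hypothesis G1 : mu (~` G) = 0.
Hypothesis HG : forall x, G x -> forall B, measurable B ->
  t%:E * mu (B `&` xsection H x) <= kiter P n x B.
Context (del : R) (B : set T).
Hypothesis del0 : (0 < del)%R.
Hypothesis HB : forall z, B z -> del%:E <= mu (ysection H z).
Context (K rho : R) (k : nat).
Hypothesis gapk : forall f : T -> R, measurable_fun setT f -> (forall x, 0 <= f x)%R ->
  sqint mu f < +oo ->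
  sqint mu (fun x => kint (kiter P k) f x - \int[mu]_y f y)%R <=
    ((K * rho ^+ k) ^+ 2)%:E * sqint mu f.
Hypothesis Kk : (0 <= K * rho ^+ k <= del ^+ 2 / 2)%R.

Let mHx x : measurable (xsection H x).
Proof. exact: measurable_xsection. Qed.

(** By Fubini the right-hand side is the integral over A of the measures of the y-sections of [H],
    which are at least [del] because A lies in [B]. *)
Lemma core_mean (A : set T) : measurable A -> A `<=` B ->
  del%:E * mu A <= \int[mu]_y mu (A `&` xsection H y).
Proof.
move=> mA AB.
pose G' := (setT `*` A) `&` H.
have mG' : measurable G' by apply: measurableI => //; exact: measurableX.
have mf : measurable_fun setT (fun z => (\1_G' z)%:E : \bar R).
  by apply/measurable_EFinP; exact: measurable_indic.
have f0 z : 0 <= (\1_G' z)%:E :> \bar R by rewrite lee_fin.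
have e1 : \int[mu]_y mu (A `&` xsection H y) = \int[mu]_x \int[mu]_y (\1_G' (x, y))%:E.
  apply: eq_integral => x _; rewrite -(setIT (A `&` _)) -integral_indic//.
    apply: eq_integral => y _; congr (_ %:E); rewrite !indicE; congr (nat_of_bool _)%:R.
    rewrite /G' (in_setI _ A) (in_setI _ (setT `*` A)) mem_xsection; congr andb.
    by apply/idP/idP => [h|h]; rewrite inE; [split => //; exact: set_mem|have [] := set_mem h].
  exact: measurableI.
rewrite e1 (fubini_tonelli _ mf f0).
apply: (@le_trans _ _ (\int[mu]_y (del%:E * (\1_A y)%:E))).
  rewrite ge0_integralZl_EFin//; last 2 first.
  - by apply/measurable_EFinP; exact: measurable_indic.
  - exact: ltW.
  by rewrite integral_indic// setIT.
apply: ge0_le_integral => //.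
- by move=> y _; rewrite -EFinM lee_fin mulr_ge0// ltW.
- by apply: measurable_funeM; apply/measurable_EFinP; exact: measurable_indic.
- exact: (measurable_fun_fubini_tonelli_G (m1 := mu) _ mf f0).
move=> y _; rewrite indicE; case: (boolP (y \in A)) => yA; last first.
  by rewrite mule0 integral_ge0.
have By : B y by apply: AB; exact: set_mem.
rewrite mule1; apply: le_trans (HB By) _.
have mys : measurable (ysection H y) by exact: measurable_ysection.
rewrite -[X in mu X]setIT -integral_indic//; apply: ge0_le_integral => //.
- by apply/measurable_EFinP; exact: measurable_indic.
- exact: (measurableT_comp mf (measurable_pair2 y)).
move=> x _; rewrite lee_fin !indicE mem_ysection ler_nat.
by case: (boolP ((x, y) \in H)) => // /set_mem xy; rewrite mem_set//; split => //; split => //; exact: set_mem.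
Qed.

(* The first P^n puts mass at least t mu on the section of H at x, the last one
   at least t mu(A & H_y) at the arrival point y; in between, P^k replaces the
   function y |-> mu(A & H_y) by its mean up to an L_2 error. *)
Lemma core_minorization x (A : set T) : G x -> del%:E <= mu (xsection H x) ->
  measurable A -> A `<=` B ->
  (t ^+ 2 * (del ^+ 2 / 2))%:E * mu A <= kiter P (n + (k + n)) x A.
Proof.
move=> Gx Hx mA AB.
pose al y := fine (mu (A `&` xsection H y)).
pose a := fine (mu A).
have muA : mu A = a%:E by rewrite fineK// fin_prob.
have alE y : mu (A `&` xsection H y) = (al y)%:E.
  by rewrite fineK// fin_prob//; exact: measurableI.
have al0 y : (0 <= al y)%R by rewrite -lee_fin -alE.
have ala y : (al y <= a)%R.
  by rewrite -lee_fin -alE -muA; apply: le_measure; rewrite ?inE//; exact: measurableI.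
have a0 : (0 <= a)%R by rewrite -lee_fin -muA.
have mal : measurable_fun setT al.
  apply/measurable_EFinP; rewrite (_ : _ \o _ = fun y => cst_kernel mu y
      (xsection ((setT `*` A) `&` H) y)); last first.
    by apply/funext => y; rewrite /= -alE xsectionI in_xsectionX// inE.
  by apply: measurable_xsection_kernel; apply: measurableI => //; exact: measurableX.
pose w := kint (kiter P k) al.
have Ial y : (kernel_prob (kiter P k) y).-integrable setT (EFin \o al).
  by apply: (@integrable_bounded_prob _ _ _ _ _ a) => // z; rewrite al0 ala.
have wE y : (w y)%:E = \int[kiter P k y]_z (al z)%:E.
  rewrite /w /kint /Rintegral fineK//; exact: (integrable_fin_num _ (Ial y)).
have mw : measurable_fun setT w by exact: measurable_kint.
have w0 y : (0 <= w y)%R by rewrite -lee_fin wE; apply: integral_ge0 => z _; rewrite lee_fin.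
have wa y : (w y <= a)%R.
  rewrite -lee_fin wE -[leRHS](integral_prob_cst (kernel_prob (kiter P k) y)).
  apply: ge0_le_integral => //.
  - by move=> z _; rewrite lee_fin.
  - exact/measurable_EFinP.
  - by move=> z _; rewrite lee_fin.
pose phi y := kiter P (k + n) y A.
have mphi : measurable_fun setT phi by exact: measurable_kernel.
have phi0 y : 0 <= phi y by [].
have e1 : t%:E * \int[mu]_(y in xsection H x) phi y <= kiter P (n + (k + n)) x A.
  rewrite kiterD//; apply: minorized_integral => //; first exact: ltW.
  by move=> D mD; exact: HG.
have nullG : {ae mu, forall y, kiter P k y (~` G) = 0}.
  apply: ae_eq0_integral => //; first by apply: measurable_kernel; exact: measurableC.
  by rewrite (kiter_invariant k inv)//; exact: measurableC.
(* For almost every y the law P^k(y, .) is carried by [G], where the lower bound for the last P^n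
   holds. *)
have wphi : {ae mu, forall y, t%:E * (w y)%:E <= phi y}.
  apply: filterS nullG => y ny; rewrite /phi kiterD// wE -ge0_integralZl//; last 3 first.
  - exact/measurable_EFinP.
  - by move=> z _; rewrite lee_fin.
  - by rewrite lee_fin ltW.
  apply: ae_ge0_le_integral => //.
  - by move=> z _; rewrite -EFinM lee_fin mulr_ge0// ltW.
  - by apply: measurable_funeM; exact/measurable_EFinP.
  - by apply: measurable_kernel.
  exists (~` G); split => //; first exact: measurableC.
  move=> z /= nz Gz; apply: nz => _; rewrite -alE; exact: HG.
pose u y := (w y - \int[mu]_z al z)%R.
have mu_ : measurable_fun setT u by exact: measurable_funB.
pose I y := \1_(xsection H x) y : R.
have mI : measurable_fun setT I by exact: measurable_indic.
have I01 y : (0 <= I y <= 1)%R.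
  by rewrite /I indicE; case: (y \in _); rewrite /= ?ler01 ?lexx ?ler01.
(* As [al] is bounded by a = mu A, its L_2 norm is at most a. The indicator of A has norm sqrt a, so
   applying P^k to it directly would leave an error too large for small A; this is why a last P^n
   follows P^k. *)
have sqal : sqint mu al <= (a ^+ 2)%:E.
  rewrite -[leRHS](integral_prob_cst mu); apply: ge0_le_integral => //.
  - by move=> z _; rewrite lee_fin sqr_ge0.
  - exact: measurable_sq.
  - by move=> z _; rewrite lee_fin ler_pXn2r ?nnegrE.
have squ : sqint mu u <= ((del ^+ 2 / 2 * a) ^+ 2)%:E.
  apply: le_trans (gapk mal al0 _) _; first by apply: le_lt_trans sqal (ltry _).
  rewrite (exprMn _ (del ^+ 2 / 2)%R a) [leRHS]EFinM; have /andP[Kk0 Kk1] := Kk.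
  apply: (@le_trans _ _ (((K * rho ^+ k) ^+ 2)%:E * (a ^+ 2)%:E)).
    by rewrite lee_wpmul2l// lee_fin sqr_ge0.
  rewrite lee_wpmul2r ?lee_fin ?sqr_ge0// ler_pXn2r// ?nnegrE//.
  exact: le_trans Kk0 Kk1.
have sqIu : ((\int[mu]_y (I y * u y)) ^+ 2 <= (del ^+ 2 / 2 * a) ^+ 2)%R.
  rewrite -lee_fin; apply: le_trans (sq_Rintegral_le _ (measurable_funM mI mu_)) _.
  apply: le_trans squ; apply: ge0_le_integral => //.
  - by move=> z _; rewrite lee_fin sqr_ge0.
  - by apply: measurable_sq; exact: measurable_funM.
  - exact: measurable_sq.
  - move=> z _; rewrite lee_fin exprMn; have /andP[i0 i1] := I01 z.
    by rewrite -[leRHS]mul1r ler_wpM2r ?sqr_ge0// expr_le1.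
have cIu : (- (del ^+ 2 / 2 * a) <= \int[mu]_y (I y * u y))%R.
  have c0 : (0 <= del ^+ 2 / 2 * a)%R by rewrite mulr_ge0// divr_ge0// sqr_ge0.
  by rewrite -[(_ ^+ 2)%R]real_normK ?num_real// ler_pXn2r ?nnegrE// ler_norml in sqIu;
     case/andP: sqIu.
have IE : \int[mu]_y (I y)%:E = mu (xsection H x) by rewrite integral_indic// setIT.
have II : mu.-integrable setT (EFin \o I).
  exact: (@integrable_bounded_prob _ _ _ _ _ 1).
have IIw : mu.-integrable setT (EFin \o (fun y => I y * w y)%R).
  apply: (@integrable_bounded_prob _ _ _ _ _ a); first exact: measurable_funM.
  move=> y; have /andP[i0 i1] := I01 y; rewrite mulr_ge0//=.
  by rewrite (le_trans _ (wa y))// ler_piMl.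
have Iw : \int[mu]_(y in xsection H x) (w y)%:E = (\int[mu]_y (I y * w y))%:E.
  rewrite integral_mkcond /Rintegral fineK; last exact: integrable_fin_num _ IIw.
  apply: eq_integral => y _; rewrite patchE /I indicE.
  by case: ifP => yH /=; rewrite ?mul1r ?mul0r.
have split_w : (\int[mu]_y (I y * w y) =
   \int[mu]_z al z * \int[mu]_y I y + \int[mu]_y (I y * u y))%R.
  set m := (\int[mu]_z al z)%R.
  have -> : (fun y => I y * u y)%R = (fun y => - m * I y + 0 * I y + I y * w y)%R.
    by apply/funext => y; rewrite /u -/m; ring.
  by rewrite Rintegral_lin3//; ring.
have mean : (del * a <= \int[mu]_z al z)%R.
  rewrite -lee_fin EFinM -muA; apply: le_trans (core_mean mA AB) _.
  rewrite /Rintegral fineK; last first.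
    by apply: integrable_fin_num => //; apply: (@integrable_bounded_prob _ _ _ _ _ a) => // z; rewrite al0 ala.
  by rewrite le_eqVlt; apply/orP; left; apply/eqP; apply: eq_integral => y _; exact: alE.
have Idel : (del <= \int[mu]_y I y)%R.
  by rewrite -lee_fin /Rintegral fineK ?IE// -IE; exact: integrable_fin_num.
(* The mean of [al] times the mass of the section gives at least del^2 a, and the L_2 error costs at
   most half of that. *)
have main : (del ^+ 2 / 2 * a <= \int[mu]_y (I y * w y))%R.
  rewrite split_w.
  have : (del * a * del <= \int[mu]_z al z * \int[mu]_y I y)%R.
    by apply: ler_pM => //; rewrite ?mulr_ge0// ltW.
  move: cIu; nra.
apply: le_trans e1.
apply: (@le_trans _ _ (t%:E * \int[mu]_(y in xsection H x) (t%:E * (w y)%:E))); last first.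
  apply: lee_wpmul2l; first (by rewrite lee_fin ltW); apply: ae_ge0_le_integral => //.
  - by move=> y _; rewrite -EFinM lee_fin mulr_ge0// ltW.
  - by apply: measurable_funeM; apply/measurable_EFinP; exact: measurable_funTS.
  - exact: measurable_funTS.
  - by apply: filterS wphi.
rewrite ge0_integralZl_EFin//; last 3 first.
- by move=> y _; rewrite lee_fin.
- by apply/measurable_EFinP; exact: measurable_funTS.
- exact: ltW.
rewrite Iw muA -!EFinM lee_fin.
rewrite (_ : t ^+ 2 * _ * a = t * (t * (del ^+ 2 / 2 * a)))%R; last by ring.
by rewrite !ler_wpM2l// ltW.
Qed.
End Core.

Lemma integral_sections (H : set (T * T)) : measurable H ->
  \int[mu]_x mu (xsection H x) = \int[mu]_y mu (ysection H y).
Proof.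
move=> mH.
have mf : measurable_fun setT (fun z => (\1_H z)%:E : \bar R).
  by apply/measurable_EFinP; exact: measurable_indic.
have f0 z : 0 <= (\1_H z)%:E :> \bar R by rewrite lee_fin.
transitivity (\int[mu]_x \int[mu]_y (\1_H (x, y))%:E).
  apply: eq_integral => x _; rewrite -(setIT (xsection H x)) -integral_indic//; last first.
    exact: measurable_xsection.
  by apply: eq_integral => y _; rewrite !indicE mem_xsection.
rewrite (fubini_tonelli _ mf f0); apply: eq_integral => y _.
rewrite -(setIT (ysection H y)) -integral_indic//; last exact: measurable_ysection.
by apply: eq_integral => x _; rewrite !indicE mem_ysection.
Qed.

Lemma exists_minorized_set : exists (m : nat) (C B : set T) (eps : R),
  [/\ (1 <= m)%N, measurable C, measurable B & (0 < eps)%R] /\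
  [/\ 0 < mu C, 0 < mu B & forall x A, C x -> measurable A ->
    eps%:E * mu (A `&` B) <= kiter P m x A].
Proof.
have [n [t [H [t0 mH H0 HG]]]] := iter_ac_component inv irr.
have [N [mN N0 HN]] := ae_minorization hcg t0 mH HG.
have mx : measurable_fun setT (fun x => mu (xsection H x)).
  exact: measurable_fun_xsection.
have my : measurable_fun setT (fun x => mu (ysection H x)).
  exact: measurable_fun_ysection.
have [d1 [d10 h1]] : exists del : R, (0 < del)%R /\ 0 < mu [set x | del%:E <= mu (xsection H x)].
  by apply: positive_level => //; rewrite -[X in _ < X](jointE mu (cst_kernel mu)).
have [d2 [d20 h2]] : exists del : R, (0 < del)%R /\ 0 < mu [set x | del%:E <= mu (ysection H x)].
  apply: positive_level => //; rewrite -integral_sections//.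
  by rewrite -[X in _ < X](jointE mu (cst_kernel mu)).
have mL (f : T -> \bar R) (r : R) : measurable_fun setT f -> measurable [set x | r%:E <= f x].
  move=> mf; rewrite (_ : [set _ | _] = setT `&` [set x | r%:E <= f x]); last by rewrite setTI.
  exact: measurable_lee.
pose del := Num.min d1 d2.
have del0 : (0 < del)%R by rewrite lt_min d10.
have [K [rho [rho0 rho1 K0 gapK]]] := kint_gap inv irr gap.
have rho01 : (0 <= rho < 1)%R by rewrite rho0.
(* The goal is K rho^k <= del^2 / 2. Passing to the successor of [k0] also makes n + (k + n)
   positive, as n may be 0. *)
have [k0 hk] := exprn_small rho01 (divr_gt0 (divr_gt0 (exprn_gt0 2 del0) (ltr0Sn R 1)) K0).
pose k := k0.+1.
pose G := ~` N.
have mG : measurable G by exact: measurableC.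
pose B := [set z | del%:E <= mu (ysection H z)].
pose C := G `&` [set x | del%:E <= mu (xsection H x)].
have mB : measurable B by exact: mL.
have mC : measurable C by apply: measurableI => //; exact: mL.
exists (n + (k + n))%N, C, B, (t ^+ 2 * (del ^+ 2 / 2))%R; split.
  by split => //; [by rewrite addnCA|rewrite mulr_gt0// ?divr_gt0// exprn_gt0].
split.
- apply: lt_le_trans h1 _; rewrite -[leRHS]add0e -N0.
  apply: le_trans (measureU2 mu mN mC); apply: le_measure; rewrite ?inE; [exact: mL|exact: measurableU|].
  move=> x /= hx; have [Nx|Nx] := pselect (N x); [by left|right; split => //=].
  by apply: le_trans hx; rewrite lee_fin ge_min lexx.
- apply: lt_le_trans h2 _; apply: le_measure; rewrite ?inE; [exact: mL|exact: mL|].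
  by move=> x /=; apply: le_trans; rewrite lee_fin ge_min lexx orbT.
move=> x A [Gx Hx] mA.
apply: (@le_trans _ _ (kiter P (n + (k + n)) x (A `&` B))); last first.
  by apply: le_measure; rewrite ?inE//; exact: measurableI.
apply: (core_minorization (B := B) t0 mH mG _ _ del0 _ (gapK k)) => //.
- by rewrite /G setCK.
- by move=> y Gy D mD; apply: contrapT => h; apply: Gy; apply: HN => h'; apply: h; exact: h'.
- by rewrite mulr_ge0 ?exprn_ge0// ?(ltW K0)//= mulrC -ler_pdivlMr// ltW// hk// leqnSn.
- exact: measurableI.
Qed.
End SmallSet.

(** * The residual kernel and the Lyapunov function *)

Section SquareIntegrableExtended.
Context d (T : measurableType d) (R : realType) (mu : probability T R).
Implicit Types (f g : T -> \bar R).

(** The functions of the Lyapunov construction must be defined at every point but may be infinite on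
    a null set; square integrability is therefore stated for their [fine] part, next to almost sure
    finiteness. *)
Definition sqf f := [/\ measurable_fun setT f, forall x, 0 <= f x,
  {ae mu, forall x, f x \is a fin_num} & sqint mu (fine \o f) < +oo].

Lemma measurable_finef f : measurable_fun setT f -> measurable_fun setT (fine \o f).
Proof. by move=> mf; apply: (@measurableT_comp _ _ _ _ _ _ (@fine R)). Qed.

Lemma sqf_integral f : sqf f -> \int[mu]_x f x = (\int[mu]_x fine (f x))%:E.
Proof.
move=> [mf f0 ff fi]; rewrite /Rintegral fineK; last first.
  by apply: integrable_fin_num => //; apply: sq_integrable => //; exact: measurable_finef.
apply: ae_eq_integral => //; first by apply/measurable_EFinP; exact: measurable_finef.
by apply: filterS ff => x fx _; rewrite fineK.
Qed.

Lemma sqf_le f g : sqf g -> measurable_fun setT f -> (forall x, 0 <= f x) ->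
  {ae mu, forall x, f x <= g x} -> sqf f /\ sqint mu (fine \o f) <= sqint mu (fine \o g).
Proof.
move=> [mg g0 fg gi] mf f0 fg'.
have ff : {ae mu, forall x, f x \is a fin_num}.
  apply: filterS2 fg fg' => x gx fgx; rewrite ge0_fin_numE//.
  by apply: le_lt_trans fgx _; rewrite -ge0_fin_numE.
have le : sqint mu (fine \o f) <= sqint mu (fine \o g).
  apply: ae_ge0_le_integral => //.
  - by move=> x _; rewrite lee_fin sqr_ge0.
  - by apply: measurable_sq; exact: measurable_finef.
  - by move=> x _; rewrite lee_fin sqr_ge0.
  - by apply: measurable_sq; exact: measurable_finef.
  - apply: filterS3 ff fg fg' => x fx gx fgx _.
    by rewrite lee_fin ler_pXn2r ?nnegrE/= ?fine_ge0// fine_le.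
by split => //; split => //; exact: le_lt_trans le gi.
Qed.

Lemma sqf_EFin (f : T -> R) : measurable_fun setT f -> (forall x, 0 <= f x)%R ->
  sqint mu f < +oo -> sqf (EFin \o f).
Proof.
move=> mf f0 fi; split => //; first exact/measurable_EFinP.
exact: filterE.
Qed.

Section Kernel.
Context (k : R.-pker T ~> T).
Hypothesis inv : invariant_probability k mu.

Lemma sqf_int_kernel f : sqf f ->
  {ae mu, forall x, \int[k x]_y f y = (kint k (fine \o f) x)%:E}.
Proof.
move=> [mf f0 [N [mN N0 HN]] fi].
have mff := measurable_finef mf.
have h1 := ae_sqint inv mff fi.
have h2 : {ae mu, forall x, k x N = 0}.
  apply: ae_eq0_integral => //; first exact: measurable_kernel.
  by rewrite inv.
apply: filterS2 h1 h2 => x h1 h2.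
rewrite /kint /Rintegral fineK; last first.
  by apply: integrable_fin_num => //; exact: (@sq_integrable _ _ _ (kernel_prob k x)).
apply: ae_eq_integral => //; first exact/measurable_EFinP.
exists N; split => // y /= h; apply: HN => h'; apply: h => _; by rewrite fineK.
Qed.

Lemma sqf_kernel f : sqf f -> sqf (fun x => \int[k x]_y f y) /\
  sqint mu (fine \o (fun x => \int[k x]_y f y)) = sqint mu (kint k (fine \o f)).
Proof.
move=> hf; have := sqf_int_kernel hf; case: (hf) => mf f0 ff fi hk.
have mff := measurable_finef mf.
have mk : measurable_fun setT (fun x => \int[k x]_y f y) by exact: measurable_int_kernel.
have e : sqint mu (fine \o (fun x => \int[k x]_y f y)) = sqint mu (kint k (fine \o f)).
  apply: ae_eq_integral => //.
  - by apply: measurable_sq; exact: measurable_finef.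
  - by apply: measurable_sq; exact: measurable_kint.
  - by apply: filterS hk => x h _; rewrite /= h.
split; last exact: e.
split; first exact: mk.
- by move=> x; exact: integral_ge0.
- by apply: filterS hk => x ->.
- by rewrite e; apply: le_lt_trans fi; exact: sqint_kint.
Qed.
End Kernel.
End SquareIntegrableExtended.

(** Cauchy-Schwarz, from the nonnegative integral of (f - (Y / c) w)^2 with Y the integral of f w.
    Dividing by the bound c rather than by the second moment of w avoids the case where the latter
    is 0. *)
Lemma sq_Rintegral_mul_le d (T : measurableType d) (R : realType) (m : probability T R)
    (f w : T -> R) (c : R) :
  measurable_fun setT f -> measurable_fun setT w -> sqint m f < +oo -> (0 < c)%R ->
  sqint m w <= c%:E -> ((\int[m]_x (f x * w x)) ^+ 2)%:E <= c%:E * sqint m f.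
Proof.
move=> mf mw fi c0 wc.
have wi : sqint m w < +oo by apply: le_lt_trans wc (ltry _).
have If2 : m.-integrable setT (EFin \o (fun x => f x ^+ 2)%R).
  by have := sq_mul_integrable mf mf fi fi; congr (integrable _ _ _); apply/funext => x /=; rewrite expr2.
have Iw2 : m.-integrable setT (EFin \o (fun x => w x ^+ 2)%R).
  by have := sq_mul_integrable mw mw wi wi; congr (integrable _ _ _); apply/funext => x /=; rewrite expr2.
have Ifw : m.-integrable setT (EFin \o (fun x => f x * w x)%R).
  exact: (sq_mul_integrable mf mw fi wi).
set Y := (\int[m]_x (f x * w x))%R.
have XE : sqint m f = (\int[m]_x (f x ^+ 2))%:E.
  by rewrite /Rintegral fineK//; exact: (integrable_fin_num _ If2).
have WE : sqint m w = (\int[m]_x (w x ^+ 2))%:E.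
  by rewrite /Rintegral fineK//; exact: (integrable_fin_num _ Iw2).
rewrite XE -EFinM lee_fin; rewrite WE lee_fin in wc.
set X := (\int[m]_x (f x ^+ 2))%R in wc *; set W := (\int[m]_x (w x ^+ 2))%R in wc *.
have : (0 <= \int[m]_x ((- (2 * (Y / c))) * (f x * w x) + (Y / c) ^+ 2 * w x ^+ 2 + f x ^+ 2))%R.
  apply: Rintegral_ge0 => x _.
  rewrite (_ : _ + _ = (f x - (Y / c) * w x) ^+ 2)%R ?sqr_ge0//; ring.
rewrite Rintegral_lin3// -/X -/Y -/W => h.
have e : (- (2 * (Y / c)) * Y + (Y / c) ^+ 2 * W + X <= X - Y ^+ 2 / c)%R.
  apply: (@le_trans _ _ (- (2 * (Y / c)) * Y + (Y / c) ^+ 2 * c + X)%R).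
    by rewrite lerD2r lerD2l ler_wpM2l// sqr_ge0.
  rewrite le_eqVlt; apply/orP; left; apply/eqP; field; exact: lt0r_neq0.
by have := le_trans h e; rewrite subr_ge0 ler_pdivrMr// mulrC.
Qed.

Section Residual.
Context d (T : measurableType d) (R : realType) (mu : probability T R).
Context (P : R.-pker T ~> T).
Hypothesis inv : invariant_probability P mu.
Context (m : nat) (C B : set T) (eps : R).
Hypotheses (mC : measurable C) (mB : measurable B) (eps0 : (0 < eps)%R).
Hypothesis minor : forall x A, C x -> measurable A ->
  eps%:E * mu (A `&` B) <= kiter P m x A.
Local Notation k := (kiter P m).

Let invk : invariant_probability k mu := kiter_invariant m inv.

(** The operator Q of the overview. The subtracted term is finite for [sqf] functions, so that no
    difference of infinities arises. *)
Definition residual (f : T -> \bar R) (x : T) : \bar R :=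
  \int[k x]_y f y - (eps * \1_C x)%:E * \int[mu]_(y in B) f y.

Lemma int_set_fin f : sqf mu f -> \int[mu]_(y in B) f y \is a fin_num.
Proof.
move=> hf; case: (hf) => mf f0 _ _.
rewrite ge0_fin_numE; last exact: integral_ge0.
apply: (@le_lt_trans _ _ (\int[mu]_y f y)).
  by apply: ge0_subset_integral.
by rewrite (sqf_integral hf) ltry.
Qed.

Lemma eps1_ge0 x : (0 <= eps * \1_C x)%R.
Proof. by rewrite mulr_ge0// ltW. Qed.

Lemma residual_add f x : sqf mu f ->
  residual f x + (eps * \1_C x)%:E * \int[mu]_(y in B) f y = \int[k x]_y f y.
Proof. by move=> hf; rewrite subeK// fin_numM// int_set_fin. Qed.

Lemma residual_ge0 f x : sqf mu f -> 0 <= residual f x.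
Proof.
move=> hf; case: (hf) => mf f0 _ _.
rewrite /residual sube_ge0; last by apply/orP; left; rewrite fin_numM// int_set_fin.
rewrite indicE; have [xC|xC] := boolP (x \in C); last first.
  by rewrite mulr0 mul0e integral_ge0.
rewrite mulr1; apply: minorized_integral => //; first exact: ltW.
by move=> A mA; apply: minor => //; exact: set_mem.
Qed.

Lemma residual_le f x : sqf mu f -> residual f x <= \int[k x]_y f y.
Proof.
move=> hf; case: (hf) => mf f0 _ _.
by rewrite leeBlDr ?fin_numM ?int_set_fin// leeDl// mule_ge0 ?lee_fin ?eps1_ge0// integral_ge0.
Qed.

Lemma measurable_residual f : sqf mu f -> measurable_fun setT (residual f).
Proof.
move=> hf; case: (hf) => mf f0 _ _.
apply: emeasurable_funB; first exact: measurable_int_kernel.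
apply: emeasurable_funM; last exact: measurable_cst.
apply/measurable_EFinP; apply: measurable_funM => //; exact: measurable_indic.
Qed.

Lemma sqf_residual f : sqf mu f -> sqf mu (residual f) /\
  sqint mu (fine \o residual f) <= sqint mu (fine \o f).
Proof.
move=> hf; have [hk ek] := sqf_kernel invk hf.
have [|h1 h2] := sqf_le hk (measurable_residual hf) (fun x => residual_ge0 x hf).
  by apply: filterE => x; exact: residual_le.
split; first exact: h1.
apply: le_trans h2 _; rewrite ek; apply: (sqint_kint invk).
by case: hf => mf _ _ _; exact: measurable_finef.
Qed.

(** By invariance P^m keeps the mean, and the removed part has mean eps mu(C) times the integral of
    f over [B]. *)
Lemma residual_mean f : sqf mu f ->
  (\int[mu]_x fine (residual f x) =
   \int[mu]_x (fine (f x) * (1 - eps * fine (mu C) * \1_B x)))%R.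
Proof.
move=> hf; have [hr _] := sqf_residual hf; case: (hf) => mf f0 ff fi.
have mF := measurable_finef mf.
have IF : mu.-integrable setT (EFin \o (fine \o f)) by exact: sq_integrable.
pose D x : R := \1_B x.
have mD : measurable_fun setT D by exact: measurable_indic.
have D01 x : (0 <= D x <= 1)%R.
  by rewrite /D indicE; case: (x \in _); rewrite /= ?ler01 ?lexx ?ler01.
have sD : sqint mu D < +oo.
  apply: (@le_lt_trans _ _ (\int[mu]_x 1)); last by rewrite integral_prob_cst ltry.
  apply: ge0_le_integral => //.
  - by move=> x _; rewrite lee_fin sqr_ge0.
  - exact: measurable_sq.
  - by move=> x _; rewrite lee_fin; have /andP[a b] := D01 x; rewrite expr_le1.
have IFD : mu.-integrable setT (EFin \o (fun x => fine (f x) * D x)%R).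
  exact: (@sq_mul_integrable _ _ _ mu (fine \o f) D).
have bE : \int[mu]_(y in B) f y = (\int[mu]_x (fine (f x) * D x))%:E.
  rewrite /Rintegral fineK; last exact: integrable_fin_num _ IFD.
  rewrite [LHS]integral_mkcond; apply: ae_eq_integral => //.
  - exact: (measurable_restrictT f mB).1 (measurable_funTS mf).
  - by apply/measurable_EFinP; exact: measurable_funM.
  - apply: filterS ff => x fx _; rewrite patchE /D indicE.
    by case: ifP => xB /=; rewrite ?mulr1 ?mulr0 ?fineK.
apply/EFin_inj; rewrite -(sqf_integral hr).
have e1 : \int[mu]_x residual f x + (eps * fine (mu C))%:E * \int[mu]_(y in B) f y =
    \int[mu]_x f x.
  rewrite -(integral_invariant invk f0 mf).
  transitivity (\int[mu]_x (residual f x + (eps * \1_C x)%:E * \int[mu]_(y in B) f y)).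
    rewrite [RHS](@ge0_integralD _ _ _ mu setT measurableT (residual f)
      (fun x => (eps * \1_C x)%:E * \int[mu]_(y in B) f y)).
    - congr (_ + _); rewrite ge0_integralZr//; last 3 first.
      + by apply/measurable_EFinP; apply: measurable_funM => //; exact: measurable_indic.
      + by move=> x _; rewrite lee_fin eps1_ge0.
      + by rewrite integral_ge0.
      congr (_ * _); under eq_integral do rewrite EFinM.
      rewrite ge0_integralZl_EFin//; last 2 first.
      + by apply/measurable_EFinP; exact: measurable_indic.
      + exact: ltW.
      by rewrite integral_indic// setIT EFinM fineK// fin_prob.
    - by move=> x _; exact: residual_ge0.
    - exact: measurable_residual.
    - by move=> x _; rewrite mule_ge0 ?lee_fin ?eps1_ge0// integral_ge0.
    - apply: emeasurable_funM; last exact: measurable_cst.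
      by apply/measurable_EFinP; apply: measurable_funM => //; exact: measurable_indic.
  by apply: eq_integral => x _; exact: residual_add.
move: e1; rewrite (sqf_integral hr) (sqf_integral hf) bE -EFinM -EFinD => -[e]; congr EFin.
rewrite (_ : (fun x => fine (f x) * (1 - eps * fine (mu C) * \1_B x))%R =
  (fun x => (- (eps * fine (mu C))) * (fine (f x) * D x) + 0 * D x + fine (f x))%R); last first.
  by apply/funext => x; rewrite /D; ring.
rewrite Rintegral_lin3//; last by apply: sq_integrable.
by rewrite -e; ring.
Qed.
End Residual.

(** Bernoulli's inequality for q = 1 - (1 - z) / (2 (L + 1)) gives q^L >= (1 + z) / 2. The successor
    of L avoids a division by 0. *)
Lemma bernoulli_root (R : realType) (z : R) (L : nat) : (0 <= z < 1)%R ->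
  exists q : R, (0 < q < 1)%R /\ (z <= q ^+ L)%R.
Proof.
move=> /andP[z0 z1].
have bern (x : R) n : (0 <= x <= 1)%R -> (1 - n%:R * x <= (1 - x) ^+ n)%R.
  move=> /andP[x0 x1]; elim: n => [|n IH]; first by rewrite mul0r subr0 expr0.
  rewrite exprS; apply: (@le_trans _ _ ((1 - x) * (1 - n%:R * x))%R); last first.
    by rewrite ler_wpM2l// subr_ge0.
  rewrite -natr1 -subr_ge0 (_ : _ - _ = n%:R * x ^+ 2)%R ?mulr_ge0 ?sqr_ge0//; ring.
have L0 : (0 < L.+1%:R :> R)%R by rewrite ltr0n.
pose x := ((1 - z) / 2 / L.+1%:R)%R.
have x0 : (0 < x)%R by rewrite !divr_gt0// subr_gt0.
have L1 : (1 <= L.+1%:R :> R)%R by rewrite ler1n.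
have x1 : (x < 1)%R.
  rewrite ltr_pdivrMr// mul1r; apply: lt_le_trans L1.
  by rewrite ltr_pdivrMr// mul1r; lra.
exists (1 - x)%R; split; first by apply/andP; split; lra.
apply: le_trans (bern x L _); last by apply/andP; split; lra.
have h : (L%:R * x <= L.+1%:R * x)%R by rewrite ler_wpM2r ?ler_nat// ltW.
have e : (L.+1%:R * x = (1 - z) / 2)%R by rewrite /x mulrC divfK// lt0r_neq0.
by rewrite e in h; lra.
Qed.

(** Shifting the index by N gives S <= S_N + lam S for the partial sums. *)
Lemma partial_sums_bounded (R : realType) (a : nat -> R) (N : nat) (lam : R) :
  (forall j, 0 <= a j)%R -> (0 <= lam < 1)%R -> (forall j, a (j + N)%N <= lam * a j)%R ->
  forall n, (\sum_(0 <= j < n) a j <= (\sum_(0 <= j < N) a j) / (1 - lam))%R.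
Proof.
move=> a0 /andP[l0 l1] ha n.
have mono p : (\sum_(0 <= j < p) a j <= \sum_(0 <= j < p + N) a j)%R.
  rewrite [leRHS](@big_cat_nat _ _ _ p)//= ?leq_addr// lerDl.
  by apply: sumr_ge0 => j _.
apply: le_trans (mono n) _.
have h : (\sum_(0 <= j < n + N) a j <=
  \sum_(0 <= j < N) a j + lam * \sum_(0 <= j < n + N) a j)%R.
  rewrite [leLHS](@big_cat_nat _ _ _ N)//= ?leq_addl// lerD2l.
  rewrite -{1}[N]add0n big_addn addnK.
  apply: (@le_trans _ _ (lam * \sum_(0 <= j < n) a j)%R); last by rewrite ler_wpM2l.
  by rewrite mulr_sumr; apply: ler_sum => j _.
rewrite ler_pdivlMr ?subr_gt0// mulrBr mulr1 [(_ * lam)%R]mulrC; lra.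
Qed.

(** Pythagoras: the kernel preserves the mean, so the fluctuation is orthogonal to the constants. *)
Lemma sqint_kint_mean d (T : measurableType d) (R : realType) (mu : probability T R)
    (k : R.-pker T ~> T) (F : T -> R) : invariant_probability k mu ->
  measurable_fun setT F -> sqint mu F < +oo ->
  sqint mu (kint k F) =
    sqint mu (fun x => kint k F x - \int[mu]_y F y)%R + ((\int[mu]_y F y) ^+ 2)%:E.
Proof.
move=> inv mF fi.
have sl : sqint mu (kint k F) < +oo by apply: le_lt_trans (sqint_kint inv mF) fi.
rewrite (sqintB_cst _ (measurable_kint k mF) sl) (Rintegral_kint inv mF fi).
set M := (\int[mu]_x F x)%R.
rewrite (_ : (2 * M * M - M ^+ 2)%R = (M ^+ 2)%R) ?subeK//; ring.
Qed.

Section Decay.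
Context d (T : measurableType d) (R : realType) (mu : probability T R).
Context (P : R.-pker T ~> T).
Hypothesis inv : invariant_probability P mu.
Hypothesis irr : psi_irreducible_aperiodic P.
Hypothesis gap : L2_spectral_gap mu P.
Context (m : nat) (C B : set T) (eps : R).
Hypotheses (m1 : (1 <= m)%N) (mC : measurable C) (mB : measurable B).
Hypotheses (eps0 : (0 < eps)%R) (eps1 : (eps <= 1 / 2)%R).
Hypotheses (C0 : 0 < mu C) (B0 : 0 < mu B).
Hypothesis minor : forall x A, C x -> measurable A ->
  eps%:E * mu (A `&` B) <= kiter P m x A.
Local Notation res := (residual mu P m C B eps).
Local Notation nsq f := (sqint mu (fine \o f)).

Lemma sqf_iter_residual n f : sqf mu f -> sqf mu (iter n res f).
Proof.
by move=> hf; elim: n => [//|n IH]; exact: (sqf_residual inv mC mB eps0 minor IH).1.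
Qed.

Lemma iter_residual_le n f x : sqf mu f ->
  iter n res f x <= \int[kiter P (m * n) x]_y f y.
Proof.
move=> hf; case: (hf) => mf f0 _ _; elim: n x => [|n IH] x.
  by rewrite muln0 integral_kiter0.
have hi := sqf_iter_residual n hf.
apply: le_trans (residual_le P m C mB eps0 x hi) _.
rewrite mulnS integral_kiterD//; apply: ge0_le_integral => //.
- by case: hi.
- by case: hi.
- exact: measurable_int_kernel.
Qed.

Let c : R := (eps * fine (mu C))%R.
Let b : R := fine (mu B).
(** The second moment of the weight in [residual_mean], which is 1 - c on [B] and 1 elsewhere. The
    cap eps <= 1/2 keeps it strictly between 0 and 1. *)
Let kap : R := (1 - (2 * c - c ^+ 2) * b)%R.

Let muBE : mu B = b%:E. Proof. by rewrite fineK// fin_prob. Qed.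
Let b0 : (0 < b)%R. Proof. by rewrite -lte_fin -muBE. Qed.
Let b1 : (b <= 1)%R. Proof. by rewrite -lee_fin -muBE le1_prob. Qed.
Let muCE : mu C = (fine (mu C))%:E. Proof. by rewrite fineK// fin_prob. Qed.
Let c01 : (0 < c <= 1 / 2)%R.
Proof.
have h0 : (0 < fine (mu C))%R by rewrite -lte_fin -muCE.
have h1 : (fine (mu C) <= 1)%R by rewrite -lee_fin -muCE le1_prob.
rewrite mulr_gt0//= (le_trans _ eps1)// ler_piMr// ltW//.
Qed.

Let kap01 : (0 < kap < 1)%R.
Proof.
have /andP[c0 c1] := c01.
have h : (0 < (2 * c - c ^+ 2) * b)%R by rewrite mulr_gt0// expr2; nra.
have h' : ((2 * c - c ^+ 2) * b <= 2 * c - c ^+ 2)%R by rewrite ler_piMr// expr2; nra.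
apply/andP; split; rewrite /kap; last by lra.
have : (0 < (1 - c) ^+ 2)%R by rewrite exprn_gt0//; lra.
rewrite sqrrB expr1n mul1r; lra.
Qed.

Lemma sqint_weight : sqint mu (fun x => 1 - c * \1_B x)%R <= kap%:E.
Proof.
rewrite /sqint (_ : (fun x => _) = (fun x => (1 + (- (2 * c - c ^+ 2) * \1_B x))%:E)); last first.
  apply/funext => x; congr EFin; rewrite indicE; case: (x \in B) => /=; ring.
have IB : mu.-integrable setT (EFin \o (\1_B : T -> R)).
  apply: (@integrable_bounded_prob _ _ _ _ _ 1); first exact: measurable_indic.
  by move=> x; rewrite indicE; case: (x \in _); rewrite /= ?ler01 ?lexx ?ler01.
under eq_integral do rewrite EFinD EFinM.
rewrite integralD//; last 2 first.
- exact: finite_measure_integrable_cst.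
- exact: (integrableZl measurableT (- (2 * c - c ^+ 2)) IB).
rewrite integral_prob_cst (integralZl measurableT IB).
rewrite integral_indic// setIT.
apply: (@le_trans _ _ (1 + (- (2 * c - c ^+ 2))%:E * b%:E)); first by rewrite -muBE lexx.
by rewrite -EFinM -EFinD lee_fin /kap mulNr.
Qed.

(* P^(m n) sends [res f] to its mean up to a small L_2 error, and by
   Cauchy-Schwarz that mean loses a fixed factor against the norm of [f]. *)
Lemma residual_decay : exists (N : nat) (kap' : R), (0 < kap' < 1)%R /\
  forall f, sqf mu f -> nsq (iter N res f) <= kap'%:E * nsq f.
Proof.
have /andP[k0 k1] := kap01.
have [K [rho [rho0 rho1 K0 gapK]]] := kint_gap inv irr gap.
(* Half of the room below 1: the fluctuation may use eta, the mean uses kap, and eta + kap = (1 +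
   kap) / 2 < 1. *)
pose eta : R := ((1 - kap) / 2)%R.
have etaE : (eta + kap = (1 + kap) / 2)%R by rewrite /eta; lra.
have eta1 : (eta <= 1)%R by rewrite /eta; lra.
have eta0 : (0 < eta)%R by rewrite /eta; lra.
have rho01 : (0 <= rho < 1)%R by rewrite rho0.
have [n hn] := exprn_small rho01 (divr_gt0 eta0 K0).
have Ke : (0 <= K * rho ^+ (m * n) <= eta)%R.
  rewrite mulr_ge0 ?exprn_ge0// ?(ltW K0)//= mulrC -ler_pdivlMr// ltW// hn//.
  by rewrite -{1}[n]mul1n leq_mul2r m1 orbT.
(* One application of [res] shrinks the mean; the other n are dominated by P^(m n), which damps the
   fluctuation. *)
exists n.+1, ((1 + kap) / 2)%R; split; first by apply/andP; split; lra.
move=> f hf; have [hr hle] := sqf_residual inv mC mB eps0 minor hf.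
rewrite iterSr; set f1 := res f in hr hle *.
case: (hf) => mf f0 _ fi; case: (hr) => mf1 f10 _ fi1.
have mF1 := measurable_finef mf1.
have invl := kiter_invariant (m * n) inv.
set l := kiter P (m * n) in invl *.
have [hk ek] := sqf_kernel invl hr.
have hi := sqf_iter_residual n hr; case: (hi) => mi i0 _ _.
have [|_ h1] := sqf_le hk mi i0.
  by apply: filterE => x; exact: iter_residual_le.
apply: le_trans h1 _; rewrite ek.
set F := fine \o f1 in mF1 fi1 *.
set M := (\int[mu]_x F x)%R.
rewrite (sqint_kint_mean invl mF1 fi1) -/M.
have hM2 : (M ^+ 2)%:E <= kap%:E * nsq f.
  rewrite /M (residual_mean inv mC mB eps0 minor hf).
  apply: sq_Rintegral_mul_le => //; first exact: measurable_finef.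
    apply: measurable_funB => //; apply: measurable_funM => //; exact: measurable_indic.
  exact: sqint_weight.
have hF : sqint mu (fun x => kint l F x - M)%R <= eta%:E * nsq f.
  apply: le_trans (gapK (m * n)%N F mF1 _ fi1) _; first by move=> x; exact: fine_ge0.
  apply: le_trans (lee_wpmul2l _ hle) _; first by rewrite lee_fin sqr_ge0.
  apply: lee_wpmul2r; first exact: sqint_ge0.
  have /andP[Ke0 Ke1] := Ke; rewrite lee_fin.
  apply: (@le_trans _ _ (eta ^+ 2)%R); first by rewrite ler_pXn2r// ?nnegrE// ltW.
  by rewrite expr2 ler_piMr// ltW.
apply: le_trans (leeD hF hM2) _.
by rewrite -ge0_muleDl ?lee_fin ?(ltW eta0) ?(ltW k0)// -EFinD etaE.
Qed.

(** By Jensen the means are bounded by the norms [Y], which lose a factor sqrt kap' every N steps.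
    The ratio of the series is written q^-m in view of the m-th root needed to pass from P^m to
    P. *)
Lemma residual_summable f : sqf mu f -> exists q S : R, [/\ (0 < q < 1)%R &
  forall n, (\sum_(0 <= j < n) ((q ^+ m)^-1) ^+ j *
    \int[mu]_x fine (iter j res f x) <= S)%R].
Proof.
move=> hf; have [N [kap' [/andP[k0 k1] dec]]] := residual_decay.
pose X j := fine (nsq (iter j res f)).
have hs j := sqf_iter_residual j hf.
have XE j : nsq (iter j res f) = (X j)%:E.
  rewrite fineK// ge0_fin_numE; first by case: (hs j).
  exact: sqint_ge0.
have X0 j : (0 <= X j)%R by rewrite -lee_fin -XE sqint_ge0.
pose Y j := Num.sqrt (X j).
pose sk := Num.sqrt kap'.
have sk0 : (0 < sk)%R by rewrite sqrtr_gt0.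
have sk1 : (sk < 1)%R by rewrite -[ltRHS]sqrtr1 ltr_sqrt.
have YN j : (Y (j + N)%N <= sk * Y j)%R.
  rewrite /Y /sk -sqrtrM ?(ltW k0)// ler_sqrt ?mulr_ge0 ?(ltW k0)//.
  rewrite -lee_fin -XE EFinM -XE addnC iterD; exact: dec.
have MY j : (\int[mu]_x fine (iter j res f x) <= Y j)%R.
  apply: le_trans (ler_norm _) _; rewrite -sqrtr_sqr ler_sqrt//.
  rewrite -lee_fin -XE; apply: sq_Rintegral_le.
  by apply: measurable_finef; case: (hs j).
(* Since q^(m N) is at least (1 + sk) / 2 > sk, the growth q^-(m N) over N steps is beaten by the
   factor [sk]. *)
have [|q [/andP[q0 q1] hq]] := @bernoulli_root R ((1 + sk) / 2) (m * N).
  by apply/andP; split; lra.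
pose r := ((q ^+ m)^-1)%R.
have r0 : (0 < r)%R by rewrite invr_gt0 exprn_gt0.
pose a j := (r ^+ j * Y j)%R.
pose lam := (sk / ((1 + sk) / 2))%R.
have a0 j : (0 <= a j)%R by rewrite mulr_ge0 ?sqrtr_ge0// exprn_ge0// ltW.
have lam01 : (0 <= lam < 1)%R.
  by rewrite divr_ge0 ?ltr_pdivrMr//=; lra.
have aN j : (a (j + N)%N <= lam * a j)%R.
  rewrite /a exprD.
  have rN : (r ^+ N <= ((1 + sk) / 2)^-1)%R.
    rewrite /r exprVn -exprM lef_pV2 ?posrE ?exprn_gt0//; lra.
  apply: (@le_trans _ _ (r ^+ j * ((1 + sk) / 2)^-1 * (sk * Y j))%R).
    apply: ler_pM => //; rewrite ?mulr_ge0 ?exprn_ge0 ?sqrtr_ge0 ?(ltW r0)//.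
    by rewrite ler_wpM2l// exprn_ge0// ltW.
  by rewrite le_eqVlt; apply/orP; left; apply/eqP; rewrite /lam; ring.
exists q, ((\sum_(0 <= j < N) a j) / (1 - lam))%R; split; first by rewrite q0.
move=> n; apply: le_trans (partial_sums_bounded a0 lam01 aN n).
by apply: ler_sum => j _; rewrite ler_wpM2l// exprn_ge0// ltW.
Qed.
End Decay.

(** * From a drift condition for P^m to one for P *)

Section RootDrift.
Context d (T : measurableType d) (R : realType) (P : R.-pker T ~> T).
Context (m : nat) (W : T -> \bar R) (q : R).
Hypotheses (mW : measurable_fun setT W) (W0 : forall x, 0 <= W x).
Hypothesis q0 : (0 < q)%R.

Definition root_lyapunov (x : T) : \bar R :=
  \sum_(0 <= i < m) ((q^-1) ^+ i)%:E * \int[kiter P i x]_y W y.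

Let p0 i : (0 <= q^-1 ^+ i)%R.
Proof. by rewrite exprn_ge0// invr_ge0 ltW. Qed.

Let A0 i x : 0 <= \int[kiter P i x]_y W y.
Proof. exact: integral_ge0. Qed.

Let t0 i x : 0 <= ((q^-1) ^+ i)%:E * \int[kiter P i x]_y W y.
Proof. by rewrite mule_ge0 ?lee_fin. Qed.

Let mA i : measurable_fun setT (fun x => \int[kiter P i x]_y W y).
Proof. exact: measurable_int_kernel. Qed.

Let mt i : measurable_fun setT (fun x => ((q^-1) ^+ i)%:E * \int[kiter P i x]_y W y).
Proof. by apply: measurable_funeM. Qed.

Lemma measurable_root_lyapunov : measurable_fun setT root_lyapunov.
Proof. exact: emeasurable_sum. Qed.

Lemma root_lyapunov_ge x : (0 < m)%N -> W x <= root_lyapunov x.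
Proof.
move=> m0; rewrite /root_lyapunov -(prednK m0) big_nat_recl// expr0 mul1e integral_kiter0//.
by rewrite leeDl// sume_ge0.
Qed.

(** Under P the i-th term becomes q times the next one. The last term, by the drift of P^m, is at
    most q W, that is q times the term of index 0, plus a multiple of the indicator of C. *)
Lemma root_lyapunov_drift (C : set T) (b : R) : (0 < m)%N -> (0 <= b)%R ->
  (forall x, \int[kiter P m x]_y W y <= (q ^+ m)%:E * W x + (b * \1_C x)%:E) ->
  forall x, \int[P x]_y root_lyapunov y <=
    q%:E * root_lyapunov x + (q^-1 ^+ m.-1 * b * \1_C x)%:E.
Proof.
move=> m0 b0 drift x; rewrite /root_lyapunov ge0_integral_sum//.
have e i : \int[P x]_y (((q^-1) ^+ i)%:E * \int[kiter P i y]_z W z) =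
    ((q^-1) ^+ i)%:E * \int[kiter P i.+1 x]_y W y.
  by rewrite ge0_integralZl//; rewrite ?lee_fin// integral_kiterS.
under eq_bigr do rewrite e.
have := drift x; rewrite -(prednK m0) succnK; set m' := m.-1 => hd.
rewrite big_nat_recr// [X in _ <= _ * X + _]big_nat_recl//= [X in _ <= X + _]ge0_muleDr ?sume_ge0//.
rewrite expr0 mul1e integral_kiter0// ge0_sume_distrr//.
rewrite [leRHS]addeC addeA [leRHS]addeC; apply: leeD.
  rewrite le_eqVlt; apply/orP; left; apply/eqP; apply: eq_bigr => i _.
  by rewrite muleA -EFinM exprS mulrA divff ?mul1r// lt0r_neq0.
apply: le_trans (lee_wpmul2l _ hd) _; first by rewrite lee_fin.
rewrite ge0_muleDr ?lee_fin ?mulr_ge0//; last first.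
  by rewrite mule_ge0// lee_fin exprn_ge0// ltW.
rewrite muleA -!EFinM addeC mulrA exprSr [(q ^+ m' * q)%R]mulrC.
rewrite (_ : q^-1 ^+ m' * (q * q ^+ m') = q)%R//.
by rewrite mulrCA -exprMn mulVf ?expr1n ?mulr1// lt0r_neq0.
Qed.

Lemma integral_root_lyapunov (mu : probability T R) : invariant_probability P mu ->
  \int[mu]_x W x < +oo -> \int[mu]_x root_lyapunov x < +oo.
Proof.
move=> inv Wi; rewrite /root_lyapunov ge0_integral_sum//.
apply: lte_sum_pinfty => i _; rewrite ge0_integralZl ?lee_fin//.
rewrite (integral_invariant (kiter_invariant i inv))//.
by rewrite lte_mul_pinfty// lee_fin.
Qed.
End RootDrift.

(** The probability is [mu] conditioned on [B], with constant eps mu(B). *)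
Lemma small_set_of_minorization d (T : measurableType d) (R : realType)
    (mu : probability T R) (P : R.-pker T ~> T) (m : nat) (C B : set T) (eps : R) :
  (1 <= m)%N -> measurable C -> measurable B -> (0 < eps)%R -> 0 < mu B ->
  (forall x A, C x -> measurable A -> eps%:E * mu (A `&` B) <= kiter P m x A) ->
  small_set P C.
Proof.
move=> m1 mC mB eps0 B0 minor; split => //.
have bE : mu B = (fine (mu B))%:E by rewrite fineK// fin_prob.
have b0 : (0 < fine (mu B))%R by rewrite -lte_fin -bE.
pose nu := mnormalize (mrestr mu mB) mu : probability T R.
have nuE A : nu A = mu (A `&` B) * ((fine (mu B))^-1)%:E.
  have e : (mrestr mu mB : {measure set T -> \bar R}) setT = (fine (mu B))%:E.
    by transitivity (mu (setT `&` B)) => //; rewrite setTI.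
  by rewrite /nu /= /mnormalize e eqe gt_eqF.
exists m, (eps * fine (mu B))%R, nu; split => //; first by rewrite mulr_gt0.
move=> x A mA; rewrite -kiterE nuE indicE.
have [xC|xC] := boolP (x \in C); last by rewrite mule0 mul0e.
rewrite mule1 [mu _ * _]muleC muleA -EFinM mulfK ?lt0r_neq0//.
by apply: minor => //; exact: set_mem.
Qed.

Section ResidualLyapunov.
Context d (T : measurableType d) (R : realType) (mu : probability T R).
Context (P : R.-pker T ~> T).
Hypothesis inv : invariant_probability P mu.
Hypothesis irr : psi_irreducible_aperiodic P.
Hypothesis gap : L2_spectral_gap mu P.
Context (m : nat) (C B : set T) (eps : R).
Hypotheses (m1 : (1 <= m)%N) (mC : measurable C) (mB : measurable B).
Hypotheses (eps0 : (0 < eps)%R) (eps1 : (eps <= 1 / 2)%R).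
Hypotheses (C0 : 0 < mu C) (B0 : 0 < mu B).
Hypothesis minor : forall x A, C x -> measurable A ->
  eps%:E * mu (A `&` B) <= kiter P m x A.
Local Notation res := (residual mu P m C B eps).

(** As P^m is Q plus eps 1_C times integration over [B], applying it to the series of r^j Q^j f
    shifts the index by one, at the price r^-1 = q^m, and adds eps 1_C times the sum of the
    r^j-weighted integrals over [B], which the bound S controls. *)
Lemma residual_lyapunov f : sqf mu f -> exists (W : T -> \bar R) (q b : R),
  [/\ (0 < q < 1)%R, (0 <= b)%R, measurable_fun setT W & forall x, f x <= W x] /\
  (\int[mu]_x W x < +oo /\ forall x,
    \int[kiter P m x]_y W y <= (q ^+ m)%:E * W x + (b * \1_C x)%:E).
Proof.
move=> hf.
have [q [S [/andP[q0 q1] hS]]] := residual_summable inv irr gap m1 mC mB eps0 eps1 C0 B0 minor hf.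
pose r := ((q ^+ m)^-1)%R; pose fj j := iter j res f.
have r0 : (0 < r)%R by rewrite invr_gt0 exprn_gt0.
have rj0 j : (0 <= r ^+ j)%R by rewrite exprn_ge0// ltW.
have hs j : sqf mu (fj j) by exact: (sqf_iter_residual inv mC mB eps0 minor).
have mf j : measurable_fun setT (fj j) by case: (hs j).
have f0 j x : 0 <= fj j x by case: (hs j).
have mt j : measurable_fun setT (fun x => (r ^+ j)%:E * fj j x) by exact: measurable_funeM.
have t0 j x : 0 <= (r ^+ j)%:E * fj j x by rewrite mule_ge0 ?lee_fin.
pose W x := \sum_(0 <= j <oo) ((r ^+ j)%:E * fj j x).
pose M j := (\int[mu]_x fine (fj j x))%R.
have IM j : \int[mu]_x fj j x = (M j)%:E by exact: sqf_integral.
have rM0 j : (0 <= r ^+ j * M j)%R.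
  by rewrite mulr_ge0// -lee_fin -IM integral_ge0.
have SM : \sum_(0 <= j <oo) (r ^+ j * M j)%:E <= S%:E.
  apply: lime_le; first by apply: is_cvg_nneseries => j _ _; rewrite lee_fin.
  by apply: nearW => n; rewrite sumEFin lee_fin; exact: hS.
pose be j := fine (\int[mu]_(y in B) fj j y).
have beE j : \int[mu]_(y in B) fj j y = (be j)%:E by rewrite fineK// int_set_fin.
have be0 j : (0 <= be j)%R by rewrite fine_ge0// integral_ge0.
have beM j : (be j <= M j)%R.
  by rewrite -lee_fin -beE -IM; exact: ge0_subset_integral.
have Sb : \sum_(0 <= j <oo) (r ^+ j * be j)%:E <= S%:E.
  apply: le_trans SM; apply: lee_nneseries => [j _ _|j _]; rewrite lee_fin.
    by rewrite mulr_ge0.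
  by rewrite ler_wpM2l.
have Sb0 : 0 <= \sum_(0 <= j <oo) (r ^+ j * be j)%:E.
  by apply: nneseries_ge0 => j _ _; rewrite lee_fin mulr_ge0.
have S0 : (0 <= S)%R by rewrite -lee_fin (le_trans Sb0).
exists W, q, (eps * S)%R; split; last split.
- split; first by rewrite q0.
  + by rewrite mulr_ge0// ltW.
  + exact: (@ge0_emeasurable_sum _ _ _ setT _ xpredT).
  + move=> x; rewrite /W nneseries_recl// expr0 mul1e leeDl//.
    by apply: nneseries_ge0.
- rewrite /W integral_nneseries//; apply: le_lt_trans (ltry S); apply: le_trans SM.
  apply: lee_nneseries => [j _ _|j _]; first exact: integral_ge0.
  by rewrite ge0_integralZl ?lee_fin// IM EFinM.
move=> x; rewrite /W integral_nneseries//.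
have kE j : \int[kiter P m x]_y ((r ^+ j)%:E * fj j y) =
    (q ^+ m)%:E * ((r ^+ j.+1)%:E * fj j.+1 x) + (eps * \1_C x)%:E * (r ^+ j * be j)%:E.
  rewrite ge0_integralZl ?lee_fin// -(residual_add P m C eps mB x (hs j)) beE.
  rewrite muleDr//; last by rewrite fin_num_adde_defl// -EFinM.
  congr (_ + _); last by rewrite -!EFinM; congr EFin; ring.
  by rewrite muleA -EFinM exprS mulrA mulfV ?mul1r// expf_neq0// lt0r_neq0.
under eq_eseriesr do rewrite kE.
have e0 : (0 <= eps * \1_C x)%R by rewrite mulr_ge0// ltW.
rewrite nneseriesD; last 2 first.
- by move=> j _ _; rewrite mule_ge0// lee_fin exprn_ge0// ltW.
- by move=> j _ _; rewrite -EFinM lee_fin mulr_ge0// mulr_ge0.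
apply: leeD.
  rewrite nneseriesZl//; apply: lee_wpmul2l; first by rewrite lee_fin exprn_ge0// ltW.
  rewrite [leRHS]nneseries_recl// -(nneseries_addn 1)//.
  by under [X in _ <= _ + X]eq_eseriesr do rewrite addn1; rewrite leeDr.
rewrite nneseriesZl => [|j _]; last by rewrite lee_fin mulr_ge0.
rewrite (_ : (eps * S * \1_C x)%:E = (eps * \1_C x)%:E * S%:E); last first.
  by rewrite -EFinM; congr EFin; ring.
by apply: lee_wpmul2l => //; rewrite lee_fin.
Qed.
End ResidualLyapunov.

Lemma sqf_add1_normc d (T : measurableType d) (R : realType) (mu : probability T R)
    (h : T -> R[i]) : L2 mu h -> sqf mu (EFin \o (fun x => 1 + normc (h x))%R).
Proof.
move=> /L2_csq[mh hh]; have mn := measurable_normc mh.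
have mg : measurable_fun setT (fun x => 1 + normc (h x))%R by exact: measurable_funD.
apply: sqf_EFin => // [x|]; first by rewrite addr_ge0// normc_ge0.
apply: (@le_lt_trans _ _ (\int[mu]_x (2%:E + 2%:E * ((normc (h x)) ^+ 2)%:E))).
  apply: ge0_le_integral => //.
  - by move=> x _; rewrite lee_fin sqr_ge0.
  - exact: measurable_sq.
  - apply: emeasurable_funD => //; apply: measurable_funeM; exact: measurable_sq.
  - move=> x _; rewrite -EFinM -EFinD lee_fin; set y := normc _.
    rewrite -subr_ge0 (_ : _ - _ = (1 - y) ^+ 2)%R ?sqr_ge0//; ring.
rewrite ge0_integralD//; last 2 first.
- by move=> x _; rewrite -EFinM lee_fin mulr_ge0// sqr_ge0.
- by apply: measurable_funeM; exact: measurable_sq.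
rewrite integral_prob_cst ge0_integralZl_EFin//; last 2 first.
- by move=> x _; rewrite lee_fin sqr_ge0.
- exact: measurable_sq.
by rewrite lte_add_pinfty// ?ltry// lte_mul_pinfty// ?lee_fin.
Qed.

Theorem theorem1p3 (R : realType) (d : measure_display) (T : measurableType d)
    (P : R.-pker T ~> T) (mu : probability T R)
    (hcg : countably_generated T)
    (hirr : psi_irreducible_aperiodic P)
    (hinv : invariant_probability P mu)
    (hgap : L2_spectral_gap mu P)
    (h : T -> R[i]) (hh : L2 mu h) :
  exists V : T -> \bar R,
    [/\ mu.-integrable setT V,
        geometrically_ergodic P V &
        LVinfty V h].
Proof.
have [m [C [B [eps' [[m1 mC mB eps'0] [C0 B0 minor']]]]]] :=
  exists_minorized_set hinv hirr hcg hgap.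
(* Lowering the constant keeps the minorization and gives the cap needed for the decay of the
   residual kernel. *)
pose eps := Num.min eps' (1 / 2)%R.
have eps0 : (0 < eps)%R by rewrite lt_min eps'0/=; lra.
have eps1 : (eps <= 1 / 2)%R by rewrite ge_min lexx orbT.
have minor x A : C x -> measurable A -> eps%:E * mu (A `&` B) <= kiter P m x A.
  move=> Cx mA; apply: le_trans (minor' x A Cx mA).
  by rewrite lee_wpmul2r// lee_fin ge_min lexx.
have [W [q [b [[/andP[q0 q1] b0 mW gW] [iW dW]]]]] :=
  residual_lyapunov hinv hirr hgap m1 mC mB eps0 eps1 C0 B0 minor (sqf_add1_normc hh).
have n0 x : (0 <= normc (h x))%R by exact: normc_ge0.
have W0 x : 0 <= W x.
  by apply: le_trans (gW x); rewrite lee_fin addr_ge0.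
pose V := root_lyapunov P m W q.
have mV : measurable_fun setT V by exact: measurable_root_lyapunov.
(* This one bound yields both V >= 1 and |h| / V <= 1. *)
have gV x : (1 + normc (h x))%:E <= V x.
  by apply: le_trans (gW x) _; exact: root_lyapunov_ge.
have V0 x : 0 <= V x by apply: le_trans (gV x); rewrite lee_fin addr_ge0.
have iV : mu.-integrable setT V.
  apply/integrableP; split => //; rewrite (eq_integral V) => [|x _]; last by rewrite gee0_abs.
  exact: integral_root_lyapunov.
exists V; split => //.
- split => //.
  + by move=> x; apply: le_trans (gV x); rewrite lee_fin lerDl.
  + have [x /(_ Logic.I) Vx] := ae_exists (integrable_ae measurableT iV).
    by exists x; rewrite -ge0_fin_numE.
  exists C, (1 - q)%R, (q^-1 ^+ m.-1 * b)%R; split; last 1 first.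
  + by move=> x; rewrite subKr; exact: root_lyapunov_drift.
  + exact: (small_set_of_minorization m1 mC mB eps0 B0 minor).
  + by rewrite subr_gt0.
split; first by case: hh.
apply: (@le_lt_trans _ _ 1); last exact: ltry.
apply: ge_ereal_sup => _ [x _ <-].
(* Where V is infinite the quotient is 0. *)
have := gV x; case: (V x) => [v||]//=; last by rewrite invey mule0.
rewrite lee_fin => hv; have v0 : (0 < v)%R by apply: lt_le_trans hv; rewrite ltr_pwDl.
by rewrite inver gt_eqF// -EFinM lee_fin ler_pdivrMr// mul1r; apply: le_trans hv; rewrite lerDr.
Qed.
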